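(* (Minimum modulus principle) Let $A\in\{\mathbb{C},\mathbb{H},\mathbb{O}\}$, let $\Omega\subseteq A$ be a circular open set and let $f\in\mathcal{SR}(\Omega)$. Suppose $x_0\in\Omega$ is a local minimum point for $|f|$, but not a zero of $f$. In case $x_0\in\partial V(f'_s)$, take one of the following additional assumptions: (a) there exists a circular neighbourhood $C$ of $x_0$ such that $|f(x_0)|=\min_C|f|$; or (b) there exist $w_0\in\mathbb{S}_{x_0}$ and an open neighbourhood $H$ of $w_0$ in $\Omega$ such that $T_f$ continuously extends to $H$ and the extension maps $w_0$ to $x_0$. If $\Omega$ is a slice domain, then $f$ is constant. If $\Omega$ is a product domain, then there exists $J\in\mathbb{S}$ such that $f_{|\Omega_J^+}\equiv f(x_0)$.
   Context: $A$ is one of the real $*$-algebras $\mathbb{C},\mathbb{H},\mathbb{O}$ (complex numbers, quaternions, octonions) with standard conjugation $x\mapsto x^c$, $|\cdot|$ is the Euclidean norm and $A$ has the Euclidean topology; $\operatorname{im}(x)=(x-x^c)/2$; $\mathbb{S}=\{w\in A: w^2=-1\}$; for $x=\alpha+\beta J$ with $\alpha,\beta\in\mathbb{R}$, $J\in\mathbb{S}$, $\mathbb{S}_x=\{\alpha+\beta I: I\in\mathbb{S}\}$. For $J\in\mathbb{S}$, $\mathbb{C}_J^+=\{\alpha+\beta J:\alpha,\beta\in\mathbb{R},\beta>0\}$ and $\Omega_J^+=\Omega\cap\mathbb{C}_J^+$. For nonempty $D\subseteq\mathbb{C}$ invariant under complex conjugation, $\Omega_D=\{\alpha+\beta J:\alpha,\beta\in\mathbb{R},\,J\in\mathbb{S},\,\alpha+i\beta\in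 D\}$; sets of this form are called circular. If $D$ is open, connected and intersects $\mathbb{R}$, $\Omega_D$ is a slice domain; if $D$ is open, does not intersect $\mathbb{R}$ and has two connected components switched by complex conjugation, $\Omega_D$ is a product domain. For $D$ open and $\Omega=\Omega_D$, $\mathcal{SR}(\Omega)$ is the set of slice regular functions: functions $f:\Omega\to A$ for which there are $C^1$ functions $F_1,F_2:D\to A$ with $F_1(\bar z)=F_1(z)$, $F_2(\bar z)=-F_2(z)$, $f(\alpha+\beta J)=F_1(\alpha+i\beta)+JF_2(\alpha+i\beta)$ for all $\alpha+i\beta\in D$, $J\in\mathbb{S}$, and $\partial F_1/\partial\alpha=\partial F_2/\partial\beta$, $\partial F_1/\partial\beta=-\partial F_2/\partial\alpha$. The slice product of functions corresponding to $(F_1,F_2),(G_1,G_2)$ corresponds to $(F_1G_1-F_2G_2,\;F_1G_2+F_2G_1)$; the slice conjugate $f^c$ corresponds to $(F_1^c,F_2^c)$; $N(f)=f\cdot f^c$. $V(h)$ is the zero set of $h$ in its domain. The spherical derivative $f'_s:\Omega\setminus\mathbb{R}\to A$ is $f'_s(x)=\frac12\operatorname{im}(x)^{-1}(f(x)-f(x^c))$. $\partial V(f'_s)$ denotes the closure of $V(f'_s)$ minus its interior. With $\Omega'=\Omega\setminus V(N(f))$ and $\Omega''=\Omega'\setminus(\mathbb{R}\cup V(f'_s))$, the map $T_f:\Omega''\to\Omega''$ (a bijection preserving each $\mathbb{S}_x\subseteq\Omega''$) is $$T_f(x)=\big(f^c(x)^{-1}\big((xf^c(x))f'_s(x)\big)\big)f'_s(x)^{-1}.$$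 In (b), ''continuously extends to $H$'' means that there is a continuous map $\Omega''\cup H\to A$ agreeing with $T_f$ on $\Omega''$. *)

(* Defs.v *)
From HB Require Import structures.
From mathcomp Require Import all_boot all_order all_algebra.
From mathcomp Require Import all_classical all_reals all_analysis.
Set Implicit Arguments.
Unset Strict Implicit.
Unset Printing Implicit Defensive.
Import Order.TTheory GRing.Theory Num.Theory.
Import numFieldNormedType.Exports.
Local Open Scope classical_set_scope.
Local Open Scope ring_scope.

(* The Cayley-Dickson tower: [cd R 1], [cd R 2], [cd R 3] are the complex      *)
(* numbers, the quaternions and the octonions over [R].  As a normed module,   *)
(* [cd R n] carries the sup norm of its coordinates: it is used only for its   *)
(* topology, which is the Euclidean one.  The Euclidean norm is [cdnorm].      *)
Fixpoint cd (R : realType) (n : nat) : normedModType R :=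
  match n with
  | 0 => (R^o : normedModType R)
  | m.+1 => ((cd R m * cd R m)%type : normedModType R)
  end.

Fixpoint cdone (R : realType) (n : nat) : cd R n :=
  match n return cd R n with
  | 0 => (1 : R)
  | m.+1 => (cdone R m, 0)
  end.

Fixpoint cdre (R : realType) (n : nat) : cd R n -> R :=
  match n return cd R n -> R with
  | 0 => fun x : R => x
  | m.+1 => fun x : cd R m * cd R m => cdre x.1
  end.

Fixpoint cdconj (R : realType) (n : nat) : cd R n -> cd R n :=
  match n return cd R n -> cd R n with
  | 0 => fun x : R => x
  | m.+1 => fun x : cd R m * cd R m => (cdconj x.1, - x.2)
  end.

Fixpoint cdmul (R : realType) (n : nat) : cd R n -> cd R n -> cd R n :=
  match n return cd R n -> cd R n -> cd R n with
  | 0 => fun x y : R => x * y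
  | m.+1 => fun x y : cd R m * cd R m =>
      (cdmul x.1 y.1 - cdmul (cdconj y.2) x.2,
       cdmul y.2 x.1 + cdmul x.2 (cdconj y.1))
  end.

(* Multiplication is not associative for n = 3: parentheses matter. *)
Notation "x ** y" := (cdmul x y) (at level 40, left associativity) : ring_scope.

Fixpoint cdnormsq (R : realType) (n : nat) : cd R n -> R :=
  match n return cd R n -> R with
  | 0 => fun x : R => x ^+ 2
  | m.+1 => fun x : cd R m * cd R m => cdnormsq x.1 + cdnormsq x.2
  end.

Definition cdnorm (R : realType) (n : nat) (x : cd R n) : R :=
  Num.sqrt (cdnormsq x).

Definition cdinv (R : realType) (n : nat) (x : cd R n) : cd R n :=
  (cdnormsq x)^-1 *: cdconj x.

Definition cdim (R : realType) (n : nat) (x : cd R n) : cd R n :=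
  2^-1 *: (x - cdconj x).

Definition real_axis (R : realType) (n : nat) : set (cd R n) :=
  [set x | exists a : R, x = a *: cdone R n].

Definition imag_units (R : realType) (n : nat) : set (cd R n) :=
  [set w | w ** w = - cdone R n].

(* The pair (a, b) stands for the complex number a + i b. *)
Notation plane R := ((R^o * R^o)%type).

Definition plane_conj (R : realType) (z : plane R) : plane R := (z.1, - z.2).

Definition on_slice (R : realType) (n : nat) (J : cd R n) (z : plane R) :
    cd R n :=
  (z.1 : R) *: cdone R n + (z.2 : R) *: J.

Definition sphere_of (R : realType) (n : nat) (x : cd R n) : set (cd R n) :=
  [set y | exists z J I, [/\ imag_units J, imag_units I,
                             x = on_slice J z & y = on_slice I z]].

Definition half_slice (R : realType) (n : nat) (Omega : set (cd R n))
    (J : cd R n) : set (cd R n) :=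
  Omega `&` [set x | exists2 z : plane R, 0 < (z.2 : R) & x = on_slice J z].

Definition circularization (R : realType) (n : nat) (D : set (plane R)) :
    set (cd R n) :=
  [set x | exists z J, [/\ D z, imag_units J & x = on_slice J z]].

Definition circularizes (R : realType) (n : nat) (D : set (plane R))
    (Omega : set (cd R n)) : Prop :=
  [/\ D !=set0, (forall z, D z -> D (plane_conj z)) &
      Omega = circularization D].

Definition circular (R : realType) (n : nat) (Omega : set (cd R n)) : Prop :=
  exists D, circularizes D Omega.

Definition slice_domain (R : realType) (n : nat) (Omega : set (cd R n)) :
    Prop :=
  exists D, [/\ circularizes D Omega, open D, connected D &
                exists2 z, D z & (z.2 : R) = 0].

Definition product_domain (R : realType) (n : nat) (Omega : set (cd R n)) :
    Prop :=
  exists D, [/\ circularizes D Omega, open D,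
                (forall z, D z -> (z.2 : R) != 0) &
                exists D1 D2 : set (plane R),
                  [/\ D1 <> D2,
                      [set connected_component D z | z in D] = [set D1; D2],
                      @plane_conj R @` D1 = D2 & @plane_conj R @` D2 = D1]].

Definition d_alpha (R : realType) (n : nat) (F : plane R -> cd R n) :
    plane R -> cd R n :=
  'D_((1, 0) : plane R) F.

Definition d_beta (R : realType) (n : nat) (F : plane R -> cd R n) :
    plane R -> cd R n :=
  'D_((0, 1) : plane R) F.

Definition C1_on (R : realType) (n : nat) (D : set (plane R))
    (F : plane R -> cd R n) : Prop :=
  forall z, D z ->
    [/\ derivable F z ((1, 0) : plane R), derivable F z ((0, 1) : plane R),
        {for z, continuous (d_alpha F)} & {for z, continuous (d_beta F)}].

(* A stem is a pair (F_1, F_2); its values outside D are irrelevant. *)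
Definition stem (R : realType) (n : nat) : Type :=
  ((plane R -> cd R n) * (plane R -> cd R n))%type.

Definition regular_stem (R : realType) (n : nat) (D : set (plane R))
    (F : stem R n) : Prop :=
  [/\ C1_on D F.1, C1_on D F.2,
      (forall z, D z ->
         F.1 (plane_conj z) = F.1 z /\ F.2 (plane_conj z) = - F.2 z) &
      (forall z, D z ->
         d_alpha F.1 z = d_beta F.2 z /\ d_beta F.1 z = - d_alpha F.2 z)].

Definition induces (R : realType) (n : nat) (D : set (plane R)) (F : stem R n)
    (f : cd R n -> cd R n) : Prop :=
  forall z J, D z -> imag_units J ->
    f (on_slice J z) = F.1 z + J ** F.2 z.

(* Functions on Omega are represented by total functions whose values outside  *)
(* Omega are irrelevant.                                                       *)
Definition is_stem_of (R : realType) (n : nat) (Omega : set (cd R n))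
    (f : cd R n -> cd R n) (F : stem R n) : Prop :=
  exists D, [/\ circularizes D Omega, open D, regular_stem D F &
                induces D F f].

Definition slice_regular (R : realType) (n : nat) (Omega : set (cd R n))
    (f : cd R n -> cd R n) : Prop :=
  exists F, is_stem_of Omega f F.

(* Omega determines D, and f determines the values of its stem on D. *)
Definition stem_of (R : realType) (n : nat) (Omega : set (cd R n))
    (f : cd R n -> cd R n) : stem R n :=
  xget ((fun=> 0), (fun=> 0)) (is_stem_of Omega f).

(* Here x = a + b J with a = re x, b = |im x| and J = im x / |im x|; for real  *)
(* x the second summand vanishes, as does F_2 on the real axis.                *)
Definition slice_fun (R : realType) (n : nat) (F : stem R n) (x : cd R n) :
    cd R n :=
  let z : plane R := (cdre x, cdnorm (cdim x)) in
  F.1 z + ((cdnorm (cdim x))^-1 *: cdim x) ** F.2 z.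

Definition slice_prod (R : realType) (n : nat) (Omega : set (cd R n))
    (f g : cd R n -> cd R n) : cd R n -> cd R n :=
  let F := stem_of Omega f in
  let G := stem_of Omega g in
  slice_fun ((fun z => F.1 z ** G.1 z - F.2 z ** G.2 z),
             (fun z => F.1 z ** G.2 z + F.2 z ** G.1 z)).

Definition slice_conj (R : realType) (n : nat) (Omega : set (cd R n))
    (f : cd R n -> cd R n) : cd R n -> cd R n :=
  let F := stem_of Omega f in
  slice_fun ((fun z => cdconj (F.1 z)), (fun z => cdconj (F.2 z))).

Definition normal_fun (R : realType) (n : nat) (Omega : set (cd R n))
    (f : cd R n -> cd R n) : cd R n -> cd R n :=
  slice_prod Omega f (slice_conj Omega f).

Definition spherical_derivative (R : realType) (n : nat)
    (f : cd R n -> cd R n) (x : cd R n) : cd R n :=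
  2^-1 *: (cdinv (cdim x) ** (f x - f (cdconj x))).

Definition zeros (R : realType) (n : nat) (dom : set (cd R n))
    (h : cd R n -> cd R n) : set (cd R n) :=
  dom `&` [set x | h x = 0].

(* V(f'_s), where f'_s has domain Omega \ R *)
Definition sd_zeros (R : realType) (n : nat) (Omega : set (cd R n))
    (f : cd R n -> cd R n) : set (cd R n) :=
  zeros (Omega `\` @real_axis R n) (spherical_derivative f).

Definition frontier (R : realType) (n : nat) (V : set (cd R n)) :
    set (cd R n) :=
  closure V `\` interior V.

Definition Omega' (R : realType) (n : nat) (Omega : set (cd R n))
    (f : cd R n -> cd R n) : set (cd R n) :=
  Omega `\` zeros Omega (normal_fun Omega f).

Definition Omega'' (R : realType) (n : nat) (Omega : set (cd R n))
    (f : cd R n -> cd R n) : set (cd R n) :=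
  Omega' Omega f `\` (@real_axis R n `|` sd_zeros Omega f).

Definition T_map (R : realType) (n : nat) (Omega : set (cd R n))
    (f : cd R n -> cd R n) (x : cd R n) : cd R n :=
  let fc := slice_conj Omega f in
  let fs := spherical_derivative f in
  (cdinv (fc x) ** ((x ** fc x) ** fs x)) ** cdinv (fs x).

Definition local_min_norm (R : realType) (n : nat) (Omega : set (cd R n))
    (f : cd R n -> cd R n) (x0 : cd R n) : Prop :=
  Omega x0 /\
  \forall x \near x0, Omega x -> cdnorm (f x0) <= cdnorm (f x).

Definition min_on_circular_nbhs (R : realType) (n : nat)
    (Omega : set (cd R n)) (f : cd R n -> cd R n) (x0 : cd R n) : Prop :=
  exists C : set (cd R n),
    [/\ circular C, nbhs x0 C, C `<=` Omega &
        forall x, C x -> cdnorm (f x0) <= cdnorm (f x)].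

Definition T_extends_to (R : realType) (n : nat)
    (Omega : set (cd R n)) (f : cd R n -> cd R n) (x0 : cd R n) : Prop :=
  exists w0 (H : set (cd R n)) (G : cd R n -> cd R n),
    [/\ sphere_of x0 w0, [/\ open H, H w0 & H `<=` Omega],
        {within Omega'' Omega f `|` H, continuous G},
        (forall x, Omega'' Omega f x -> G x = T_map Omega f x) &
        G w0 = x0].

(* Main.v *)
Require Import Defs.
From HB Require Import structures.
From mathcomp Require Import all_boot all_order all_algebra.
From mathcomp Require Import all_classical all_reals all_analysis.
From mathcomp Require Import ring lra.
Set Implicit Arguments.
Unset Strict Implicit.
Unset Printing Implicit Defensive.
Import Order.TTheory GRing.Theory Num.Theory.
Import numFieldNormedType.Exports.
Local Open Scope classical_set_scope.
Local Open Scope ring_scope.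

(* Write [a] for the value at [alpha + beta I] of the slice conjugate of [f],  *)
(* and [nu] for [|N(f)|^2], which depends on [alpha + i beta] only.  If [J]    *)
(* satisfies [a (J F2) = (I a) F2], as does the direction of [T_f], then       *)
(* [|a|^2 |f(alpha + beta J)|^2 = nu]; so a local minimum of [|f|] becomes a   *)
(* local maximum of [|a|^2 / nu] at some [w0] in the sphere of [x0], provided  *)
(* all points near [w0] are reached from points near [x0].                     *)
(* Off [V(f'_s)], [|f|^2] is affine in [J] on spheres: if it is not constant   *)
(* on the sphere of [x0], then [x0] minimizes it on the whole sphere and the   *)
(* minimizer moves continuously; if it is constant, [T_f] is continuous.       *)
(* On [V(f'_s)], one argues by (a), by (b), or [F2] vanishes identically.      *)
(* The maximum principle on the slice of [w0] makes [N(f)^-1 f^c] equal to a   *)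
(* constant [c] on that slice.  As the octonions are not associative this is   *)
(* not enough; but the maximality over nearby slices forces                    *)
(* [conj F1 F2] into the plane of [I], so that everything takes place in the   *)
(* associative subalgebra generated by [I] and [c], and [f] is constant on     *)
(* the half slice of [J = c^-1 I c].  (For [A] the complex numbers, one uses   *)
(* [1 / f] directly.)  The identity theorem then globalizes.                   *)
(* As stems are only assumed to be C^1, the maximum principle rests on the     *)
(* mean value property for equally spaced points on circles, and the identity  *)
(* theorem on the maximum principle applied to quotients by [(w - z0)^N].      *)

(** * Holomorphic pairs and the maximum principle *)

(** If [f] were holomorphic without zeros, [1 / f] would have a local maximum of its modulus and
    would be constant. Here the role of [1 / f] is played by [g = N(f)^-1 f^c]. It satisfies
    [|g(w)| = 1 / |f(T_f(w))|], because the direction of [T_f] makes [f^c(w)] times [f(T_f(w))]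
    equal to the value of [N(f)] at [w] ([conj_val_mul], [Tdir_rel]).

    On a single slice [g] splits into pairs of conjugate harmonic functions ([stem_holo_slice],
    [stem_holo_nrm]), so a maximum of [|g|] there makes [g] a constant [c] ([slice_max_modulus]). To
    return from [g = c] to [f] without associativity, the maximum is also compared with nearby
    slices: a linear form with a local extremum on the unit imaginary sphere is parallel to that
    point ([affine_local_min]). Hence the imaginary part of [conj F1 F2] is a multiple of [I], and
    [slice_constant] computes in one plane. [local_slice_constant] joins these steps.

    It remains to turn a minimum of [|f|] near [x0] into a maximum of [|g|] near some point of its
    sphere. If [|f|] is not constant on that sphere, [near_sphere_min] and [local_sphere_min] do it;
    if it is constant but [F2] is not zero, [local_gap0] does. Where [F2] vanishes, [x0] may be
    real, so that nearby spheres shrink to it ([near_real_sphere]), or interior to [V(f'_s)]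
    ([local_spherically_constant]), or on its frontier, where (a) leads to [local_sphere_min] and
    (b) to [local_degenerate]. The complex case, which has no orthogonal imaginary units, is
    [local_complex]. [local_minimum] collects the cases, and [identity_theorem] spreads the local
    constancy over a component of [D]. *)

Section Partials.
Variable R : realType.
Implicit Types (D : set (plane R)) (u v p q : plane R -> R) (z w : plane R).

Definition lin2 (a b : R) (w : plane R) : R := a * (w.1 : R) + b * (w.2 : R).

Lemma lin2_linear (a b : R) : linear (lin2 a b : plane R -> R^o).
Proof. by move=> k x y; rewrite /lin2 /=; rewrite /GRing.scale /=; ring. Qed.

HB.instance Definition _ (a b : R) :=
  GRing.isLinear.Build R (plane R) (R^o) _ (lin2 a b : plane R -> R^o) (lin2_linear a b).

Lemma lin2_continuous (a b : R) : continuous (lin2 a b : plane R -> R^o).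
Proof.
move=> z; apply: cvgD; apply: cvgM; try exact: cvg_cst.
  exact: cvg_fst.
exact: cvg_snd.
Qed.

Lemma is_diff_lin2 (u : plane R -> R^o) (a b : R) z :
  (forall e : R, 0 < e -> \forall w \near (0 : plane R),
     `| u (w + z) - u z - lin2 a b w | <= e * `|w|) ->
  is_diff z (u : plane R -> R^o) (lin2 a b : plane R -> R^o).
Proof.
move=> H.
have E : u \o shift z = cst (u z) + (lin2 a b : plane R -> R^o) +o_ (0 : plane R) id.
  apply/eqaddoP => e e0; have := H e e0; rewrite !near_simpl; apply: filterS => w /=.
  by move=> h; have -> : (u \o +%R^~ z - (cst (u z) + lin2 a b)) w = u (w + z) - u z - lin2 a b w by rewrite -addrA -opprD.
have dE := @diff_unique R (plane R) R^o u (lin2 a b) z (@lin2_continuous a b) E.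
constructor => //.
apply/diff_locallyP; split.
  rewrite dE; exact: lin2_continuous.
by rewrite dE.
Qed.

Lemma is_derive_line (u : plane R -> R) (a : R) z w (t : R) :
  is_derive (z + t *: w) w (u : plane R -> R^o) a ->
  is_derive t 1 (fun s : R => u (z + s *: w)) a.
Proof.
move=> [h1 h2].
have E : (fun h : R => h^-1 *: (((fun s : R => u (z + s *: w)) \o shift t) (h *: (1:R^o)) - u (z + t *: w)))
  = (fun h : R => h^-1 *: (((u : plane R -> R^o) \o shift (z + t *: w)) (h *: w) - u (z + t *: w))).
  apply/funext => h /=; congr (_ *: (u _ - _)).
  by rewrite /GRing.scale/= mulr1 -/(GRing.scale _ _) scalerDl addrCA.
split; first by rewrite /derivable E.
by rewrite /derive E.
Qed.

Lemma MVT_origin (f df : R -> R) (t : R) :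
  (forall s : R, `|s| <= `|t| -> is_derive s 1 f (df s)) ->
  exists2 c : R, `|c| <= `|t| & f t - f 0 = df c * t.
Proof.
move=> H.
have cf (a b : R) : `|a| <= `|t| -> `|b| <= `|t| -> {within `[a, b], continuous f}.
  move=> at' bt; apply: derivable_within_continuous => s; rewrite in_itv /= => /andP[sa sb].
  by apply: ex_derive; apply: H; move: at' bt sa sb; rewrite !ler_norml; lra.
have n0 : `|0 : R| <= `|t| by rewrite normr0.
case: (leP 0 t) => [t0|t0].
- have [|c] := @MVT_segment R f df 0 t t0 _ (cf _ _ n0 (lexx _)).
    move=> s; rewrite in_itv /= => /andP[sa sb]; apply: H.
    by rewrite ler_norml; have := ger0_norm t0; lra.
  rewrite in_itv /= => /andP[ca cb]; rewrite subr0 => E.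
  exists c => //; by rewrite ler_norml (ger0_norm t0); lra.
- have [|c] := @MVT_segment R f df t 0 (ltW t0) _ (cf _ _ (lexx _) n0).
    move=> s; rewrite in_itv /= => /andP[sa sb]; apply: H.
    by rewrite ler_norml (ltr0_norm t0); lra.
  rewrite in_itv /= => /andP[ca cb] E.
  exists c; last by move: E; lra.
  by rewrite ler_norml (ltr0_norm t0); lra.
Qed.

Lemma near_plane (z : plane R) (P : plane R -> Prop) :
  (\forall w \near z, P w) <->
  exists2 d : R, 0 < d & forall w : plane R, `|w.1 - z.1 : R| < d -> `|w.2 - z.2 : R| < d -> P w.
Proof.
split.
  move=> /nbhs_ballP[d d0 H]; exists d => // w h1 h2; apply: H.
  by split; rewrite -ball_normE /= distrC.
move=> [d d0 H]; apply/nbhs_ballP; exists d => // w [].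
rewrite -!ball_normE /= => h1 h2; by apply: H; rewrite distrC.
Qed.

(** The increment is split along two axis-parallel segments, with the mean value theorem on each.
    Stems come with partial derivatives only, while the chain rule along circles requires a total
    differential. *)
Lemma C1_is_diff (u a b : plane R -> R) z :
  (\forall w \near z, is_derive w ((1, 0) : plane R) (u : plane R -> R^o) (a w)) ->
  (\forall w \near z, is_derive w ((0, 1) : plane R) (u : plane R -> R^o) (b w)) ->
  {for z, continuous a} -> {for z, continuous b} ->
  is_diff z (u : plane R -> R^o) (lin2 (a z) (b z) : plane R -> R^o).
Proof.
move=> H1 H2 ca cb; apply: is_diff_lin2 => e e0.
have e2 : 0 < e / 2 by rewrite divr_gt0.
have /near_plane[d d0 H] : \forall w \near z,
  [/\ is_derive w ((1, 0) : plane R) (u : plane R -> R^o) (a w),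
      is_derive w ((0, 1) : plane R) (u : plane R -> R^o) (b w),
      `|a z - a w| < e / 2 & `|b z - b w| < e / 2].
  move/cvgrPdist_lt: ca => /(_ _ e2) ca; move/cvgrPdist_lt: cb => /(_ _ e2) cb.
  by near=> w; split; near: w.
apply/near_plane; exists d => // w /=; rewrite !subr0 => w1 w2.
pose e1 : plane R := (1, 0); pose e2' : plane R := (0, 1).
have P1 (s : R) : z + s *: e1 = (z.1 + s, z.2).
  by apply: injective_projections; rewrite /= /GRing.scale /=; ring.
have P2 (s : R) : z + (w.1 : R) *: e1 + s *: e2' = (z.1 + w.1, z.2 + s).
  by rewrite P1; apply: injective_projections; rewrite /= /GRing.scale /=; ring.
have [s sw|c1 c1w E1] := @MVT_origin (fun s : R => u (z + s *: e1))
   (fun s => a (z + s *: e1)) w.1.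
  apply: is_derive_line; rewrite P1.
  have [||h _ _ _] := H (z.1 + s, z.2); last exact: h.
    by rewrite /= addrC addKr; exact: le_lt_trans sw w1.
  by rewrite /= subrr normr0.
have [s sw|c2 c2w E2] := @MVT_origin (fun s : R => u ((z + (w.1 : R) *: e1) + s *: e2'))
   (fun s => b ((z + (w.1 : R) *: e1) + s *: e2')) w.2.
  apply: is_derive_line; rewrite P2.
  have [||_ h _ _] := H (z.1 + w.1, z.2 + s); last exact: h.
    by rewrite /= addrC addKr.
  by rewrite /= addrC addKr; exact: le_lt_trans sw w2.
move: E1 E2; rewrite !scale0r !addr0 !P2 !P1.
have -> : w + z = (z.1 + w.1, z.2 + w.2) by rewrite addrC; case: (w).
have -> : u z = u (z.1, z.2) by case: (z).
move=> E1 E2.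
have -> : u (z.1 + w.1, z.2 + w.2) - u (z.1, z.2) - lin2 (a z) (b z) w =
   (a (z.1 + c1, z.2) - a z) * w.1 + (b (z.1 + w.1, z.2 + c2) - b z) * w.2.
  by rewrite /lin2 !mulrBl -E1 -E2; ring.
have A1 : `|a z - a (z.1 + c1, z.2)| < e / 2.
  have [||_ _ h _] := H (z.1 + c1, z.2); last exact: h.
    by rewrite /= addrC addKr; exact: le_lt_trans c1w w1.
  by rewrite /= subrr normr0.
have A2 : `|b z - b (z.1 + w.1, z.2 + c2)| < e / 2.
  have [||_ _ _ h] := H (z.1 + w.1, z.2 + c2); last exact: h.
    by rewrite /= addrC addKr.
  by rewrite /= addrC addKr; exact: le_lt_trans c2w w2.
have n1 : `|w.1 : R| <= `|w| by rewrite prod_normE le_max lexx.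
have n2 : `|w.2 : R| <= `|w| by rewrite prod_normE le_max lexx orbT.
rewrite (splitr e) [leRHS]mulrDl; apply: le_trans (ler_normD _ _) _.
apply: lerD; rewrite normrM; apply: ler_pM => //; rewrite distrC; exact: ltW.
Unshelve. all: by end_near.
Qed.

Lemma is_derive_curve (u : plane R -> R) (a b : R) (x y : R -> R) (t dx dy : R) :
  is_derive t 1 x dx -> is_derive t 1 y dy ->
  is_diff ((x t, y t) : plane R) (u : plane R -> R^o) (lin2 a b : plane R -> R^o) ->
  is_derive t 1 (fun s => u (x s, y s)) (a * dx + b * dy).
Proof.
move=> [hx ex] [hy ey] [hu eu].
have dfx : differentiable x t by apply/derivable1_diffP.
have dfy : differentiable y t by apply/derivable1_diffP.
have dg : differentiable (fun s => (x s : R^o, y s : R^o)) t by apply: differentiable_pair.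
have dc : differentiable ((u : plane R -> R^o) \o (fun s => (x s : R^o, y s : R^o))) t.
  exact: differentiable_comp.
split; first exact: diff_derivable.
rewrite deriveE // diff_comp // eu /= diff_pair //.
by rewrite /lin2 /= -!deriveE // ex ey.
Qed.

(* [u + i v] is holomorphic at [z] with derivative [p + i q], which is         *)
(* continuous at [z].                                                          *)
Definition holo_at u v p q z :=
  [/\ is_diff z (u : plane R -> R^o) (lin2 (p z) (- q z) : plane R -> R^o),
      is_diff z (v : plane R -> R^o) (lin2 (q z) (p z) : plane R -> R^o),
      {for z, continuous p} & {for z, continuous q}].

Definition polar (z : plane R) (s t : R) : plane R := (z.1 + s * cos t, z.2 + s * sin t).

Lemma holo_radial u v p q z s t : holo_at u v p q (polar z s t) ->
  is_derive s 1 (fun s => u (polar z s t))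
    (p (polar z s t) * cos t - q (polar z s t) * sin t).
Proof.
move=> [h _ _ _]; rewrite -mulNr; apply: is_derive_curve => //.
  by apply: is_derive_eq; rewrite add0r /GRing.scale /= ; ring.
by apply: is_derive_eq; rewrite add0r /GRing.scale /= ; ring.
Qed.

(** With [holo_radial], the Cauchy-Riemann equations in polar coordinates: the angular derivative of
    [v] is [s] times the radial derivative of [u]. *)
Lemma holo_angular u v p q z s t : holo_at u v p q (polar z s t) ->
  is_derive t 1 (fun t => v (polar z s t))
    (s * (p (polar z s t) * cos t - q (polar z s t) * sin t)).
Proof.
move=> [_ h _ _].
rewrite [X in is_derive _ _ _ X](_ : _ = q (polar z s t) * (s * - sin t) + p (polar z s t) * (s * cos t)); last by ring.
apply: is_derive_curve => //.
  by apply: is_derive_eq; rewrite add0r /GRing.scale /= ; ring.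
by apply: is_derive_eq; rewrite add0r /GRing.scale /= ; ring.
Qed.

(** Continuity is taken in the ambient space, so [y] may lie outside [K]. *)
Lemma compact_unif_cont (T : pseudoMetricType R) (K : set T) (f : T -> R) (e : R) :
  compact K -> (forall x, K x -> {for x, continuous f}) -> 0 < e ->
  exists2 d : R, 0 < d & forall x y, K x -> ball x d y -> `|f x - f y| < e.
Proof.
move=> /compact_near_coveringP cK cf e0.
have := cK R (0^'+) (fun d x => forall y, ball x d y -> `|f x - f y| < e) _.
case.
  have e2 : 0 < e / 2 by rewrite divr_gt0.
  move=> x Kx; have /cvgrPdist_lt/(_ _ e2)/nbhs_ballP[] := cf x Kx.
  move=> d /= d0 H; exists (ball x (d / 2), [set d' | 0 < d' < d / 2]) => /=.
    split; first by apply: nbhsx_ballx; rewrite divr_gt0.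
    near=> d'; apply/andP; split => //; near: d'.
    by apply: nbhs_right_lt; rewrite divr_gt0.
  move=> [x' d'] /= [xx' /andP[d'0 d'd]] y x'y.
  rewrite (splitr e).
  have h1 : `|f x - f x'| < e / 2.
    by apply: H; apply: le_ball xx'; lra.
  have h2 : `|f x - f y| < e / 2.
    apply: H; rewrite (splitr d); apply: (ball_triangle xx').
    by apply: le_ball x'y; apply: ltW.
  rewrite (_ : f x' - f y = (f x - f y) - (f x - f x')); last by ring.
  by apply: le_lt_trans (ler_normB _ _) _; apply: ltrD.
move=> d /= d0 H; exists (d / 2); first by rewrite divr_gt0.
move=> x y Kx; apply: H => //=; last by rewrite divr_gt0.
rewrite sub0r normrN gtr0_norm ?divr_gt0//; lra.
Unshelve. all: by end_near.
Qed.
End Partials.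

(** * Mean value property on circles *)

Section MeanValue.
Variable R : realType.
Implicit Types (D : set (plane R)) (u v p q : plane R -> R) (z w : plane R).

Lemma polar_continuous z (st : R * R) : {for st, continuous (fun st : R * R => polar z st.1 st.2)}.
Proof.
have c1 : (fun st : R * R => st.1) @ st --> st.1 by exact: cvg_fst.
have c2 : (fun st : R * R => st.2) @ st --> st.2 by exact: cvg_snd.
have h1 : (fun st : R * R => (z.1 : R) + st.1 * cos st.2) @ st --> (z.1 : R) + st.1 * cos st.2.
  apply: cvgD; first exact: cvg_cst.
  by apply: cvgM => //; apply: (cvg_comp _ _ c2); exact: continuous_cos.
have h2 : (fun st : R * R => (z.2 : R) + st.1 * sin st.2) @ st --> (z.2 : R) + st.1 * sin st.2.
  apply: cvgD; first exact: cvg_cst.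
  by apply: cvgM => //; apply: (cvg_comp _ _ c2); exact: continuous_sin.
exact: (cvg_pair h1 h2).
Qed.

(* Discrete mean value property.  The derivative in the radius of the average  *)
(* of [u] over [N] equally spaced points is, up to the modulus of continuity   *)
(* of the derivative, a telescoping sum of increments of [v].                  *)
Lemma circle_mean u v p q z (r t0 e : R) : 0 < r -> 0 < e ->
  (forall s t, 0 <= s <= r -> holo_at u v p q (polar z s t)) ->
  exists N0, forall N, (N0 <= N)%N -> (0 < N)%N ->
   `|\sum_(0 <= k < N) (u (polar z r (t0 + k%:R * (2 * pi / N%:R))) - u z)| <= N%:R * e.
Proof.
move=> r0 e0 H.
(* [W] is the radial derivative of [u]; multiplied by the radius it is the angular derivative of
   [v]. *)
pose W (st : R * R) : R := p (polar z st.1 st.2) * cos st.2 - q (polar z st.1 st.2) * sin st.2.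
pose K : set (R * R) := `[0, r]%classic `*` `[t0, t0 + 2 * pi]%classic.
have cK : compact K by apply: compact_setX; exact: segment_compact.
have cW st : K st -> {for st, continuous W}.
  move=> [/=]; rewrite !in_itv/= => sr _; have [_ _ cp cq] := H _ st.2 sr.
  have cP := @polar_continuous z st.
  have c2 : (fun st : R * R => st.2) @ st --> st.2 by exact: cvg_snd.
  apply: cvgB; apply: cvgM.
  - exact: (cvg_comp _ _ cP cp).
  - by apply: (cvg_comp _ _ c2); exact: continuous_cos.
  - exact: (cvg_comp _ _ cP cq).
  - by apply: (cvg_comp _ _ c2); exact: continuous_sin.
have er : 0 < e / r by rewrite divr_gt0.
have [d d0 dW] := compact_unif_cont cK cW er.
have pi2 : 0 < 2 * pi :> R by rewrite mulr_gt0 // pi_gt0.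
exists (Num.truncn (2 * pi / d)).+1 => N N0N N0.
have Ngt : 2 * pi / d < N%:R.
  by apply: lt_le_trans (truncnS_gt _) _; rewrite ler_nat.
have NR : 0 < N%:R :> R by rewrite ltr0n.
pose h : R := 2 * pi / N%:R.
have h0 : 0 < h by rewrite divr_gt0.
have hd : h < d by rewrite /h ltr_pdivrMr// -ltr_pdivrMl// mulrC.
pose t (k : nat) : R := t0 + k%:R * h.
have NhE : N%:R * h = 2 * pi by rewrite /h mulrC divfK// gt_eqF.
pose A (s : R) := \sum_(0 <= k < N) u (polar z s (t k)).
pose A' (s : R) := \sum_(0 <= k < N) W (s, t k).
have dA s : 0 <= s <= r -> is_derive s 1 A (A' s).
  move=> sr.
  have E : A = \sum_(k < N) (fun s => u (polar z s (t k))).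
    by apply/funext => x; rewrite /A big_mkord fct_sumE.
  rewrite E /A' big_mkord; apply: is_derive_sum => k.
  exact: holo_radial (H _ _ sr).
have dA' s : s \in `]0, r[%R -> is_derive s 1 A (A' s).
  by rewrite in_itv/= => /andP[s0 sr]; apply: dA; rewrite !ltW.
have cA : {within `[0, r], continuous A}.
  apply: derivable_within_continuous => s; rewrite in_itv /= => sr.
  by have [] := dA s sr.
have [x xr Ex] := MVT r0 dA' cA.
move: xr; rewrite in_itv/= => /andP[x0 xr].
have xr' : 0 <= x <= r by rewrite !ltW.
have -> : \sum_(0 <= k < N) (u (polar z r (t0 + k%:R * (2 * pi / N%:R))) - u z) = A r - A 0.
  rewrite /A -sumrB; apply: eq_bigr => k _; congr (_ - u _).
  by rewrite /polar !mul0r !addr0; case: (z).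
rewrite Ex subr0 normrM (gtr0_norm r0).
suff B : `|A' x| <= N%:R * (e / r).
  by apply: le_trans (ler_wpM2r (ltW r0) B) _; rewrite -mulrA divfK// gt_eqF.
(* The sample point of index [N] is the first one after a full turn. *)
have tel : \sum_(0 <= k < N) (v (polar z x (t k.+1)) - v (polar z x (t k))) = 0.
  rewrite telescope_sumr// /t NhE mul0r addr0 /polar.
  rewrite (mulrC 2 pi) [pi * 2]mulr_natr mulr2n addrA.
  by rewrite !cosDpi !sinDpi !opprK subrr.
have K1 k : (k < N)%N -> `|x * h * W (x, t k) - (v (polar z x (t k.+1)) - v (polar z x (t k)))| <= x * h * (e / r).
  move=> kN.
  have tk : t k < t k.+1 by rewrite /t -natr1 mulrDl mul1r; lra.
  have cv : {within `[t k, t k.+1], continuous (fun t => v (polar z x t))}.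
    apply: derivable_within_continuous => s _.
    by have [] := holo_angular (H x s xr').
  have [c] := MVT tk (fun s _ => holo_angular (H x s xr')) cv.
  rewrite in_itv/= => /andP[c1 c2 ->].
  have tS : t k.+1 = t k + h by rewrite /t -natr1 mulrDl mul1r; ring.
  rewrite (_ : _ - _ = x * h * (W (x, t k) - W (x, c))); last by rewrite tS /W /=; ring.
  rewrite normrM gtr0_norm; last by rewrite mulr_gt0.
  apply: ler_wpM2l; first by rewrite mulr_ge0 // ltW.
  have Kk : K (x, t k).
    rewrite /K /=; split => /=; rewrite in_itv//= /t; apply/andP; split.
      by rewrite lerDl mulr_ge0// ltW.
    by rewrite lerD2l -NhE ler_pM2r// ler_nat ltnW.
  apply: ltW; apply: (dW _ _ Kk); split.
    exact: (ballxx (x : R) d0).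
  by rewrite -ball_normE /= ltr_norml; move: c2; rewrite tS; lra.
have : `|\sum_(0 <= k < N) (x * h * W (x, t k) - (v (polar z x (t k.+1)) - v (polar z x (t k))))| <= N%:R * (x * h * (e / r)).
  apply: le_trans (ler_norm_sum _ _ _) _; rewrite big_mkord.
  have -> : N%:R * (x * h * (e / r)) = \sum_(i < N) (x * h * (e / r)).
    by rewrite sumr_const card_ord mulr_natl.
  by apply: ler_sum => i _; exact: K1 (ltn_ord i).
rewrite sumrB tel subr0 -mulr_sumr -/(A' x) normrM gtr0_norm; last by rewrite mulr_gt0.
by rewrite [leRHS]mulrCA ler_pM2l // mulr_gt0.
Qed.
End MeanValue.

(** * Maximum principle on circles and discs *)

Section MaxPrinciple.
Variable R : realType.
Implicit Types (D : set (plane R)) (u v p q : plane R -> R) (z w : plane R).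

(* If [u < u z] at one point of the circle, then this persists on an arc of    *)
(* length [2 pi / m]; with [m L] points, [L] of them fall in that arc.         *)
Lemma max_on_circle u v p q z (r t0 : R) : 0 < r ->
  (forall s t, 0 <= s <= r -> holo_at u v p q (polar z s t)) ->
  (forall t, u (polar z r t) <= u z) -> u (polar z r t0) = u z.
Proof.
move=> r0 H M; apply/eqP; rewrite eq_le M /= leNgt; apply/negP => lt0.
pose d0 := (u z - u (polar z r t0)) / 2.
have d00 : 0 < d0 by rewrite divr_gt0// subr_gt0.
have rr : 0 <= r <= r by rewrite lexx ltW.
have ct : {for t0, continuous (fun t => u (polar z r t))}.
  have hu : is_diff (polar z r t0) (u : plane R -> R^o) (lin2 (p (polar z r t0)) (- q (polar z r t0)) : plane R -> R^o).
    by have [] := H r t0 rr.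
  have cu : {for polar z r t0, continuous (u : plane R -> R^o)}.
    by apply: differentiable_continuous; have [] := hu.
  have cp := @polar_continuous R z (r, t0).
  have c2 : (fun t : R => (r, t)) @ t0 --> (r, t0).
    have h1 : (fun _ : R => r) @ t0 --> r by exact: cvg_cst.
    have h2 : (fun t : R => t) @ t0 --> t0 by exact: cvg_id.
    exact: (cvg_pair h1 h2).
  exact: (cvg_comp _ _ (cvg_comp _ _ c2 cp) cu).
move/cvgrPdist_lt : ct => /(_ _ d00) /nbhs_ballP[eta /= eta0 Heta].
have pi2 : 0 < 2 * pi :> R by rewrite mulr_gt0 // pi_gt0.
pose m := (Num.truncn (2 * pi / eta)).+1.
have m0 : 0 < m%:R :> R by rewrite ltr0n.
have mE : 2 * pi / m%:R < eta.
  by rewrite ltr_pdivrMr// -ltr_pdivrMl// mulrC truncnS_gt.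
(* The [L] points of the arc contribute at most [- L d0] and the others at most 0, against a
   tolerance of [m L] times this value, that is [L d0 / 2]. *)
have e0 : 0 < d0 / (2 * m%:R) by rewrite divr_gt0// mulr_gt0.
have [N0 HN] := circle_mean t0 r0 e0 H.
pose L := N0.+1.
have L0 : 0 < L%:R :> R by rewrite ltr0n.
have := HN (m * L)%N _ _.
have -> : (N0 <= m * L)%N by rewrite (leq_trans (leqnSn N0))// leq_pmull.
move=> /(_ isT); have -> : (0 < m * L)%N by [].
move=> /(_ isT).
set F := fun k : nat => u (polar z r (t0 + k%:R * (2 * pi / (m * L)%:R))) - u z.
rewrite -/(\sum_(0 <= k < m * L) F k).
rewrite (@big_cat_nat _ _ _ L) //=; last by rewrite leq_pmull.
have S1 : \sum_(0 <= k < L) F k <= L%:R * - d0.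
  have -> : L%:R * - d0 = \sum_(k < L) - d0 by rewrite sumr_const card_ord mulr_natl.
  rewrite big_mkord; apply: ler_sum => k _.
  have : `|u (polar z r t0) - u (polar z r (t0 + k%:R * (2 * pi / (m * L)%:R)))| < d0.
    apply: Heta; rewrite -ball_normE /= opprD addNKr normrN ger0_norm; last first.
      by rewrite mulr_ge0// divr_ge0// ltW.
    apply: le_lt_trans mE.
    have -> : k%:R * (2 * pi / (m * L)%:R) = (2 * pi / m%:R) * (k%:R / L%:R) :> R.
      by rewrite natrM; field; rewrite !gt_eqF.
    rewrite ler_piMr//.
      by rewrite divr_ge0 // ltW.
    by rewrite ler_pdivrMr// mul1r ler_nat ltnW.
  rewrite ltr_norml /F /d0; lra.
have S2 : \sum_(L <= k < m * L) F k <= 0.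
  by apply: sumr_le0 => k _; rewrite subr_le0.
rewrite ler_norml => /andP[+ _].
have -> : - ((m * L)%:R * (d0 / (2 * m%:R))) = - (L%:R * d0 / 2) :> R.
  by rewrite natrM; field; rewrite gt_eqF.
have : 0 < L%:R * d0 by rewrite mulr_gt0.
by move: S1 S2; rewrite mulrN; lra.
Qed.

(** The norm of [plane R] is the sup norm, so round discs are described by the squared Euclidean
    distance. *)
Definition esq (z w : plane R) : R := (w.1 - z.1 : R) ^+ 2 + (w.2 - z.2 : R) ^+ 2.

Lemma esq_polar z s t : esq z (polar z s t) = s ^+ 2.
Proof.
by rewrite /esq /polar /= -[RHS]mulr1 -(cos2Dsin2 t); ring.
Qed.

Lemma unit_angle (a b : R) : a ^+ 2 + b ^+ 2 = 1 -> exists t, cos t = a /\ sin t = b.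
Proof.
move=> ab.
have a2 : 0 <= a ^+ 2 by exact: sqr_ge0.
have b2 : 0 <= b ^+ 2 by exact: sqr_ge0.
have a1 : -1 <= a <= 1.
  by apply/andP; split; rewrite -subr_ge0; nra.
have b2E : 1 - a ^+ 2 = b ^+ 2 by lra.
have [b0|b0] := leP 0 b.
- exists (acos a); rewrite acosK ?in_itv//= sin_acos// b2E sqrtr_sqr; split => //.
  exact: ger0_norm.
- exists (- acos a); rewrite cosN sinN acosK ?in_itv//= sin_acos// b2E sqrtr_sqr; split => //.
  by rewrite ltr0_norm// opprK.
Qed.

Lemma polarP z w : exists s t, [/\ 0 <= s, s ^+ 2 = esq z w & w = polar z s t].
Proof.
have e0 : 0 <= esq z w by rewrite addr_ge0 // sqr_ge0.
exists (Num.sqrt (esq z w)).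
have sE := sqr_sqrtr e0.
have [z0|nz] := eqVneq (esq z w) 0.
- rewrite z0 sqrtr0; exists 0; split => //; first by rewrite expr0n.
  rewrite /polar !mul0r !addr0.
  move: z0; rewrite /esq => /eqP; rewrite paddr_eq0 ?sqr_ge0// !sqrf_eq0 !subr_eq0.
  by case: (z) (w) => [? ?] [? ?] /= /andP[/eqP -> /eqP ->].
- set s := Num.sqrt _ in sE *.
  have s0 : s != 0 by apply: contra_neq nz => s0; rewrite -sE s0 expr0n.
  have [|t [ct st]] := @unit_angle ((w.1 - z.1) / s) ((w.2 - z.2) / s).
    by rewrite !expr_div_n -mulrDl sE divff.
  exists t; split => //; first exact: sqrtr_ge0.
  rewrite /polar ct st !(mulrC s) !divfK//.
  by case: (w) => a b /=; congr (_, _); rewrite addrC subrK.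
Qed.

Lemma max_on_disc u v p q z (r : R) : 0 <= r ->
  (forall w, esq z w <= r ^+ 2 -> holo_at u v p q w) ->
  (forall w, esq z w <= r ^+ 2 -> u w <= u z) ->
  forall w, esq z w <= r ^+ 2 -> u w = u z.
Proof.
move=> r0 H M w; have [s [t [s0 sE wE]]] := polarP z w.
move=> wr; have {}sr : s <= r by rewrite -(@ler_pXn2r _ 2)// ?nnegrE// sE.
rewrite wE; move: s0; rewrite le_eqVlt => /orP[/eqP <-|s0].
  by rewrite /polar !mul0r !addr0; case: (z).
apply: (@max_on_circle _ v p q) => //.
- move=> s' t' /andP[s'0 s's]; apply: H; rewrite esq_polar ler_pXn2r ?nnegrE//.
  exact: le_trans sr.
- by move=> t'; apply: M; rewrite esq_polar sE.
Qed.
End MaxPrinciple.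

(** * Algebra of holomorphic pairs *)

Section HoloAlgebra.
Variable R : realType.
Implicit Types (D : set (plane R)) (u v p q a b c d : plane R -> R) (z w : plane R).

Lemma lin2_diffM u v z (a1 a2 b1 b2 : R) :
  is_diff z (u : plane R -> R^o) (lin2 a1 a2 : plane R -> R^o) ->
  is_diff z (v : plane R -> R^o) (lin2 b1 b2 : plane R -> R^o) ->
  is_diff z ((fun w => u w * v w) : plane R -> R^o)
    (lin2 (u z * b1 + v z * a1) (u z * b2 + v z * a2) : plane R -> R^o).
Proof.
move=> hu hv.
have -> : lin2 (u z * b1 + v z * a1) (u z * b2 + v z * a2) = u z *: lin2 b1 b2 + v z *: lin2 a1 a2 :> (plane R -> R).
  by apply/funext => w; rewrite !fctE /lin2 /GRing.scale /=; ring.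
exact: (@is_diffM R (plane R) u v (lin2 a1 a2) (lin2 b1 b2) z hu hv).
Qed.

Lemma lin2_diffD u v z (a1 a2 b1 b2 : R) :
  is_diff z (u : plane R -> R^o) (lin2 a1 a2 : plane R -> R^o) ->
  is_diff z (v : plane R -> R^o) (lin2 b1 b2 : plane R -> R^o) ->
  is_diff z ((fun w => u w + v w) : plane R -> R^o)
    (lin2 (a1 + b1) (a2 + b2) : plane R -> R^o).
Proof.
move=> hu hv.
have -> : lin2 (a1 + b1) (a2 + b2) = lin2 a1 a2 + lin2 b1 b2 :> (plane R -> R).
  by apply/funext => w; rewrite !fctE /lin2 /=; ring.
exact: (@is_diffD R (plane R) R^o u v (lin2 a1 a2) (lin2 b1 b2) z hu hv).
Qed.

Lemma lin2_diffV u z (a1 a2 : R) : u z != 0 ->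
  is_diff z (u : plane R -> R^o) (lin2 a1 a2 : plane R -> R^o) ->
  is_diff z ((fun w => (u w)^-1) : plane R -> R^o)
    (lin2 (- (u z) ^- 2 * a1) (- (u z) ^- 2 * a2) : plane R -> R^o).
Proof.
move=> uz hu.
have -> : lin2 (- (u z) ^- 2 * a1) (- (u z) ^- 2 * a2) = - (u z) ^- 2 *: lin2 a1 a2 :> (plane R -> R).
  by apply/funext => w; rewrite !fctE /lin2 /GRing.scale /=; ring.
have [hu1 hu2] := hu.
constructor; first exact: (@differentiableV R (plane R) u z).
by rewrite (@diffV R (plane R) u z) // hu2.
Qed.

Lemma lin2_diff_cst (k : R) z : is_diff z ((fun=> k) : plane R -> R^o) (lin2 0 0 : plane R -> R^o).
Proof.
have -> : lin2 0 0 = 0 :> (plane R -> R) by apply/funext => w; rewrite /lin2 !mul0r addr0.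
exact: is_diff_cst.
Qed.

Lemma is_diff_lin2_eq u z (a1 a2 b1 b2 : R) :
  is_diff z (u : plane R -> R^o) (lin2 a1 a2 : plane R -> R^o) -> a1 = b1 -> a2 = b2 ->
  is_diff z (u : plane R -> R^o) (lin2 b1 b2 : plane R -> R^o).
Proof. by move=> h <- <-. Qed.

Lemma holo_at_continuous u v p q z : holo_at u v p q z ->
  {for z, continuous u} /\ {for z, continuous v}.
Proof.
move=> [[hu _] [hv _] _ _]; split; exact: differentiable_continuous.
Qed.

Lemma holo_mul u v p q a b c d z : holo_at u v p q z -> holo_at a b c d z ->
  holo_at (fun w => u w * a w - v w * b w) (fun w => u w * b w + v w * a w)
    (fun w => u w * c w - v w * d w + (p w * a w - q w * b w))
    (fun w => u w * d w + v w * c w + (p w * b w + q w * a w)) z.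
Proof.
move=> H1 H2; have [cu cv] := holo_at_continuous H1; have [ca cb] := holo_at_continuous H2.
move: H1 H2 => [du dv cp cq] [da db cc cd].
have dN := lin2_diffM (lin2_diff_cst (-1) z) (lin2_diffM dv db).
split.
- have := lin2_diffD (lin2_diffM du da) dN.
  rewrite (_ : (fun w => _ + -1 * _) = (fun w => u w * a w - v w * b w)); last first.
    by apply/funext => w; ring.
  by move/is_diff_lin2_eq; apply; ring.
- have := lin2_diffD (lin2_diffM du db) (lin2_diffM dv da).
  by move/is_diff_lin2_eq; apply; ring.
- by apply: cvgD; apply: cvgB; apply: cvgM.
- by apply: cvgD; apply: cvgD; apply: cvgM.
Qed.

(** The inverse of [a + i b] is [(a - i b) / N], with derivative [- (c + i d) (a - i b)^2 / N^2]. *)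
Lemma holo_inv a b c d z : holo_at a b c d z -> a z * a z + b z * b z != 0 ->
  let N w := a w * a w + b w * b w in
  holo_at (fun w => a w * (N w)^-1) (fun w => -1 * (b w * (N w)^-1))
    (fun w => - ((c w * (a w * a w - b w * b w) + d w * (2 * (a w * b w))) * ((N w)^-1 * (N w)^-1)))
    (fun w => - ((d w * (a w * a w - b w * b w) - c w * (2 * (a w * b w))) * ((N w)^-1 * (N w)^-1))) z.
Proof.
move=> H Nz N; have [ca cb] := holo_at_continuous H.
move: H => [da db cc cd].
have dV := lin2_diffV Nz (lin2_diffD (lin2_diffM da da) (lin2_diffM db db)).
have cN : N x @[x --> z] --> N z by apply: cvgD; apply: cvgM.
have cV : (N x)^-1 @[x --> z] --> (N z)^-1 by apply: cvgV.
have cab : 2 * (a x * b x) @[x --> z] --> 2 * (a z * b z).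
  by apply: cvgM; [exact: cvg_cst|apply: cvgM].
split.
- have := lin2_diffM da dV.
  by move/is_diff_lin2_eq; apply; rewrite /N; field.
- have := lin2_diffM (lin2_diff_cst (-1) z) (lin2_diffM db dV).
  by move/is_diff_lin2_eq; apply; rewrite /N; field.
- apply: cvgN; apply: cvgM; last by apply: cvgM.
  by apply: cvgD; apply: cvgM => //; apply: cvgB; apply: cvgM.
- apply: cvgN; apply: cvgM; last by apply: cvgM.
  by apply: cvgB; apply: cvgM => //; apply: cvgB; apply: cvgM.
Qed.


Lemma holo_lin u v p q a b c d (k l : R) z : holo_at u v p q z -> holo_at a b c d z ->
  holo_at (fun w => k * u w + l * a w) (fun w => k * v w + l * b w)
    (fun w => k * p w + l * c w) (fun w => k * q w + l * d w) z.
Proof.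
move=> [du dv cp cq] [da db cc cd]; split.
- have := lin2_diffD (lin2_diffM (lin2_diff_cst k z) du) (lin2_diffM (lin2_diff_cst l z) da).
  by move/is_diff_lin2_eq; apply; ring.
- have := lin2_diffD (lin2_diffM (lin2_diff_cst k z) dv) (lin2_diffM (lin2_diff_cst l z) db).
  by move/is_diff_lin2_eq; apply; ring.
- by apply: cvgD; apply: cvgM => //; exact: cvg_cst.
- by apply: cvgD; apply: cvgM => //; exact: cvg_cst.
Qed.

(** Multiplication by [-i]; together with [holo_lin] it gives all complex linear combinations. *)
Lemma holo_rot u v p q z : holo_at u v p q z ->
  holo_at v (fun w => - u w) q (fun w => - p w) z.
Proof.
move=> [du dv cp cq]; split => //.
- by apply: is_diff_lin2_eq dv _ _ => //; rewrite opprK.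
- have := lin2_diffM (lin2_diff_cst (-1) z) du.
  rewrite (_ : (fun w => -1 * u w) = (fun w => - u w)); last by apply/funext => w; rewrite mulN1r.
  by move/is_diff_lin2_eq; apply; ring.
- exact: cvgN.
Qed.

Lemma holo_at_cst (k l : R) z : holo_at (fun=> k) (fun=> l) (fun=> 0) (fun=> 0) z.
Proof.
split; try exact: cvg_cst; last exact: lin2_diff_cst.
by apply: is_diff_lin2_eq (lin2_diff_cst k z) _ _; rewrite ?oppr0.
Qed.

Lemma holo_at_sub (z0 : plane R) z :
  holo_at (fun w => w.1 - z0.1) (fun w => w.2 - z0.2) (fun=> 1) (fun=> 0) z.
Proof.
have L (k l m : R) : is_diff z ((fun w : plane R => lin2 k l w + m) : plane R -> R^o) (lin2 k l : plane R -> R^o).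
  apply: is_diff_lin2_eq (lin2_diffD _ (lin2_diff_cst m z)) (addr0 _) (addr0 _).
  constructor; first by apply: linear_differentiable; exact: lin2_continuous.
  by apply: diff_lin; exact: lin2_continuous.
split; try exact: cvg_cst.
- have := L 1 0 (- z0.1).
  rewrite (_ : (fun w => _) = (fun w => w.1 - z0.1)).
    by move/is_diff_lin2_eq; apply => //; rewrite oppr0.
  by apply/funext => w; rewrite /lin2 mul1r mul0r addr0.
- have := L 0 1 (- z0.2).
  rewrite (_ : (fun w => _) = (fun w => w.2 - z0.2)) //.
  by apply/funext => w; rewrite /lin2 mul1r mul0r add0r.
Qed.
End HoloAlgebra.

(** * Maximum modulus on squares and the identity theorem on a disc *)

Section Identity.
Variable R : realType.
Implicit Types (D : set (plane R)) (u v p q a b c d : plane R -> R) (z w : plane R).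

Definition sqmod u v w := u w ^+ 2 + v w ^+ 2.

Lemma sqr_sum_le0 (x y : R) : x ^+ 2 + y ^+ 2 <= 0 -> x = 0 /\ y = 0.
Proof.
move=> h; have : x ^+ 2 + y ^+ 2 == 0 by rewrite eq_le h addr_ge0 // sqr_ge0.
by rewrite paddr_eq0 ?sqr_ge0// !sqrf_eq0 => /andP[/eqP -> /eqP ->].
Qed.

(** With [h = u + i v], the real part of [conj (h z) h] is maximal at [z] by Cauchy-Schwarz, so
    [max_on_disc] makes it constant. Then [|h w| <= |h z|] leaves [|h w - h z|^2 <= 0]. *)
Lemma max_modulus_disc u v p q z (r : R) : 0 <= r ->
  (forall w, esq z w <= r ^+ 2 -> holo_at u v p q w) ->
  (forall w, esq z w <= r ^+ 2 -> sqmod u v w <= sqmod u v z) ->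
  forall w, esq z w <= r ^+ 2 -> u w = u z /\ v w = v z.
Proof.
move=> r0 H M w wr.
have := @max_on_disc R _ _ _ _ z r r0 (fun w hw => holo_lin (u z) (v z) (H w hw) (holo_rot (H w hw))).
have sq (x : R) := sqr_ge0 x.
have CS x : esq z x <= r ^+ 2 -> u z * u x + v z * v x <= u z * u z + v z * v z.
  move=> /M; rewrite /sqmod; have := sq (u x - u z); have := sq (v x - v z).
  by rewrite !sqrrB !expr2; lra.
move=> /(_ CS w wr) E.
have Mw := M _ wr.
have [|h1 h2] := @sqr_sum_le0 (u w - u z) (v w - v z).
  by move: Mw E; rewrite /sqmod !sqrrB !expr2; lra.
by split; apply/eqP; rewrite -subr_eq0 ?h1 ?h2.
Qed.

Definition square z (r : R) : set (plane R) :=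
  [set w | `|w.1 - z.1 : R| <= r /\ `|w.2 - z.2 : R| <= r].

Lemma square_compact z r : compact (square z r).
Proof.
have -> : square z r = `[z.1 - r, z.1 + r]%classic `*` `[z.2 - r, z.2 + r]%classic.
  apply/seteqP; split => w [/=].
    by rewrite !ler_norml => h1 h2; split; rewrite /= in_itv/=; lra.
  by rewrite !in_itv/= => h1 h2; split; rewrite ler_norml; lra.
by apply: (@compact_setX R^o R^o); exact: segment_compact.
Qed.

(** At a maximum point [m], the pair is constant on the largest disc about [m] inside the square,
    and that disc touches the boundary. *)
Lemma max_modulus_square u v p q z (r M : R) : 0 <= r ->
  (forall w, square z r w -> holo_at u v p q w) ->
  (forall w, square z r w -> `|w.1 - z.1 : R| = r \/ `|w.2 - z.2 : R| = r -> sqmod u v w <= M) ->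
  forall w, square z r w -> sqmod u v w <= M.
Proof.
move=> r0 H HM.
have [||m /set_mem mS Mm] := @compact_EVT_max (plane R) R (sqmod u v) (square z r) _ (@square_compact z r).
- by exists z; split; rewrite subrr normr0.
- apply: continuous_in_subspaceT => w /set_mem /H /holo_at_continuous[cu cv].
  by apply: cvgD; rewrite /= ?expr2; apply: cvgM.
suff hm : sqmod u v m <= M.
  by move=> w wS; apply: le_trans hm; apply: Mm; exact/mem_set.
have [m1 m2] := mS.
pose t := Num.min (r - `|m.1 - z.1 : R|) (r - `|m.2 - z.2 : R|).
have t0 : 0 <= t by rewrite le_min !subr_ge0 m1 m2.
have t1 : t <= r - `|m.1 - z.1 : R| by rewrite ge_min lexx.
have t2 : t <= r - `|m.2 - z.2 : R| by rewrite ge_min lexx orbT.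
have sub w : esq m w <= t ^+ 2 -> square z r w.
  rewrite /esq => wt.
  have sq (x : R) := sqr_ge0 x.
  have h1 : `|w.1 - m.1 : R| <= t.
    by rewrite -(ger0_norm t0) -ler_sqr ?nnegrE// !real_normK ?num_real//; have := sq (w.2 - m.2); lra.
  have h2 : `|w.2 - m.2 : R| <= t.
    by rewrite -(ger0_norm t0) -ler_sqr ?nnegrE// !real_normK ?num_real//; have := sq (w.1 - m.1); lra.
  split.
    have -> : w.1 - z.1 = (w.1 - m.1) + (m.1 - z.1) :> R by ring.
    by apply: le_trans (ler_normD _ _) _; lra.
  have -> : w.2 - z.2 = (w.2 - m.2) + (m.2 - z.2) :> R by ring.
  by apply: le_trans (ler_normD _ _) _; lra.
have K w : esq m w <= t ^+ 2 -> u w = u m /\ v w = v m.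
  apply: (@max_modulus_disc u v p q) => // x xt; first by apply: H; exact: sub.
  by apply: Mm; apply/mem_set; exact: sub.
have K' w : esq m w = t ^+ 2 -> `|w.1 - z.1 : R| = r \/ `|w.2 - z.2 : R| = r -> sqmod u v m <= M.
  move=> wt wb; have wt' : esq m w <= t ^+ 2 by rewrite wt.
  have [uE vE] := K _ wt'; rewrite /sqmod -uE -vE; apply: HM => //; exact: sub.
have [tE|tE] : t = r - `|m.1 - z.1 : R| \/ t = r - `|m.2 - z.2 : R|.
  by rewrite /t minEle; case: ifP; [left|right].
- have [s0|s0] := leP 0 (m.1 - z.1 : R).
    apply: (K' (m.1 + t, m.2)); first by rewrite /esq /=; ring.
    left; rewrite /= tE (ger0_norm s0) ger0_norm; lra.
  apply: (K' (m.1 - t, m.2)); first by rewrite /esq /=; ring.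
  left; rewrite /= tE (ltr0_norm s0) ler0_norm; lra.
- have [s0|s0] := leP 0 (m.2 - z.2 : R).
    apply: (K' (m.1, m.2 + t)); first by rewrite /esq /=; ring.
    right; rewrite /= tE (ger0_norm s0) ger0_norm; lra.
  apply: (K' (m.1, m.2 - t)); first by rewrite /esq /=; ring.
  right; rewrite /= tE (ltr0_norm s0) ler0_norm; lra.
Qed.

Lemma esq_ge0 z w : 0 <= esq z w.
Proof. by rewrite addr_ge0 // sqr_ge0. Qed.

Lemma esq_eq0 z w : esq z w = 0 -> w = z.
Proof.
move=> h; have [|/eqP h1 /eqP h2] := @sqr_sum_le0 (w.1 - z.1) (w.2 - z.2); first by rewrite -/(esq z w) h.
by move: h1 h2; rewrite !subr_eq0; case: (w) (z) => [? ?] [? ?] /= /eqP -> /eqP ->.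
Qed.

Lemma esq_continuous z : continuous (esq z).
Proof.
have h := fun w => holo_at_continuous (holo_at_sub z w).
move=> w; have [h1 h2] := h w.
rewrite /esq; apply: cvgD; rewrite /= ?expr2; apply: cvgM; assumption.
Qed.

Lemma near_esq_lt z0 z (s : R) : esq z0 z < s -> \forall w \near z, esq z0 w < s.
Proof. by move=> h; have /cvgr_lt := @esq_continuous z0 z; apply. Qed.

(** Gives holomorphy of the quotients in [identity_square] at the centre, where their formula
    divides by zero. *)
Lemma holo_at_zero u v p q z :
  (\forall w \near z, [/\ u w = 0, v w = 0, p w = 0 & q w = 0]) -> holo_at u v p q z.
Proof.
move=> H; have [u0 v0 p0 q0] := nbhs_singleton H.
have L (f : plane R -> R) : (\forall w \near z, f w = 0) -> is_diff z (f : plane R -> R^o) (lin2 0 0 : plane R -> R^o).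
  move=> Hf; apply: is_diff_lin2 => e e0.
  have : \forall w \near (0 : plane R), f (w + z) = 0.
    have /near_plane[d d0 Hd] := Hf; apply/near_plane; exists d => // w /=.
    by rewrite !subr0 => h1 h2; apply: Hd; rewrite /= addrK.
  apply: filterS => w ->; rewrite (nbhs_singleton Hf) /lin2 !mul0r addr0 !subr0 normr0.
  by rewrite mulr_ge0 // ltW.
have C (f : plane R -> R) : (\forall w \near z, f w = 0) -> {for z, continuous f}.
  by move=> Hf; rewrite /prop_for /continuous_at (nbhs_singleton Hf); apply: cvg_near_cst.
split.
- by apply: is_diff_lin2_eq (L u _) _ _; rewrite ?p0 ?q0 ?oppr0//; apply: filterS H => w [].
- by apply: is_diff_lin2_eq (L v _) _ _; rewrite ?p0 ?q0 ?oppr0//; apply: filterS H => w [].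
- by apply: C; apply: filterS H => w [].
- by apply: C; apply: filterS H => w [].
Qed.

Lemma holo_at_zero_deriv u v p q z : holo_at u v p q z ->
  (\forall w \near z, u w = 0) -> p z = 0 /\ q z = 0.
Proof.
move=> [[du eu] _ _ _] H.
have [_ e0] : is_diff z (u : plane R -> R^o) (lin2 0 0 : plane R -> R^o).
  have [] // := @holo_at_zero u (fun=>0) (fun=>0) (fun=>0) z.
    by apply: filterS H => w ->.
  by move=> h _ _ _; rewrite /= oppr0 in h.
have E w : lin2 (p z) (- q z) w = lin2 0 0 w by rewrite -[LHS]/((lin2 (p z) (- q z) : plane R -> R^o) w) -eu e0.
have := E (1, 0); have := E (0, 1); rewrite /lin2 /=; lra.
Qed.

(* Dividing by powers of [w - z0] and applying the maximum principle gives *)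
(* [|k w| <= M (|w - z0| / r) ^ N] for every [N].                          *)
Lemma identity_square u v p q z0 (s r : R) : 0 < s -> 0 < r ->
  (forall w, square z0 r w -> holo_at u v p q w) ->
  (forall w, esq z0 w < s -> u w = 0 /\ v w = 0) ->
  forall w, esq z0 w < r ^+ 2 -> u w = 0 /\ v w = 0.
Proof.
move=> s0 r0.
wlog sr : s s0 / s <= r ^+ 2.
  move=> W H Z; apply: (W (Num.min s (r ^+ 2))).
  - by rewrite lt_min s0 exprn_gt0.
  - by rewrite ge_min lexx orbT.
  - exact: H.
  - by move=> w; rewrite lt_min => /andP[+ _]; exact: Z.
move=> H Z.
have disc_sq w : esq z0 w < s -> square z0 r w.
  move=> ws; have {}ws : esq z0 w < r ^+ 2 by exact: lt_le_trans sr.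
  have sq (x : R) := sqr_ge0 x; move: ws; rewrite /esq => ws.
  split; rewrite -(ger0_norm (ltW r0)) -ler_sqr ?nnegrE// !real_normK ?num_real//.
    by have := sq (w.2 - z0.2); lra.
  by have := sq (w.1 - z0.1); lra.
have Z4 w : esq z0 w < s -> [/\ u w = 0, v w = 0, p w = 0 & q w = 0].
  move=> ws; have [u0 v0] := Z _ ws.
  have [p0 q0] := holo_at_zero_deriv (H _ (disc_sq _ ws)) (filterS (fun x xs => (Z x xs).1) (near_esq_lt ws)).
  by split.
(* The pair [a + i b] is the quotient of [u + i v] by the [N]-th power of [w - z0]. It is zero on
   the disc where [u + i v] is, so there is no pole at [z0]. *)
have step N : exists a b c d, [/\ (forall w, square z0 r w -> holo_at a b c d w),
    (forall w, esq z0 w < s -> [/\ a w = 0, b w = 0, c w = 0 & d w = 0]) &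
    (forall w, sqmod a b w * esq z0 w ^+ N = sqmod u v w)].
  elim: N => [|N [a [b [c [d [h1 h2 h3]]]]]].
    by exists u, v, p, q; split => // w; rewrite expr0 mulr1.
  pose a1 (w : plane R) : R := w.1 - z0.1; pose b1 (w : plane R) : R := w.2 - z0.2.
  have a1b1 w : a1 w * a1 w + b1 w * b1 w = esq z0 w by rewrite /esq !expr2.
  have nz w : w <> z0 -> a1 w * a1 w + b1 w * b1 w != 0.
    by move=> wz; rewrite a1b1; apply/eqP => /esq_eq0.
  pose V w := (a1 w * a1 w + b1 w * b1 w)^-1.
  pose i1 w := a1 w * V w; pose j1 w := -1 * (b1 w * V w).
  pose k1 w := - ((1 * (a1 w * a1 w - b1 w * b1 w) + 0 * (2 * (a1 w * b1 w))) * (V w * V w)).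
  pose l1 w := - ((0 * (a1 w * a1 w - b1 w * b1 w) - 1 * (2 * (a1 w * b1 w))) * (V w * V w)).
  have inv w wz : holo_at i1 j1 k1 l1 w :=
    @holo_inv R a1 b1 (fun=> 1) (fun=> 0) w (holo_at_sub z0 w) (nz w wz).
  exists (fun w => a w * i1 w - b w * j1 w), (fun w => a w * j1 w + b w * i1 w),
    (fun w => a w * k1 w - b w * l1 w + (c w * i1 w - d w * j1 w)),
    (fun w => a w * l1 w + b w * k1 w + (c w * j1 w + d w * i1 w)); split.
  - move=> w wS; have [ws|ws] := ltP (esq z0 w) s.
      apply: holo_at_zero; apply: filterS (near_esq_lt ws) => x /h2[-> -> -> ->].
      by split; ring.
    apply: holo_mul (h1 _ wS) (inv _ _).
    by move=> wz; move: ws; rewrite wz /esq !subrr expr0n addr0 leNgt s0.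
  - by move=> w /h2[/= -> -> -> ->]; split; ring.
  - move=> w; rewrite -h3 exprS mulrA; congr (_ * _).
    have [->|wz] := pselect (w = z0).
      by rewrite /sqmod; have [] := h2 z0; rewrite ?/esq ?subrr ?expr0n ?addr0// => -> -> _ _; ring.
    have e0 : esq z0 w <> 0 by move=> /esq_eq0.
    rewrite /sqmod /i1 /j1 /V -a1b1; field; rewrite a1b1; exact/eqP.
move=> w wr.
have r20 : 0 < r ^+ 2 by rewrite exprn_gt0.
have wS : square z0 r w.
  have sq (x : R) := sqr_ge0 x; move: wr; rewrite /esq => wr.
  split; rewrite -(ger0_norm (ltW r0)) -ler_sqr ?nnegrE// !real_normK ?num_real//.
    by have := sq (w.2 - z0.2); lra.
  by have := sq (w.1 - z0.1); lra.
have [||m /set_mem mS Mm] := @compact_EVT_max (plane R) R (sqmod u v) (square z0 r) _ (@square_compact z0 r).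
- by exists w.
- apply: continuous_in_subspaceT => x /set_mem /H /holo_at_continuous[cu cv].
  by apply: cvgD; rewrite /= ?expr2; apply: cvgM.
set M := sqmod u v m in Mm.
have bd N : sqmod u v w <= M * (esq z0 w / r ^+ 2) ^+ N.
  have [a [b [c [d [h1 h2 h3]]]]] := step N.
  have K : sqmod a b w <= M / (r ^+ 2) ^+ N.
    apply: (@max_modulus_square a b c d z0 r) => //; first exact: ltW.
    move=> x xS xb.
    have xr : r ^+ 2 <= esq z0 x.
      have sq (y : R) := sqr_ge0 y.
      case: xb => [xb|xb]; rewrite /esq -xb real_normK ?num_real//.
        by have := sq (x.2 - z0.2); lra.
      by have := sq (x.1 - z0.1); lra.
    rewrite ler_pdivlMr ?exprn_gt0//; apply: le_trans (Mm x (mem_set xS)).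
    rewrite -h3; apply: ler_wpM2l; first by rewrite addr_ge0// sqr_ge0.
    by apply: lerXn2r => //; rewrite nnegrE ?esq_ge0// ltW.
  rewrite -h3 exprMn exprVn mulrCA mulrC; apply: ler_wpM2l => //.
  by rewrite exprn_ge0// esq_ge0.
have : (fun N => M * (esq z0 w / r ^+ 2) ^+ N) @ \oo --> M * 0.
  apply: cvgM; first exact: cvg_cst.
  apply: cvg_expr; rewrite ger0_norm; last by rewrite divr_ge0 ?esq_ge0// ltW.
  by rewrite ltr_pdivrMr// mul1r.
rewrite mulr0 => cv; apply: sqr_sum_le0.
by apply: (ler_cvg_to (cvg_cst _) cv); near=> N; exact: bd.
Unshelve. all: by end_near.
Qed.
End Identity.

(** * Identity theorem on connected sets *)

Section IdentityConnected.
Variable R : realType.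
Implicit Types (D : set (plane R)) (u v p q : plane R -> R) (z w : plane R).

Lemma near_esq (z : plane R) (P : plane R -> Prop) :
  (\forall w \near z, P w) ->
  exists2 s : R, 0 < s & forall w, esq z w <= s ^+ 2 -> P w.
Proof.
move=> /near_plane[d d0 H]; exists (d / 2); first by rewrite divr_gt0.
have d2 : 0 <= d / 2 by rewrite divr_ge0// ltW.
have sq (x : R) := sqr_ge0 x.
move=> w; rewrite /esq => wd; apply: H; apply: (@le_lt_trans _ _ (d / 2)); try lra.
  rewrite -(ger0_norm d2) -ler_sqr ?nnegrE// !real_normK ?num_real//.
  by have := sq (w.2 - z.2); lra.
rewrite -(ger0_norm d2) -ler_sqr ?nnegrE// !real_normK ?num_real//.
by have := sq (w.1 - z.1); lra.
Qed.

(** The interior of the zero set is open and closed in [E]. For closedness, a limit point [z] has a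
    point [x] of that interior within [d / 8] in each coordinate. The square of half side [d / 2]
    about [x] stays in [D], and its inscribed disc covers the points within [d / 8] of [z]. *)
Lemma identity_theorem D E u v p q z0 : open D -> connected E -> E `<=` D ->
  (forall z, D z -> holo_at u v p q z) -> E z0 ->
  (\forall z \near z0, u z = 0 /\ v z = 0) ->
  forall z, E z -> u z = 0 /\ v z = 0.
Proof.
move=> oD cE ED H Ez0 Z0.
pose Z : set (plane R) := [set w | u w = 0 /\ v w = 0].
have EZ : E `&` interior Z = E.
  apply: cE.
  - by exists z0.
  - by exists (interior Z); first exact: open_interior.
  - exists (closure (interior Z)); first exact: closed_closure.
    apply/seteqP; split => z [Ez hz]; split => //; first exact: subset_closure.
    have Dz := ED z Ez.
    have /near_plane[d d0 Hd] : \forall w \near z, D w by exact: open_nbhs_nbhs.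
    have d8 : 0 < d / 8 by rewrite divr_gt0.
    have [x [xZ [x1 x2]]] : interior Z `&` [set w | `|w.1 - z.1 : R| < d / 8 /\ `|w.2 - z.2 : R| < d / 8] !=set0.
      by apply: hz; apply/near_plane; exists (d / 8).
    have [s s0 Hs] := near_esq xZ.
    have d2 : 0 < d / 2 by rewrite divr_gt0.
    have s2 : 0 < s ^+ 2 by rewrite exprn_gt0.
    have K := @identity_square R u v p q x (s ^+ 2) (d / 2) s2 d2.
    apply/near_plane; exists (d / 8) => // w w1 w2; apply: K.
    + move=> y [y1 y2]; apply: H; apply: Hd.
        by move: y1 x1; rewrite ler_norml !ltr_norml; lra.
      by move: y2 x2; rewrite ler_norml !ltr_norml; lra.
    + by move=> y /ltW; exact: Hs.
    + rewrite /esq.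
      have a1 : `|w.1 - x.1 : R| <= d / 4 by move: w1 x1; rewrite ler_norml !ltr_norml; lra.
      have a2 : `|w.2 - x.2 : R| <= d / 4 by move: w2 x2; rewrite ler_norml !ltr_norml; lra.
      have b1 : (w.1 - x.1 : R) ^+ 2 <= (d / 4) ^+ 2.
        by rewrite -[leLHS]real_normK ?num_real//; apply: lerXn2r => //; rewrite nnegrE; lra.
      have b2 : (w.2 - x.2 : R) ^+ 2 <= (d / 4) ^+ 2.
        by rewrite -[leLHS]real_normK ?num_real//; apply: lerXn2r => //; rewrite nnegrE; lra.
      have : 0 < d ^+ 2 by rewrite exprn_gt0.
      by move: b1 b2; rewrite !expr_div_n; lra.
by move=> z; rewrite -EZ => -[_ /nbhs_singleton].
Qed.
End IdentityConnected.

(** * Cayley-Dickson algebra *)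

Section CayleyDickson.
Variable R : realType.

Fixpoint cddot (n : nat) : cd R n -> cd R n -> R :=
  match n return cd R n -> cd R n -> R with
  | 0 => fun x y : R => x * y
  | m.+1 => fun x y : cd R m * cd R m => cddot x.1 y.1 + cddot x.2 y.2
  end.

Implicit Types n : nat.

Lemma cdconjD n (x y : cd R n) : cdconj (x + y) = cdconj x + cdconj y.
Proof.
elim: n x y => [//|n IH] [x1 x2] [y1 y2] /=.
by rewrite IH opprD.
Qed.

Lemma cdconjZ n k (x : cd R n) : cdconj (k *: x) = k *: cdconj x.
Proof. by elim: n x => [//|n IH] [x1 x2] /=; rewrite IH -scalerN. Qed.

Lemma cdconjN n (x : cd R n) : cdconj (- x) = - cdconj x.
Proof. by rewrite -scaleN1r cdconjZ scaleN1r. Qed.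

Lemma cdconjB n (x y : cd R n) : cdconj (x - y) = cdconj x - cdconj y.
Proof. by rewrite cdconjD cdconjN. Qed.

Lemma cdconjK n (x : cd R n) : cdconj (cdconj x) = x.
Proof. by elim: n x => [//|n IH] [x1 x2] /=; rewrite IH opprK. Qed.

Lemma cdconj1 n : cdconj (cdone R n) = cdone R n.
Proof. by elim: n => [//|n IH] /=; rewrite IH oppr0. Qed.

Lemma cdmulDl n (x y z : cd R n) : (x + y) ** z = x ** z + y ** z.
Proof.
suff : (forall x y z : cd R n, (x + y) ** z = x ** z + y ** z) /\
       (forall x y z : cd R n, z ** (x + y) = z ** x + z ** y) by case.
elim: n {x y z} => [|n [IHl IHr]].
  by split => x y z /=; [exact: mulrDl|exact: mulrDr].
split => -[x1 x2] [y1 y2] [z1 z2] /=; rewrite ?cdconjD !IHl !IHr;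
  by congr (_, _); rewrite ?opprD addrACA.
Qed.

Lemma cdmulDr n (x y z : cd R n) : z ** (x + y) = z ** x + z ** y.
Proof.
elim: n x y z => [|n IH] ; first by move=> x y z /=; exact: mulrDr.
move=> [x1 x2] [y1 y2] [z1 z2] /=; rewrite ?cdconjD !cdmulDl !IH.
by congr (_, _); rewrite ?opprD addrACA.
Qed.

Lemma cdmulZl n k (x y : cd R n) : (k *: x) ** y = k *: (x ** y).
Proof.
suff : (forall k (x y : cd R n), (k *: x) ** y = k *: (x ** y)) /\
       (forall k (x y : cd R n), x ** (k *: y) = k *: (x ** y)) by case.
elim: n {k x y} => [|n [IHl IHr]].
  by split => k x y /=; rewrite /GRing.scale /=; [rewrite mulrA|rewrite mulrCA].
split => k [x1 x2] [y1 y2] /=; rewrite ?cdconjZ !IHl !IHr;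
  by congr (_, _); rewrite ?scalerBr ?scalerDr.
Qed.

Lemma cdmulZr n k (x y : cd R n) : x ** (k *: y) = k *: (x ** y).
Proof.
elim: n k x y => [|n IH] k.
  by move=> x y /=; rewrite /GRing.scale /= mulrCA.
move=> [x1 x2] [y1 y2] /=; rewrite ?cdconjZ !cdmulZl !IH.
by congr (_, _); rewrite ?scalerBr ?scalerDr.
Qed.

Lemma cdmulNl n (x y : cd R n) : (- x) ** y = - (x ** y).
Proof. by rewrite -scaleN1r cdmulZl scaleN1r. Qed.
Lemma cdmulNr n (x y : cd R n) : x ** (- y) = - (x ** y).
Proof. by rewrite -scaleN1r cdmulZr scaleN1r. Qed.
Lemma cdmulBl n (x y z : cd R n) : (x - y) ** z = x ** z - y ** z.
Proof. by rewrite cdmulDl cdmulNl. Qed.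
Lemma cdmulBr n (x y z : cd R n) : z ** (x - y) = z ** x - z ** y.
Proof. by rewrite cdmulDr cdmulNr. Qed.
Lemma cdmul0l n (x : cd R n) : 0 ** x = 0.
Proof. by rewrite -(scale0r (0 : cd R n)) cdmulZl !scale0r. Qed.
Lemma cdmul0r n (x : cd R n) : x ** 0 = 0.
Proof. by rewrite -(scale0r (0 : cd R n)) cdmulZr !scale0r. Qed.

Lemma cdmul1r n (x : cd R n) : x ** cdone R n = x.
Proof.
elim: n x => [|n IH]; first by move=> x /=; exact: mulr1.
have conj0 : cdconj (0 : cd R n) = 0 by rewrite -(scale0r (0 : cd R n)) cdconjZ !scale0r.
by move=> [x1 x2] /=; rewrite conj0 cdconj1 !IH !cdmul0l subr0 add0r.
Qed.

Lemma cdmul1l n (x : cd R n) : cdone R n ** x = x.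
Proof.
elim: n x => [|n IH]; first by move=> x /=; exact: mul1r.
by move=> [x1 x2] /=; rewrite IH cdmul1r cdmul0l cdmul0r subr0 addr0.
Qed.

Lemma cdconjM n (x y : cd R n) : cdconj (x ** y) = cdconj y ** cdconj x.
Proof.
elim: n x y => [|n IH]; first by move=> x y /=; exact: mulrC.
move=> [x1 x2] [y1 y2] /=.
rewrite cdconjB !IH !cdconjK cdconjN !cdmulNl cdmulNr opprK.
by congr (_, _); rewrite opprD addrC.
Qed.

Lemma cddotC n (x y : cd R n) : cddot x y = cddot y x.
Proof.
elim: n x y => [|n IH]; first by move=> x y /=; exact: mulrC.
by move=> [x1 x2] [y1 y2] /=; rewrite IH (IH x2).
Qed.

Lemma cddotDl n (x y z : cd R n) : cddot (x + y) z = cddot x z + cddot y z.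
Proof.
elim: n x y z => [|n IH]; first by move=> x y z /=; exact: mulrDl.
by move=> [x1 x2] [y1 y2] [z1 z2] /=; rewrite !IH addrACA.
Qed.

Lemma cddotZl n k (x y : cd R n) : cddot (k *: x) y = k * cddot x y.
Proof.
elim: n x y => [|n IH]; first by move=> x y /=; rewrite /GRing.scale /= mulrA.
by move=> [x1 x2] [y1 y2] /=; rewrite !IH mulrDr.
Qed.

Lemma cddotDr n (x y z : cd R n) : cddot z (x + y) = cddot z x + cddot z y.
Proof. by rewrite cddotC cddotDl !(cddotC z). Qed.
Lemma cddotZr n k (x y : cd R n) : cddot x (k *: y) = k * cddot x y.
Proof. by rewrite cddotC cddotZl cddotC. Qed.
Lemma cddotNl n (x y : cd R n) : cddot (- x) y = - cddot x y.
Proof. by rewrite -scaleN1r cddotZl mulN1r. Qed.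
Lemma cddotNr n (x y : cd R n) : cddot x (- y) = - cddot x y.
Proof. by rewrite -scaleN1r cddotZr mulN1r. Qed.
Lemma cddot0l n (x : cd R n) : cddot 0 x = 0.
Proof. by rewrite -(scale0r (0 : cd R n)) cddotZl mul0r. Qed.
Lemma cddot0r n (x : cd R n) : cddot x 0 = 0.
Proof. by rewrite cddotC cddot0l. Qed.

Lemma cdnormsqE n (x : cd R n) : cdnormsq x = cddot x x.
Proof.
elim: n x => [|n IH]; first by move=> x /=; rewrite expr2.
by move=> [x1 x2] /=; rewrite !IH.
Qed.

Lemma cdnormsq_ge0 n (x : cd R n) : 0 <= cdnormsq x.
Proof.
elim: n x => [|n IH]; first by move=> x /=; exact: sqr_ge0.
by move=> [x1 x2] /=; rewrite addr_ge0.
Qed.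

Lemma cdnormsq_eq0 n (x : cd R n) : cdnormsq x = 0 -> x = 0.
Proof.
elim: n x => [|n IH]; first by move=> x /= /eqP; rewrite sqrf_eq0 => /eqP.
move=> [x1 x2] /= /eqP; rewrite paddr_eq0 ?cdnormsq_ge0// => /andP[/eqP/IH -> /eqP/IH ->].
by [].
Qed.

Lemma cddot_conj n (x y : cd R n) : cddot (cdconj x) (cdconj y) = cddot x y.
Proof.
elim: n x y => [//|n IH] [x1 x2] [y1 y2] /=.
by rewrite IH cddotNl cddotNr opprK.
Qed.

(** The adjoint of a multiplication is multiplication by the conjugate. Both sides are proved
    together, because doubling exchanges left and right factors. *)
Lemma cddotM n (a x y : cd R n) :
  cddot (x ** a) y = cddot x (y ** cdconj a) /\ cddot (a ** x) y = cddot x (cdconj a ** y).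
Proof.
elim: n a x y => [|n IH] a x y; first by move: a x y => /= a x y; split; ring.
have IHr a' x' y' := (IH a' x' y').1; have IHl a' x' y' := (IH a' x' y').2.
have cj (x' y' : cd R n) : cddot (cdconj x') y' = cddot x' (cdconj y') by rewrite -cddot_conj cdconjK.
move: a x y => [a1 a2] [x1 x2] [y1 y2]; split => /=.
- rewrite !cddotDl !cddotNl cdconjN !cdmulNl opprK !cddotDr !cddotNr.
  by rewrite (IHr a1) (IHl (cdconj a2)) (IHl a2) (IHr (cdconj a1)) !cdconjK; ring.
- rewrite !cddotDl !cddotNl !cdmulNl !cdmulNr opprK !cddotDr !cddotNr.
  by rewrite (IHl a1) (IHr a2 (cdconj x2)) (IHr a1) (IHl a2 (cdconj x1)) !cj !cdconjM !cdconjK; ring.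
Qed.

Lemma cddotMr n (a x y : cd R n) : cddot (x ** a) y = cddot x (y ** cdconj a).
Proof. by have [] := cddotM a x y. Qed.
Lemma cddotMl n (a x y : cd R n) : cddot (a ** x) y = cddot x (cdconj a ** y).
Proof. by have [] := cddotM a x y. Qed.

Lemma cdre_dot n (x : cd R n) : cdre x = cddot (cdone R n) x.
Proof.
elim: n x => [|n IH]; first by move=> x /=; rewrite mul1r.
by move=> [x1 x2] /=; rewrite cddot0l addr0.
Qed.

Lemma cd_add_conj n (x : cd R n) : x + cdconj x = (2 * cdre x) *: cdone R n.
Proof.
elim: n x => [|n IH].
  by move=> x /=; rewrite /GRing.scale /= mulr1 mulr2n mulrDl mul1r.
move=> [x1 x2] /=; transitivity (x1 + cdconj x1, x2 - x2); first by [].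
by rewrite IH subrr -[0 in LHS](scaler0 _ (2 * cdre x1)).
Qed.

Lemma cdconj0 n : cdconj (0 : cd R n) = 0.
Proof. by rewrite -(scale0r (0 : cd R n)) cdconjZ !scale0r. Qed.

Lemma cdconj_mul n (x : cd R n) : cdconj x ** x = cdnormsq x *: cdone R n.
Proof.
elim: n x => [|n IH]; first by move=> x /=; rewrite /GRing.scale /= mulr1 expr2.
move=> [x1 x2] /=; rewrite IH cdmulNr opprK cdmulNl subrr IH -scalerDl.
transitivity ((cdnormsq x1 + cdnormsq x2) *: cdone R n, 0 : cd R n) => //.
by rewrite -[0 in LHS](scaler0 _ (cdnormsq x1 + cdnormsq x2)).
Qed.

Lemma cdmulA1 (x y z : cd R 1) : x ** (y ** z) = (x ** y) ** z.
Proof.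
case: x y z => [x1 x2] [y1 y2] [z1 z2] /=.
apply: injective_projections => /=; ring.
Qed.

Lemma cdmulA2 (x y z : cd R 2) : x ** (y ** z) = (x ** y) ** z.
Proof.
case: x y z => [[x1 x2] [x3 x4]] [[y1 y2] [y3 y4]] [[z1 z2] [z3 z4]] /=.
do 2 (apply: injective_projections => /=); ring.
Qed.

Definition cdassoc n := forall x y z : cd R n, x ** (y ** z) = (x ** y) ** z.

Lemma cdassoc_lt3 n : (n < 3)%N -> cdassoc n.
Proof.
case: n => [|[|[|]]] // _; [|exact: cdmulA1|exact: cdmulA2].
by move=> x y z /=; exact: mulrA.
Qed.

(** The bound on [n] enters here: the components of [a] and [x] lie in the previous algebra of the
    tower, which is associative for [n < 4]. Cancellation and multiplicativity of the norm follow
    from this law. *)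
Lemma cd_altl n (a x : cd R n) : (n < 4)%N -> cdconj a ** (a ** x) = cdnormsq a *: x.
Proof.
case: n a x => [|n]; first by move=> a x _ /=; rewrite /GRing.scale /= mulrA expr2.
move=> [a1 a2] [x1 x2] nlt /=.
have A : cdassoc n by exact: cdassoc_lt3.
have N' (x : cd R n) : x ** cdconj x = cdnormsq x *: cdone R n.
  have := cdconj_mul (cdconj x).
  by rewrite cdconjK !cdnormsqE cddot_conj.
rewrite cdconjD cdconjB !cdconjM !cdconjK cdmulNr cdmulNl opprK.
rewrite cdmulBr !cdmulDl cdmulBr !A.
rewrite cdconj_mul N' -!A cdconj_mul N' !cdmulZr !cdmulZl !cdmul1l !cdmul1r.
apply: injective_projections; rewrite /= scalerDl; first by rewrite addrA subrK.
by rewrite opprB addrACA subrr addr0.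
Qed.

Lemma cd_altr n (a x : cd R n) : (n < 4)%N -> (x ** a) ** cdconj a = cdnormsq a *: x.
Proof.
move=> n4; have := cd_altl (cdconj a) (cdconj x) n4.
move/(congr1 (@cdconj R n)); rewrite !cdconjM !cdconjK cdconjZ cdconjK.
by rewrite !cdnormsqE cddot_conj.
Qed.

Lemma cdconjE n (x : cd R n) : cdconj x = (2 * cdre x) *: cdone R n - x.
Proof. by rewrite -cd_add_conj addrC addKr. Qed.

Lemma cdnormsqD n (x y : cd R n) :
  cdnormsq (x + y) = cdnormsq x + 2 * cddot x y + cdnormsq y.
Proof. by rewrite !cdnormsqE !cddotDl !cddotDr (cddotC y x); ring. Qed.

Lemma cd_polarl n (a b x : cd R n) : (n < 4)%N ->
  cdconj a ** (b ** x) + cdconj b ** (a ** x) = (2 * cddot a b) *: x.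
Proof.
move=> n4; have := cd_altl (a + b) x n4.
rewrite cdconjD !cdmulDl !cdmulDr !cd_altl// cdnormsqD !scalerDl => H.
apply: (addrI (cdnormsq a *: x)); apply: (addIr (cdnormsq b *: x)).
by rewrite -H !addrA.
Qed.

Lemma cd_polarr n (a b x : cd R n) : (n < 4)%N ->
  (x ** a) ** cdconj b + (x ** b) ** cdconj a = (2 * cddot a b) *: x.
Proof.
move=> n4; have := cd_polarl (cdconj b) (cdconj a) (cdconj x) n4.
move/(congr1 (@cdconj R n)).
by rewrite cdconjD !cdconjM !cdconjK cdconjZ cdconjK cddot_conj (cddotC b).
Qed.

Lemma cdmul_conj n (x : cd R n) : x ** cdconj x = cdnormsq x *: cdone R n.
Proof. by have := cdconj_mul (cdconj x); rewrite cdconjK !cdnormsqE cddot_conj. Qed.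

(** Both sides complete [|x|^2 conj y] to the same polarized multiple of [x]. *)
Lemma cd_flex n (x y : cd R n) : (n < 4)%N -> (x ** y) ** x = x ** (y ** x).
Proof.
move=> n4.
have := cd_polarl (cdconj x) y x n4; have := cd_polarr (cdconj x) y x n4.
rewrite !cdconjK cdconj_mul cdmul_conj cdmulZl cdmulZr cdmul1l cdmul1r => <-.
by rewrite [RHS]addrC => /addIr.
Qed.

Lemma cdnormsqM n (x y : cd R n) : (n < 4)%N -> cdnormsq (x ** y) = cdnormsq x * cdnormsq y.
Proof. by move=> n4; rewrite cdnormsqE cddotMl cd_altl// cddotZr -cdnormsqE. Qed.

Lemma cdnormsq_conj n (x : cd R n) : cdnormsq (cdconj x) = cdnormsq x.
Proof. by rewrite !cdnormsqE cddot_conj. Qed.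

Lemma cdnormsqZ n k (x : cd R n) : cdnormsq (k *: x) = k ^+ 2 * cdnormsq x.
Proof. by rewrite !cdnormsqE cddotZl cddotZr; ring. Qed.

Lemma cdnormsqN n (x : cd R n) : cdnormsq (- x) = cdnormsq x.
Proof. by rewrite -scaleN1r cdnormsqZ sqrrN expr1n mul1r. Qed.

Lemma cdnormsq1 n : cdnormsq (cdone R n) = 1.
Proof. by elim: n => [|n IH] /=; rewrite ?expr1n// IH cdnormsqE cddot0l addr0. Qed.

Lemma cdre1 n : cdre (cdone R n) = 1.
Proof. by rewrite cdre_dot -cdnormsqE cdnormsq1. Qed.

Lemma cdreD n (x y : cd R n) : cdre (x + y) = cdre x + cdre y.
Proof. by rewrite !cdre_dot cddotDr. Qed.

Lemma cdreZ n k (x : cd R n) : cdre (k *: x) = k * cdre x.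
Proof. by rewrite !cdre_dot cddotZr. Qed.

Definition unit_im n (J : cd R n) := cdre J = 0 /\ cdnormsq J = 1.

(** Each [x] satisfies [x^2 = 2 re(x) x - |x|^2]; a square root of -1 with nonzero real part would
    therefore be real. *)
Lemma imag_unitsP n (J : cd R n) : imag_units J <-> unit_im J.
Proof.
have sq (x : cd R n) : x ** x = (2 * cdre x) *: x - cdnormsq x *: cdone R n.
  by rewrite -cdconj_mul cdconjE cdmulBl cdmulZl cdmul1l subKr.
rewrite /imag_units /=; split; last first.
  by move=> [r0 n1]; rewrite sq r0 n1 mulr0 scale0r scale1r sub0r.
move=> JJ; move: (JJ); rewrite sq => E.
have r0 : cdre J = 0.
  apply/eqP; apply/negPn/negP => r0.
  have E1 : J = ((cdnormsq J - 1) / (2 * cdre J)) *: cdone R n.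
    have r20 : 2 * cdre J != 0 by rewrite mulf_neq0// pnatr_eq0.
    rewrite mulrC -scalerA scalerBl scale1r -E addrC subrK scalerA.
    by rewrite mulVf// scale1r.
  move: JJ; rewrite E1; set k := _ / _; rewrite cdmulZl cdmulZr cdmul1l scalerA.
  move/(congr1 (@cdre R n)); rewrite cdreZ -scaleN1r cdreZ cdre1 !mulr1 => h.
  by have := sqr_ge0 k; rewrite expr2 h; lra.
split => //; move: E; rewrite r0 mulr0 scale0r sub0r => /oppr_inj h.
by have := congr1 (@cdre R n) h; rewrite cdreZ cdre1 mulr1.
Qed.

Lemma unit_im_conj n (J : cd R n) : unit_im J -> cdconj J = - J.
Proof. by move=> [r0 _]; rewrite cdconjE r0 mulr0 scale0r sub0r. Qed.

Lemma unit_imK n (J x : cd R n) : (n < 4)%N -> unit_im J -> J ** (J ** x) = - x.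
Proof.
move=> n4 hJ; have := cd_altl J x n4.
by rewrite unit_im_conj// hJ.2 scale1r cdmulNl => h; apply: oppr_inj; rewrite opprK.
Qed.

Lemma unit_imKr n (J x : cd R n) : (n < 4)%N -> unit_im J -> (x ** J) ** J = - x.
Proof.
move=> n4 hJ; have := cd_altr J x n4.
by rewrite unit_im_conj// hJ.2 scale1r cdmulNr => h; apply: oppr_inj; rewrite opprK.
Qed.
Lemma cd_dot_ext n (x y : cd R n) : (forall w : cd R n, cddot w x = cddot w y) -> x = y.
Proof.
move=> h; apply/eqP; rewrite -subr_eq0; apply/eqP/cdnormsq_eq0.
by rewrite cdnormsqE cddotDr cddotNr h subrr.
Qed.
End CayleyDickson.

(** Pairing an identity of vectors with an arbitrary vector leaves a scalar goal for [ring] or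
    [field]. *)
Ltac vec := apply: cd_dot_ext => ?; rewrite !(cddotDr, cddotNr, cddotZr).

(** * Algebra of the two stem values on one sphere *)

Section SliceAlgebra.
Variables (R : realType) (n : nat).
Hypothesis n4 : (n < 4)%N.
Implicit Types (X Y I J K c w x y : cd R n).


Lemma cdnormsq_gt0 x : x <> 0 -> 0 < cdnormsq x.
Proof.
move=> x0; rewrite lt_neqAle cdnormsq_ge0 andbT eq_sym.
by apply/eqP => /cdnormsq_eq0.
Qed.

Lemma dot_unit_mul I x : unit_im I -> cddot x (I ** x) = 0.
Proof. by move=> [r0 _]; rewrite cddotC cddotMr cdmul_conj cddotZr cddotC -cdre_dot r0 mulr0. Qed.

Lemma dot_mul_unit I x : unit_im I -> cddot x (x ** I) = 0.
Proof. by move=> [r0 _]; rewrite cddotC cddotMl cdconj_mul cddotZr cddotC -cdre_dot r0 mulr0. Qed.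

Lemma normsq_slice (s t : R) I : unit_im I -> cdnormsq (s *: cdone R n + t *: I) = s ^+ 2 + t ^+ 2.
Proof.
move=> [r0 n1]; rewrite cdnormsqD !cdnormsqZ cdnormsq1 n1 cddotZl cddotZr -cdre_dot r0.
by ring.
Qed.

Definition nrm0 X Y : R := cdnormsq X - cdnormsq Y.
Definition nrm1 X Y : R := 2 * cddot X Y.
(* The value at [alpha + beta I] of the slice conjugate of a function with     *)
(* stem values [X], [Y]; [nrm0] and [nrm1] are the stem values of its norm.    *)
Definition conj_val X Y I := cdconj X + I ** cdconj Y.

(** The hypothesis stands in for associativity: it turns the product into [a X + (I a) Y], where the
    mixed terms [(I conj Y) X + (I conj X) Y] equal [2 <X, Y> I] by polarization. The result is the
    value of [N(f)] at [alpha + beta I]. *)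
Lemma conj_val_mul X Y I J : unit_im I ->
  conj_val X Y I ** (J ** Y) = (I ** conj_val X Y I) ** Y ->
  conj_val X Y I ** (X + J ** Y) = nrm0 X Y *: cdone R n + nrm1 X Y *: I.
Proof.
move=> hI E; rewrite cdmulDr E /conj_val !cdmulDr !cdmulDl unit_imK// cdmulNl !cdconj_mul.
have := cd_polarr (cdconj Y) (cdconj X) I n4.
rewrite !cdconjK cddot_conj (cddotC Y) => P.
by rewrite /nrm0 /nrm1 -P; vec; ring.
Qed.

Lemma conj_val_normsq_mul X Y I J : unit_im I ->
  conj_val X Y I ** (J ** Y) = (I ** conj_val X Y I) ** Y ->
  cdnormsq (conj_val X Y I) * cdnormsq (X + J ** Y) = nrm0 X Y ^+ 2 + nrm1 X Y ^+ 2.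
Proof. by move=> hI E; rewrite -cdnormsqM // conj_val_mul // normsq_slice. Qed.

Definition im_part w := w - cdre w *: cdone R n.

Lemma im_part_re w : cdre (im_part w) = 0.
Proof. by rewrite /im_part -scaleNr cdreD cdreZ cdre1 mulr1 subrr. Qed.

Lemma dot_im_part w J : cdre J = 0 -> cddot (im_part w) J = cddot w J.
Proof. by move=> r0; rewrite /im_part cddotDl cddotNl cddotZl -cdre_dot r0 mulr0 subr0. Qed.

Lemma im_part_normsq w : cdnormsq (im_part w) = cdnormsq w - cdre w ^+ 2.
Proof.
rewrite /im_part cdnormsqD cdnormsqN cdnormsqZ cdnormsq1 cddotNr cddotZr cddotC -cdre_dot.
by ring.
Qed.

(** Being affine in [J], [|f|^2] has its extrema on a sphere governed by the imaginary part of
    [X conj Y]. *)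
Lemma fv_normsq X Y J : unit_im J ->
  cdnormsq (X + J ** Y) = cdnormsq X + cdnormsq Y + 2 * cddot (X ** cdconj Y) J.
Proof.
move=> [r0 n1]; rewrite cdnormsqD cdnormsqM// n1 mul1r (cddotC _ J) -cddotMr cddotC.
by ring.
Qed.

Lemma conj_val_normsq X Y I : unit_im I ->
  cdnormsq (conj_val X Y I) = cdnormsq X + cdnormsq Y + 2 * cddot (cdconj X ** Y) I.
Proof.
by move=> hI; rewrite /conj_val fv_normsq// !cdnormsq_conj cdconjK.
Qed.

(* On a sphere, [|f|^2] ranges between [|X|^2 + |Y|^2 - 2 sqrt gap] and        *)
(* [|X|^2 + |Y|^2 + 2 sqrt gap].                                               *)
Definition gap X Y : R := cdnormsq X * cdnormsq Y - cddot X Y ^+ 2.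

(** The product of the two extreme values of [|f|^2] on a sphere is [|N(f)|^2]. *)
Lemma gapE X Y : (cdnormsq X + cdnormsq Y) ^+ 2 - 4 * gap X Y = nrm0 X Y ^+ 2 + nrm1 X Y ^+ 2.
Proof. by rewrite /gap /nrm0 /nrm1; ring. Qed.

(** With [gap_u]: [X conj Y] and [conj X Y] have imaginary parts of equal norm, so [|f|] and [|f^c|]
    have the same extreme values on a sphere. *)
Lemma gap_v X Y : cdnormsq (im_part (X ** cdconj Y)) = gap X Y.
Proof.
by rewrite im_part_normsq cdnormsqM// cdnormsq_conj cdre_dot cddotC cddotMr cdconjK cdmul1l /gap.
Qed.

Lemma gap_u X Y : cdnormsq (im_part (cdconj X ** Y)) = gap X Y.
Proof.
by rewrite im_part_normsq cdnormsqM// cdnormsq_conj cdre_dot cddotC cddotMl cdconjK cdmul1r cddotC /gap.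
Qed.

Lemma cauchy_unit w J : unit_im J -> cddot w J ^+ 2 <= cdnormsq (im_part w).
Proof.
move=> hJ; have [r0 n1] := hJ.
have := cdnormsq_ge0 (im_part w + (- cddot w J) *: J).
rewrite cdnormsqD cdnormsqZ n1 cddotZr dot_im_part//; lra.
Qed.

Lemma unit_extremal w J0 : unit_im J0 -> exists2 J, unit_im J & cddot w J = Num.sqrt (cdnormsq (im_part w)).
Proof.
move=> h0; have [z|nz] := eqVneq (cdnormsq (im_part w)) 0.
  (* The form vanishes on all imaginary units, so any unit serves. *)
  exists J0 => //; rewrite z sqrtr0; apply/eqP; rewrite -sqrf_eq0 eq_le sqr_ge0 andbT.
  by rewrite -z; exact: cauchy_unit.
have p : 0 < cdnormsq (im_part w) by rewrite lt_neqAle eq_sym nz cdnormsq_ge0.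
set m := Num.sqrt _.
have m2 : m ^+ 2 = cdnormsq (im_part w) by rewrite sqr_sqrtr// ltW.
have m0 : m != 0 by rewrite gt_eqF// sqrtr_gt0.
have hJ : unit_im (m^-1 *: im_part w).
  by split; [rewrite cdreZ im_part_re mulr0|rewrite cdnormsqZ -m2 -exprMn mulVf// expr1n].
exists (m^-1 *: im_part w) => //.
rewrite -dot_im_part; last exact: hJ.1.
by rewrite cddotZr -cdnormsqE -m2 expr2 mulKf.
Qed.

(** Equality case of Cauchy-Schwarz: both units are the same multiple of the imaginary part of
    [w]. *)
Lemma unit_minimal_uniq w J J' : unit_im J -> unit_im J' -> 0 < cdnormsq (im_part w) ->
  cddot w J ^+ 2 = cdnormsq (im_part w) -> cddot w J' = cddot w J -> J' = J.
Proof.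
move=> hJ hJ' p E E'.
have P K : unit_im K -> cddot w K = cddot w J -> im_part w = cddot w J *: K.
  move=> hK EK; apply/eqP; rewrite -subr_eq0 -scaleNr; apply/eqP/cdnormsq_eq0.
  rewrite cdnormsqD cdnormsqZ hK.2 cddotZr dot_im_part ?EK; last exact: hK.1.
  by rewrite -E; ring.
have := P _ hJ' E'; rewrite (P _ hJ erefl) => H.
have d0 : cddot w J != 0 by apply: contraTneq p => h; rewrite -E h expr0n ltxx.
by have := congr1 (fun x => (cddot w J)^-1 *: x) H; rewrite !scalerA mulVf// !scale1r.
Qed.

(* Rational parametrization of the circle through the orthogonal [J], [K].     *)
Definition unit_rot J K (t : R) := ((1 - t ^+ 2) / (1 + t ^+ 2)) *: J + (2 * t / (1 + t ^+ 2)) *: K.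

Lemma unit_rot_unit J K t : unit_im J -> unit_im K -> cddot J K = 0 -> unit_im (unit_rot J K t).
Proof.
move=> [rJ nJ] [rK nK] JK; split; first by rewrite cdreD !cdreZ rJ rK !mulr0 addr0.
have t0 : 1 + t ^+ 2 != 0 by rewrite gt_eqF// ltr_pwDl// sqr_ge0.
rewrite cdnormsqD !cdnormsqZ nJ nK cddotZl cddotZr JK; field; exact: t0.
Qed.

(** Along [unit_rot] the inequality becomes [0 <= t (<w, K> - t <w, J0>)] for small [t] of either
    sign, so [<w, K> = 0] and [<w, J0> <= 0]. If the imaginary part of [w] had a component
    orthogonal to [J0], normalizing that component would give a [K] with [<w, K>] nonzero. *)
Lemma affine_local_min w J0 : unit_im J0 ->
  (exists2 K, unit_im K & cddot J0 K = 0) ->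
  (forall K, unit_im K -> cddot J0 K = 0 ->
     exists2 d : R, 0 < d & forall t, `|t| < d -> cddot w J0 <= cddot w (unit_rot J0 K t)) ->
  im_part w = cddot w J0 *: J0 /\ cddot w J0 <= 0.
Proof.
move=> h0 [K0 hK0 JK0] H.
have st K : unit_im K -> cddot J0 K = 0 -> cddot w K = 0 /\ cddot w J0 <= 0.
  move=> hK JK; have [d d0 Hd] := H K hK JK.
  have key t : `|t| < d -> 0 <= t * (cddot w K - t * cddot w J0).
    move=> td; have := Hd t td; rewrite /unit_rot cddotDr !cddotZr.
    have t1 : 0 < 1 + t ^+ 2 by rewrite ltr_pwDl// sqr_ge0.
    rewrite -(ler_pM2l t1).
    have -> : (1 + t ^+ 2) * ((1 - t ^+ 2) / (1 + t ^+ 2) * cddot w J0 + 2 * t / (1 + t ^+ 2) * cddot w K) =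
       (1 - t ^+ 2) * cddot w J0 + 2 * t * cddot w K by field; rewrite gt_eqF.
    by rewrite mulrBr mulrA -expr2; lra.
  set k := cddot w K in key *; set s := cddot w J0 in key *.
  have k0 : k = 0.
    pose t : R := Num.min (d / 2) (`|k| / (2 * (1 + `|s|))).
    apply/eqP; apply/negPn/negP => kn.
    have ap : 0 < `|k| by rewrite normr_gt0.
    have s0 : 0 <= `|s| by [].
    have tp : 0 < t by rewrite lt_min !divr_gt0 // mulr_gt0// ltr_pwDl.
    have td : t < d by rewrite gt_min; apply/orP; left; lra.
    have tk : t * (2 * (1 + `|s|)) <= `|k|.
      by rewrite -ler_pdivlMr ?ge_min ?lexx ?orbT// mulr_gt0// ltr_pwDl.
    have ss : `|t * s| < `|k|.
      by rewrite normrM (gtr0_norm tp); nra.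
    have [k0|k0] := ltP 0 k.
      have : 0 <= - t * (k - - t * s) by apply: key; rewrite normrN gtr0_norm.
      move: ss; rewrite (gtr0_norm k0) ltr_norml => /andP[? ?]; nra.
    have k1 : k < 0 by rewrite lt_neqAle kn.
    have : 0 <= t * (k - t * s) by apply: key; rewrite gtr0_norm.
    move: ss; rewrite (ltr0_norm k1) ltr_norml => /andP[? ?]; nra.
  split => //.
  have d2 : 0 < d / 2 by rewrite divr_gt0.
  have : 0 <= (d / 2) * (k - (d / 2) * s) by apply: key; rewrite gtr0_norm//; lra.
  rewrite k0 sub0r pmulr_rge0// oppr_ge0 pmulr_rle0//.
split; last by have [] := st K0 hK0 JK0.
have [rJ nJ] := h0.
apply/eqP; rewrite -subr_eq0; apply/negPn/negP => /eqP ne.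
set y := im_part w - _ in ne.
have ry : cdre y = 0 by rewrite /y -scaleNr cdreD im_part_re cdreZ rJ mulr0 addr0.
have yJ : cddot J0 y = 0.
  by rewrite /y -scaleNr cddotDr cddotZr -cdnormsqE nJ (cddotC _ (im_part w)) dot_im_part// mulr1 subrr.
have yp := cdnormsq_gt0 ne.
set m := Num.sqrt (cdnormsq y).
have m2 : m ^+ 2 = cdnormsq y by rewrite sqr_sqrtr// ltW.
have m0 : m != 0 by rewrite gt_eqF// sqrtr_gt0.
have hK : unit_im (m^-1 *: y).
  by split; [rewrite cdreZ ry mulr0|rewrite cdnormsqZ -m2 -exprMn mulVf// expr1n].
have [] := st _ hK; first by rewrite cddotZr yJ mulr0.
rewrite -dot_im_part; last exact: hK.1.
rewrite cddotZr.
have -> : cddot (im_part w) y = cdnormsq y.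
  have -> : im_part w = y + cddot w J0 *: J0 by rewrite /y subrK.
  by rewrite cddotDl cddotZl yJ mulr0 addr0 -cdnormsqE.
by move=> /eqP; rewrite mulf_eq0 invr_eq0 (negPf m0) gt_eqF.
Qed.

(* [X] and [Y] lie in [conj c] times the plane of [I], where no associativity  *)
(* problem arises.                                                             *)
Lemma slice_constant X Y I c (s t : R) : unit_im I -> c <> 0 ->
  nrm0 X Y ^+ 2 + nrm1 X Y ^+ 2 != 0 ->
  conj_val X Y I = nrm0 X Y *: c + nrm1 X Y *: (I ** c) ->
  cdconj X ** Y = s *: cdone R n + t *: I ->
  X + ((cdnormsq c)^-1 *: (cdconj c ** (I ** c))) ** Y = (cdnormsq c)^-1 *: cdconj c.
Proof.
move=> hI c0 nu0 aE kE.
set n0 := nrm0 X Y in nu0 aE *; set n1 := nrm1 X Y in nu0 aE *.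
set a := conj_val X Y I in aE.
set C := cdnormsq c; have C0 : 0 < C by exact: cdnormsq_gt0.
(* In the basis [e], [g] of [conj c] times the plane of [I], right multiplication by [I] is a
   quarter turn. *)
set e := cdconj c; set g := cdconj c ** I.
have gI : g ** I = - e by exact: unit_imKr.
have acE : cdconj a = n0 *: e - n1 *: g.
  by rewrite aE cdconjD !cdconjZ cdconjM (unit_im_conj hI) cdmulNr scalerN.
have aF2 : a ** Y = s *: cdone R n + (t + cdnormsq Y) *: I.
  have := cd_altr (cdconj Y) I n4; rewrite cdconjK cdnormsq_conj => h.
  by rewrite /a /conj_val cdmulDl h kE scalerDl addrA.
have na : 0 < cdnormsq a.
  have -> : cdnormsq a = (n0 ^+ 2 + n1 ^+ 2) * C.
    rewrite aE cdnormsqD !cdnormsqZ cddotZl cddotZr dot_unit_mul// cdnormsqM// hI.2 -/C; ring.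
  by rewrite mulr_gt0// lt_neqAle eq_sym nu0 addr_ge0 ?sqr_ge0.
pose t' := t + cdnormsq Y.
pose p := (cdnormsq a)^-1 * (n0 * s + n1 * t').
pose q := (cdnormsq a)^-1 * (n0 * t' - n1 * s).
have YE : Y = p *: e + q *: g.
  have := cd_altl a Y n4; rewrite aF2 -/t' acE.
  rewrite cdmulDr !cdmulZr cdmul1r !cdmulBl !cdmulZl gI -/g => h.
  have := congr1 (fun x => (cdnormsq a)^-1 *: x) h; rewrite scalerA mulVf ?gt_eqF// scale1r => <-.
  by rewrite /p /q; vec; ring.
pose h := n0 - q; pose k := p - n1.
have XE : X = h *: e + k *: g.
  have : cdconj a = X + - (Y ** I).
    by rewrite /a /conj_val cdconjD cdconjM !cdconjK (unit_im_conj hI) cdmulNr.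
  rewrite acE YE cdmulDl !cdmulZl gI -/g => E.
  have -> : X = n0 *: e - n1 *: g + (p *: g + q *: - e) by rewrite E subrK.
  by rewrite /h /k; vec; ring.
have ne : cdnormsq e = C by rewrite cdnormsq_conj.
have ng : cdnormsq g = C by rewrite /g cdnormsqM// ne hI.2 mulr1.
have eg : cddot e g = 0 by exact: dot_mul_unit.
have N0 : n0 = C * (h ^+ 2 + k ^+ 2 - p ^+ 2 - q ^+ 2).
  rewrite /n0 /nrm0 [in LHS]XE [in LHS]YE !cdnormsqD !cdnormsqZ !cddotZl !cddotZr eg ne ng; ring.
have N1 : n1 = 2 * C * (h * p + k * q).
  rewrite /n1 /nrm1 [in LHS]XE [in LHS]YE !cddotDl !cddotDr !cddotZl !cddotZr -!cdnormsqE (cddotC g) eg ne ng; ring.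
(* [A0] and [A1] form a linear system in [C (n0 - 2 q)] and [C (n1 - 2 p)], of determinant
   [- (n0^2 + n1^2)], solved by 1 and 0. *)
have A0 : n0 = n0 * (C * (n0 - 2 * q)) + n1 * (C * (n1 - 2 * p)).
  by rewrite [LHS]N0 /h /k; ring.
have A1 : n1 = n1 * (C * (n0 - 2 * q)) - n0 * (C * (n1 - 2 * p)).
  by rewrite [LHS]N1 /h /k; ring.
have E1 : C * (n0 - 2 * q) = 1.
  apply/eqP; rewrite -subr_eq0 -(mulrI_eq0 _ (mulfI nu0)); apply/eqP.
  transitivity (n0 * (n0 * (C * (n0 - 2 * q)) + n1 * (C * (n1 - 2 * p)) - n0) +
    n1 * (n1 * (C * (n0 - 2 * q)) - n0 * (C * (n1 - 2 * p)) - n1)); first by ring.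
  by rewrite -A0 -A1 !subrr !mulr0 addr0.
have E2 : C * (n1 - 2 * p) = 0.
  apply/eqP; rewrite -(mulrI_eq0 _ (mulfI nu0)); apply/eqP.
  transitivity (n1 * (n0 * (C * (n0 - 2 * q)) + n1 * (C * (n1 - 2 * p)) - n0) -
    n0 * (n1 * (C * (n0 - 2 * q)) - n0 * (C * (n1 - 2 * p)) - n1)); first by ring.
  by rewrite -A0 -A1 !subrr !mulr0 subr0.
have E2' : n1 - 2 * p = 0 by apply/eqP; move/eqP: E2; rewrite mulf_eq0 gt_eqF.
have E1' : n0 - 2 * q = C^-1 by rewrite -[LHS](mulKf (lt0r_neq0 C0)) E1 mulr1.
have JE : cdconj c ** (I ** c) = g ** c.
  by rewrite /g cdconjE !cdmulBl !cdmulZl !cdmul1l cd_flex.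
have Je : (g ** c) ** e = C *: g by rewrite cd_altr.
have Jg : (g ** c) ** g = - C *: e.
  have := cd_altl (cdconj c) I n4; rewrite cdconjK cdnormsq_conj -/g -/C => cg.
  by rewrite cd_flex// cg cdmulZr gI scaleNr scalerN.
rewrite JE {1}XE {1}YE cdmulZl cdmulDr !cdmulZr Je Jg.
transitivity ((h - q) *: e + (k + p) *: g).
  by vec; field; rewrite gt_eqF.
have -> : h - q = C^-1 by rewrite -E1' /h; ring.
have -> : k + p = 0 by rewrite /k -[RHS]oppr0 -E2'; ring.
by rewrite scale0r addr0.
Qed.

Lemma conj_rot_unit I c : unit_im I -> c <> 0 ->
  unit_im ((cdnormsq c)^-1 *: (cdconj c ** (I ** c))).
Proof.
move=> hI c0; have C0 := cdnormsq_gt0 c0; split.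
  by rewrite cdreZ cdre_dot cddotC cddotMl cdmul1r cdconjK cddotC dot_unit_mul// mulr0.
rewrite cdnormsqZ !cdnormsqM// cdnormsq_conj hI.2 mul1r; field.
by rewrite gt_eqF.
Qed.
End SliceAlgebra.

(** * Stems and the local form of the theorem *)

Section StemHolo.
Variable R : realType.
Implicit Types (z : plane R).

Lemma cddot_cont n (T : topologicalType) (X Y : T -> cd R n) t :
  {for t, continuous X} -> {for t, continuous Y} -> {for t, continuous (fun s => cddot (X s) (Y s) : R)}.
Proof.
elim: n X Y => [|n IH] X Y cX cY; first by apply: cvgM.
have c1 (Z : T -> cd R n * cd R n) : {for t, continuous Z} -> {for t, continuous (fun s => (Z s).1 : cd R n)}.
  by move=> cZ; apply: (cvg_comp _ _ cZ); exact: cvg_fst.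
have c2 (Z : T -> cd R n * cd R n) : {for t, continuous Z} -> {for t, continuous (fun s => (Z s).2 : cd R n)}.
  by move=> cZ; apply: (cvg_comp _ _ cZ); exact: cvg_snd.
by apply: cvgD; apply: IH; [exact: c1|exact: c1|exact: c2|exact: c2].
Qed.

Lemma cdconj_cont n (T : topologicalType) (X : T -> cd R n) t :
  {for t, continuous X} -> {for t, continuous (fun s => cdconj (X s))}.
Proof.
elim: n X => [//|n IH] X cX.
have c1 : {for t, continuous (fun s => (X s).1 : cd R n)}.
  by apply: (cvg_comp _ _ cX); exact: cvg_fst.
have c2 : {for t, continuous (fun s => - (X s).2 : cd R n)}.
  by apply: cvgN; apply: (cvg_comp _ _ cX); exact: cvg_snd.
exact: (cvg_pair (IH _ c1) c2).
Qed.

Lemma cdmul_cont n (T : topologicalType) (X Y : T -> cd R n) t :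
  {for t, continuous X} -> {for t, continuous Y} -> {for t, continuous (fun s => X s ** Y s)}.
Proof.
elim: n X Y => [|n IH] X Y cX cY.
  by apply: (@cvgM R^o).
have c1 (Z : T -> cd R n * cd R n) : {for t, continuous Z} -> {for t, continuous (fun s => (Z s).1 : cd R n)}.
  by move=> cZ; apply: (cvg_comp _ _ cZ); exact: cvg_fst.
have c2 (Z : T -> cd R n * cd R n) : {for t, continuous Z} -> {for t, continuous (fun s => (Z s).2 : cd R n)}.
  by move=> cZ; apply: (cvg_comp _ _ cZ); exact: cvg_snd.
have h1 : {for t, continuous (fun s => (X s).1 ** (Y s).1 - cdconj (Y s).2 ** (X s).2)}.
  by apply: cvgB; apply: IH; [exact: c1|exact: c1|apply: cdconj_cont; exact: c2|exact: c2].
have h2 : {for t, continuous (fun s => (Y s).2 ** (X s).1 + (X s).2 ** cdconj (Y s).1)}.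
  by apply: cvgD; apply: IH; [exact: c2|exact: c1|exact: c2|apply: cdconj_cont; exact: c1].
exact: (cvg_pair h1 h2).
Qed.

Lemma cdre_cont n : continuous (@cdre R n : cd R n -> R).
Proof.
move=> x; have -> : @cdre R n = (fun y => cddot (cdone R n) y) by apply/funext => y; exact: cdre_dot.
by apply: cddot_cont; [exact: cvg_cst|exact: cvg_id].
Qed.

Lemma cdnormsq_cont n (T : topologicalType) (X : T -> cd R n) t :
  {for t, continuous X} -> {for t, continuous (fun s => cdnormsq (X s) : R)}.
Proof.
move=> cX; have -> : (fun s => cdnormsq (X s)) = (fun s => cddot (X s) (X s)).
  by apply/funext => s; exact: cdnormsqE.
exact: cddot_cont.
Qed.

Lemma is_derive_dot n (F : plane R -> cd R n) z v dF (w : cd R n) :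
  is_derive z v F dF -> is_derive z v (fun x => cddot w (F x) : R^o) (cddot w dF).
Proof.
move=> [hF eF].
have cv : (fun h : R => h^-1 *: ((F \o shift z) (h *: v) - F z)) @ 0^' --> dF.
  by rewrite -eF; exact: hF.
have cw : (fun h : R => cddot w (h^-1 *: ((F \o shift z) (h *: v) - F z)) : R^o) @ 0^' --> cddot w dF.
  apply: (@cvg_comp _ _ _ _ (fun y => cddot w y : R^o) _ _ _ cv).
  by apply: cddot_cont; [exact: cvg_cst|exact: cvg_id].
have E : (fun h : R => cddot w (h^-1 *: ((F \o shift z) (h *: v) - F z)) : R^o) =
    (fun h : R => h^-1 *: (((fun x => cddot w (F x) : R^o) \o shift z) (h *: v) - cddot w (F z))).
  by apply/funext => h; rewrite cddotZr cddotDr cddotNr.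
rewrite E in cw; split; first by apply/cvg_ex; exists (cddot w dF).
by apply: cvg_lim cw => //; exact: Rhausdorff.
Qed.

(* For each coordinate [w], the pair [(<w, F1>, <w, F2>)] is holomorphic.      *)
Definition stem_holo n (F1 F2 P Q : plane R -> cd R n) z := forall w : cd R n,
  holo_at (fun x => cddot w (F1 x)) (fun x => cddot w (F2 x))
    (fun x => cddot w (P x)) (fun x => cddot w (Q x)) z.

Lemma regular_stem_holo n (D : set (plane R)) (F : stem R n) z :
  open D -> regular_stem D F -> D z ->
  stem_holo F.1 F.2 (d_alpha F.1) (d_alpha F.2) z.
Proof.
move=> oD [C1 C2 _ CR] Dz w.
have nD : \forall x \near z, D x by exact: open_nbhs_nbhs.
have [_ _ c1a c1b] := C1 z Dz; have [_ _ c2a c2b] := C2 z Dz.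
have cw (G : plane R -> cd R n) : {for z, continuous G} -> {for z, continuous (fun x => cddot w (G x) : R)}.
  by move=> cG; apply: cddot_cont => //; exact: cvg_cst.
have [CR1 CR2] := CR z Dz.
split.
- rewrite -cddotNr -CR2.
  apply: (@C1_is_diff R _ (fun x => cddot w (d_alpha F.1 x)) (fun x => cddot w (d_beta F.1 x))); try exact: cw.
    apply: filterS nD => x Dx; apply: is_derive_dot; have [? _ _ _] := C1 x Dx; exact: derivableP.
  apply: filterS nD => x Dx; apply: is_derive_dot; have [_ ? _ _] := C1 x Dx; exact: derivableP.
- rewrite CR1.
  apply: (@C1_is_diff R _ (fun x => cddot w (d_alpha F.2 x)) (fun x => cddot w (d_beta F.2 x))); try exact: cw.
    apply: filterS nD => x Dx; apply: is_derive_dot; have [? _ _ _] := C2 x Dx; exact: derivableP.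
  apply: filterS nD => x Dx; apply: is_derive_dot; have [_ ? _ _] := C2 x Dx; exact: derivableP.
- exact: cw.
- exact: cw.
Qed.

(** The pair is the sum, over the real coordinates, of the squares of the holomorphic coordinates of
    the stem; the induction halves the vectors. *)
Lemma stem_holo_nrm n (F1 F2 P Q : plane R -> cd R n) z :
  stem_holo F1 F2 P Q z ->
  holo_at (fun x => nrm0 (F1 x) (F2 x)) (fun x => nrm1 (F1 x) (F2 x))
    (fun x => 2 * (cddot (F1 x) (P x) - cddot (F2 x) (Q x)))
    (fun x => 2 * (cddot (F1 x) (Q x) + cddot (F2 x) (P x))) z.
Proof.
elim: n F1 F2 P Q => [|n IH] F1 F2 P Q H.
  have := holo_mul (H 1) (H 1).
  set u := fun w => _; set v := fun w => _; set p := fun w => _; set q := fun w => _.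
  have -> : u = (fun x => nrm0 (F1 x) (F2 x)) by apply/funext => x; rewrite /u /nrm0 /=; ring.
  have -> : v = (fun x => nrm1 (F1 x) (F2 x)) by apply/funext => x; rewrite /v /nrm1 /=; ring.
  have -> : p = (fun x => 2 * (cddot (F1 x) (P x) - cddot (F2 x) (Q x))).
    by apply/funext => x; rewrite /p /=; ring.
  have -> // : q = (fun x => 2 * (cddot (F1 x) (Q x) + cddot (F2 x) (P x))).
    by apply/funext => x; rewrite /q /=; ring.
have h1 : stem_holo (fun x => (F1 x).1) (fun x => (F2 x).1) (fun x => (P x).1) (fun x => (Q x).1) z.
  move=> w; have := H (w, 0).
  by congr holo_at; apply/funext => x; rewrite /= cddot0l addr0.
have h2 : stem_holo (fun x => (F1 x).2) (fun x => (F2 x).2) (fun x => (P x).2) (fun x => (Q x).2) z.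
  move=> w; have := H (0, w).
  by congr holo_at; apply/funext => x; rewrite /= cddot0l add0r.
have := holo_lin 1 1 (IH _ _ _ _ h1) (IH _ _ _ _ h2).
by congr holo_at; apply/funext => x; rewrite /nrm0 /nrm1 /=; ring.
Qed.

End StemHolo.

(** * The maximum principle on a slice and its consequence for [f] *)

Section Core.
Variables (R : realType) (n : nat).
Hypothesis n4 : (n < 4)%N.
Implicit Types (z : plane R) (I J K c d e : cd R n) (P Q : plane R -> cd R n).

Lemma dot_unitl I x y : unit_im I -> cddot (I ** x) y = - cddot x (I ** y) :> R.
Proof. by move=> hI; rewrite cddotMl (unit_im_conj hI) cdmulNl cddotNr. Qed.

(** Splitting on the slice of [J]: the pair is [(<e, F1> + i <e, F2>) + i (<J e, F1> + i <J e,
    F2>)]. *)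
Lemma stem_holo_slice (F1 F2 P Q : plane R -> cd R n) J e z :
  stem_holo F1 F2 P Q z -> unit_im J ->
  holo_at (fun x => cddot e (F1 x + J ** F2 x)) (fun x => cddot (J ** e) (F1 x + J ** F2 x))
    (fun x => cddot e (P x + J ** Q x)) (fun x => cddot (J ** e) (P x + J ** Q x)) z.
Proof.
move=> H hJ.
have E1 X Y : cddot e (X + J ** Y) = 1 * cddot e X + -1 * cddot (J ** e) Y.
  by rewrite cddotDr dot_unitl//; ring.
have E2 X Y : cddot (J ** e) (X + J ** Y) = 1 * cddot e Y + -1 * - cddot (J ** e) X.
  by rewrite cddotDr [X in _ + X]dot_unitl// unit_imK// cddotNr; ring.
have := holo_lin 1 (-1) (H e) (holo_rot (H (J ** e))).
by congr holo_at; apply/funext => x; rewrite ?E1 ?E2.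
Qed.

Lemma stem_holo_conj (F1 F2 P Q : plane R -> cd R n) z :
  stem_holo F1 F2 P Q z ->
  stem_holo (fun x => cdconj (F1 x)) (fun x => cdconj (F2 x))
    (fun x => cdconj (P x)) (fun x => cdconj (Q x)) z.
Proof.
move=> H w; have := H (cdconj w).
by congr holo_at; apply/funext => x; rewrite -cddot_conj cdconjK.
Qed.

Definition nu (X Y : cd R n) : R := nrm0 X Y ^+ 2 + nrm1 X Y ^+ 2.

Lemma nu_ge0 X Y : 0 <= nu X Y.
Proof. by rewrite addr_ge0 // sqr_ge0. Qed.

Lemma stem_holo_nu_cont (F1 F2 P Q : plane R -> cd R n) z :
  stem_holo F1 F2 P Q z -> {for z, continuous (fun x => nu (F1 x) (F2 x))}.
Proof.
move=> /stem_holo_nrm/holo_at_continuous[c0 c1].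
by rewrite /nu; apply: cvgD; rewrite /= ?expr2; apply: cvgM.
Qed.

(** On the slice of [I], [g = N(f)^-1 f^c] satisfies [|g|^2 <= 1 / B] with equality at [z0]. The
    scalar maximum principle is applied to [<c, g>] with [c = g z0], the real part of a product of
    two holomorphic pairs. Then [<c, g> = |c|^2] and [|g| <= |c|] give [g = c]. *)
Lemma slice_max_modulus (F1 F2 P Q : plane R -> cd R n) I z0 (B : R) : unit_im I -> 0 < B ->
  (\forall z \near z0, stem_holo F1 F2 P Q z) ->
  (\forall z \near z0, cdnormsq (conj_val (F1 z) (F2 z) I) * B <= nu (F1 z) (F2 z)) ->
  cdnormsq (conj_val (F1 z0) (F2 z0) I) * B = nu (F1 z0) (F2 z0) ->
  nu (F1 z0) (F2 z0) != 0 ->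
  exists2 c, cdnormsq c = B^-1 & \forall z \near z0,
    conj_val (F1 z) (F2 z) I = nrm0 (F1 z) (F2 z) *: c + nrm1 (F1 z) (F2 z) *: (I ** c).
Proof.
move=> hI B0 H M E0 nz.
pose n0 z := nrm0 (F1 z) (F2 z); pose n1 z := nrm1 (F1 z) (F2 z).
pose a z := conj_val (F1 z) (F2 z) I.
pose N z := nu (F1 z) (F2 z).
pose g z := (N z)^-1 *: (n0 z *: a z - n1 z *: (I ** a z)).
have N0 z : 0 <= N z by exact: nu_ge0.
have ng z : N z != 0 -> cdnormsq (g z) = cdnormsq (a z) / N z.
  move=> Nz; rewrite /g cdnormsqZ -scaleNr cdnormsqD !cdnormsqZ cddotZl cddotZr dot_unit_mul//.
  by rewrite cdnormsqM// hI.2 mul1r sqrrN mulr0 mulr0 mulr0 addr0 -mulrDl -/(N z) -/(nu _ _) -/(N z); field.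
pose c := g z0.
have nc : cdnormsq c = B^-1.
  rewrite /c ng// /N -E0; field; rewrite gt_eqF//=.
  by apply: contraNneq nz => h; rewrite -E0 h mul0r.
exists c => //.
have nearN : \forall z \near z0, N z != 0.
  have cN : {for z0, continuous N} by exact: stem_holo_nu_cont (nbhs_singleton H).
  have : 0 < N z0 by rewrite lt_neqAle eq_sym nz N0.
  move=> Np; have /cvgr_gt/(_ _ Np) := cN.
  by apply: filterS => z; apply: lt0r_neq0.
have [s s0 Hs] := near_esq (filterI (filterI H M) nearN).
have ub w : esq z0 w <= s ^+ 2 -> cdnormsq (g w) <= cdnormsq c.
  move=> /Hs[[_ Mw] Nw]; rewrite ng// nc.
  have Np : 0 < N w by rewrite lt_neqAle eq_sym Nw N0.
  by rewrite ler_pdivrMr// ler_pdivlMl// mulrC.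
have NE z : n0 z * n0 z + n1 z * n1 z = N z by rewrite /N /nu !expr2.
have Nz' w : esq z0 w <= s ^+ 2 -> n0 w * n0 w + n1 w * n1 w != 0.
  by rewrite NE => /Hs[].
have Hh w (hw : esq z0 w <= s ^+ 2) := (Hs w hw).1.1.
have := @max_on_disc R _ _ _ _ z0 s (ltW s0) (fun w hw =>
  holo_mul (stem_holo_slice c (stem_holo_conj (Hh w hw)) hI)
           (holo_inv (stem_holo_nrm (Hh w hw)) (Nz' w hw))).
have re_g z : cddot c (cdconj (F1 z) + I ** cdconj (F2 z)) *
    (nrm0 (F1 z) (F2 z) * (nrm0 (F1 z) (F2 z) * nrm0 (F1 z) (F2 z) + nrm1 (F1 z) (F2 z) * nrm1 (F1 z) (F2 z))^-1) -
   cddot (I ** c) (cdconj (F1 z) + I ** cdconj (F2 z)) *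
    (-1 * (nrm1 (F1 z) (F2 z) * (nrm0 (F1 z) (F2 z) * nrm0 (F1 z) (F2 z) + nrm1 (F1 z) (F2 z) * nrm1 (F1 z) (F2 z))^-1))
   = cddot c (g z).
  rewrite -/(n0 z) -/(n1 z) NE -/(conj_val (F1 z) (F2 z) I) -/(a z) dot_unitl// /g.
  by move: (a z) (N z) (n0 z) (n1 z) => ? ? ? ?; rewrite cddotZr cddotDr cddotNr !cddotZr; ring.
move=> K.
have {}K w : esq z0 w <= s ^+ 2 -> cddot c (g w) = cdnormsq c.
  move=> hw; rewrite -re_g K//; first by rewrite re_g -cdnormsqE.
  move=> x hx; rewrite !re_g -/c -cdnormsqE.
  have := cdnormsq_ge0 (g x - c); rewrite cdnormsqD cdnormsqN cddotNr cddotC.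
  by have := ub x hx; rewrite (cddotC c); lra.
have gc w : esq z0 w <= s ^+ 2 -> g w = c.
  move=> hw; apply/eqP; rewrite -subr_eq0; apply/eqP/cdnormsq_eq0/le_anti.
  rewrite cdnormsq_ge0 andbT cdnormsqD cdnormsqN cddotNr cddotC K//.
  by have := ub w hw; lra.
have esq00 : esq z0 z0 < s ^+ 2 by rewrite /esq !subrr expr0n addr0 exprn_gt0.
apply: filterS (near_esq_lt esq00) => w /ltW hw.
rewrite -(gc w hw) /g -/(a w) -/(n0 w) -/(n1 w).
have Nw : N w != 0 by have [] := Hs w hw.
rewrite cdmulZr cdmulBr !cdmulZr unit_imK//.
rewrite -[LHS]scale1r -(mulVf Nw) -{2}NE.
by move: (a w) (I ** a w) (N w) (n0 w) (n1 w) => ? ? ? ? ?; vec; ring.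
Qed.

Lemma rot_near I K (B : set (cd R n)) : nbhs I B ->
  exists2 d : R, 0 < d & forall t, `|t| < d -> B (unit_rot I K t).
Proof.
move=> nB.
have cr : unit_rot I K t @[t --> (0 : R)] --> I.
  have e : unit_rot I K 0 = I.
    by rewrite /unit_rot expr0n subr0 addr0 divr1 mulr0 mul0r scale0r addr0 scale1r.
  rewrite -{2}e.
  have ct : (fun t : R => t) @ (0 : R) --> (0 : R) by exact: cvg_id.
  have c2 : (fun t : R => t ^+ 2) @ (0 : R) --> (0 : R) ^+ 2 by rewrite expr2; apply: cvgM.
  have cV : (fun t : R => (1 + t ^+ 2)^-1) @ (0 : R) --> (1 + (0 : R) ^+ 2)^-1.
    by apply: cvgV; [rewrite expr0n addr0 oner_eq0|apply: cvgD => //; exact: cvg_cst].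
  apply: cvgD; apply: cvgZr_tmp; apply: cvgM => //.
    by apply: cvgB => //; exact: cvg_cst.
  by apply: cvgM => //; exact: cvg_cst.
have /nbhs_ballP[d d0 H] := cr _ nB.
by exists d => // t td; apply: H; rewrite -ball_normE /= sub0r normrN.
Qed.

(** For quaternions, [K] is a quarter turn of the first two imaginary coordinates, normalized;
    doubling keeps it as [(K, 0)]. *)
Lemma unit_orth J : (1 < n)%N -> unit_im J -> exists2 K, unit_im K & cddot J K = 0.
Proof.
pose orth m := forall x : cd R m, exists2 K : cd R m, unit_im K & cddot x K = 0.
suff H m : (1 < m)%N -> orth m by move=> n1 _; exact: H.
have step k : orth k -> orth k.+1.
  move=> IH [x1 x2]; have [K [rK nK] xK] := IH x1.
  exists (K, 0); first split; rewrite /= ?nK ?cdnormsqE ?cddot0l ?addr0//.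
  by rewrite xK cddot0r addr0.
elim: m => [//|[//|m] IH] _.
case: m IH => [_|m IH]; last by apply: step; exact: IH.
move=> x.
move: x => [[a b] [c d]].
have [/eqP|nz] := eqVneq (b ^+ 2 + c ^+ 2) 0.
  rewrite paddr_eq0 ?sqr_ge0// !sqrf_eq0 => /andP[/eqP -> /eqP ->].
  by exists ((0, 1), (0, 0)); [by split; rewrite //= expr1n !expr0n !addr0 add0r|rewrite /=; ring].
have p : 0 < b ^+ 2 + c ^+ 2 by rewrite lt_neqAle eq_sym nz addr_ge0 // sqr_ge0.
pose k := Num.sqrt (b ^+ 2 + c ^+ 2).
have k2 : k ^+ 2 = b ^+ 2 + c ^+ 2 by rewrite sqr_sqrtr// ltW.
have k0 : k != 0 by rewrite gt_eqF// sqrtr_gt0.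
exists ((0, c / k), (- b / k, 0)); last by rewrite /=; ring.
split => //=; transitivity ((b ^+ 2 + c ^+ 2) / k ^+ 2); first by field.
by rewrite k2 divff.
Qed.

(** Once [g = c] on the slice of [I], equality holds at every [z] near [z0], so at each of them [I]
    maximizes [|conj_val|] among the units of [V]. By [affine_local_min] the imaginary part of
    [conj F1 F2] is then a multiple of [I], as [slice_constant] requires. The witnesses are
    [c^-1 I c] and [c^-1]. *)
Lemma local_slice_constant (F1 F2 P Q : plane R -> cd R n) I z0 (B : R) :
  (1 < n)%N -> unit_im I -> 0 < B ->
  (\forall z \near z0, stem_holo F1 F2 P Q z) ->
  (exists2 V, nbhs I V & \forall z \near z0, forall K, V K -> unit_im K ->
     cdnormsq (conj_val (F1 z) (F2 z) K) * B <= nu (F1 z) (F2 z)) ->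
  cdnormsq (conj_val (F1 z0) (F2 z0) I) * B = nu (F1 z0) (F2 z0) ->
  nu (F1 z0) (F2 z0) != 0 ->
  exists J d, [/\ unit_im J, cdnormsq d = B,
    conj_val (F1 z0) (F2 z0) I ** d = nrm0 (F1 z0) (F2 z0) *: cdone R n + nrm1 (F1 z0) (F2 z0) *: I &
    \forall z \near z0, F1 z + J ** F2 z = d].
Proof.
move=> n1 hI B0 H [V nV M] E0 nz.
have M1 : \forall z \near z0, cdnormsq (conj_val (F1 z) (F2 z) I) * B <= nu (F1 z) (F2 z).
  by apply: filterS M => z; apply => //; exact: nbhs_singleton.
have [c nc aE] := slice_max_modulus hI B0 H M1 E0 nz.
have c0 : c <> 0.
  by move=> c0; move: nc; rewrite c0 cdnormsqE cddot0l => /esym/eqP; rewrite invr_eq0 gt_eqF.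
have C0 := cdnormsq_gt0 c0.
have nearN : \forall z \near z0, nu (F1 z) (F2 z) != 0.
  have : 0 < nu (F1 z0) (F2 z0) by rewrite lt_neqAle eq_sym nz nu_ge0.
  move=> Np; have /cvgr_gt/(_ _ Np) := stem_holo_nu_cont (nbhs_singleton H).
  by apply: filterS => z; apply: lt0r_neq0.
exists ((cdnormsq c)^-1 *: (cdconj c ** (I ** c))), ((cdnormsq c)^-1 *: cdconj c); split.
- exact: conj_rot_unit.
- rewrite cdnormsqZ cdnormsq_conj nc; field; rewrite gt_eqF//.
- rewrite (nbhs_singleton aE) cdmulZr cdmulDl !cdmulZl cdmul_conj cd_altr//.
  by vec; field; rewrite gt_eqF.
near=> z.
have az : conj_val (F1 z) (F2 z) I = nrm0 (F1 z) (F2 z) *: c + nrm1 (F1 z) (F2 z) *: (I ** c).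
  by near: z.
have Nz : nu (F1 z) (F2 z) != 0 by near: z.
have Mz : forall K, V K -> unit_im K -> cdnormsq (conj_val (F1 z) (F2 z) K) * B <= nu (F1 z) (F2 z).
  by near: z.
have na : cdnormsq (conj_val (F1 z) (F2 z) I) * B = nu (F1 z) (F2 z).
  rewrite az cdnormsqD !cdnormsqZ cddotZl cddotZr dot_unit_mul// cdnormsqM// hI.2 nc /nu; field.
  by rewrite gt_eqF.
have [||kE _] := @affine_local_min R n (- (cdconj (F1 z) ** F2 z)) I hI.
- exact: unit_orth.
- move=> K hK IK; have [d d0 Hd] := rot_near K nV; exists d => // t td.
  have hr := unit_rot_unit t hI hK IK.
  have := Mz _ (Hd t td) hr; rewrite -na ler_pM2r// !conj_val_normsq// !cddotNl; lra.
- pose s := cdre (cdconj (F1 z) ** F2 z).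
  apply: (@slice_constant R n n4 (F1 z) (F2 z) I c s (cddot (cdconj (F1 z) ** F2 z) I)) => //.
  move: kE; rewrite /im_part -scaleN1r cdreZ cddotZl -/s => kE.
  apply: oppr_inj; rewrite -scaleN1r; move: kE; move: (cdconj _ ** _) => y kE.
  have -> : -1 *: y = (-1 *: y - (-1 * s) *: cdone R n) + (-1 * s) *: cdone R n by rewrite subrK.
  by rewrite kE; vec; ring.
Unshelve. all: by end_near.
Qed.
End Core.

(** * From minima of [|f|] to maxima on a slice, case by case *)

Section LocalCases.
Variables (R : realType) (n : nat).
Hypothesis n4 : (n < 4)%N.
Implicit Types (z : plane R) (I J K c d e X Y : cd R n) (P Q : plane R -> cd R n).

(* [T_f] maps [alpha + beta I] to [alpha + beta (Tdir X Y I)].                 *)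
Definition Tdir X Y I : cd R n :=
  let a := conj_val X Y I in
  ((cdnormsq a)^-1 * (cdnormsq Y)^-1) *: ((cdconj a ** ((I ** a) ** Y)) ** cdconj Y).

Lemma Tdir_mul X Y I : Y <> 0 -> conj_val X Y I <> 0 ->
  Tdir X Y I ** Y = (cdnormsq (conj_val X Y I))^-1 *: (cdconj (conj_val X Y I) ** ((I ** conj_val X Y I) ** Y)).
Proof.
move=> /cdnormsq_gt0 Y0 /cdnormsq_gt0 a0; rewrite /Tdir.
set y := cdconj _ ** (_ ** Y).
have := cd_altr (cdconj Y) y n4; rewrite cdconjK cdnormsq_conj => h.
by rewrite cdmulZl h scalerA -mulrA mulVf ?mulr1// gt_eqF.
Qed.

(** [Tdir] is this relation solved for the direction; it is the hypothesis of [conj_val_mul]. *)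
Lemma Tdir_rel X Y I : Y <> 0 -> conj_val X Y I <> 0 ->
  conj_val X Y I ** (Tdir X Y I ** Y) = (I ** conj_val X Y I) ** Y.
Proof.
move=> Y0 a0; rewrite Tdir_mul// cdmulZr.
have := cd_altl (cdconj (conj_val X Y I)) ((I ** conj_val X Y I) ** Y) n4.
rewrite cdconjK cdnormsq_conj => ->.
by rewrite scalerA mulVf ?scale1r// gt_eqF// cdnormsq_gt0.
Qed.

Lemma Tdir_unit X Y I : unit_im I -> Y <> 0 -> conj_val X Y I <> 0 -> unit_im (Tdir X Y I).
Proof.
move=> hI Y0 a0; rewrite /Tdir; set a := conj_val X Y I in a0 *.
have Yp := cdnormsq_gt0 Y0; have ap := cdnormsq_gt0 a0.
split.
  rewrite cdreZ cdre_dot cddotC cddotMr cdconjK cdmul1l cddotMl cdconjK cddotMr.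
  by rewrite cd_altr// cddotZr cddotC dot_unit_mul// !mulr0.
rewrite cdnormsqZ !cdnormsqM// !cdnormsq_conj hI.2 mul1r; field.
by rewrite !gt_eqF.
Qed.

Lemma conj_val_cont (T : topologicalType) (X Y K : T -> cd R n) t :
  {for t, continuous X} -> {for t, continuous Y} -> {for t, continuous K} ->
  {for t, continuous (fun s => conj_val (X s) (Y s) (K s))}.
Proof.
move=> cX cY cK.
exact: (cvgD (cdconj_cont cX) (cdmul_cont cK (cdconj_cont cY))).
Qed.

Lemma Tdir_cont (T : topologicalType) (X Y K : T -> cd R n) t :
  Y t <> 0 -> conj_val (X t) (Y t) (K t) <> 0 ->
  {for t, continuous X} -> {for t, continuous Y} -> {for t, continuous K} ->
  {for t, continuous (fun s => Tdir (X s) (Y s) (K s))}.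
Proof.
move=> Y0 a0 cX cY cK; have ca := conj_val_cont cX cY cK.
have cv (Z : T -> cd R n) : Z t <> 0 -> {for t, continuous Z} ->
    (cdnormsq (Z s))^-1 @[s --> t] --> (cdnormsq (Z t))^-1.
  by move=> Z0 cZ; apply: cvgV; [rewrite gt_eqF// cdnormsq_gt0|exact: cdnormsq_cont].
exact: (cvgZ (cvgM (cv _ a0 ca) (cv _ Y0 cY))
  (cdmul_cont (cdmul_cont (cdconj_cont ca) (cdmul_cont (cdmul_cont cK ca) cY)) (cdconj_cont cY))).
Qed.

Lemma cd_mull_inj X Y Z : X <> 0 -> X ** Y = X ** Z -> Y = Z.
Proof.
move=> X0 E; have := cd_altl X Y n4; rewrite E cd_altl// => h.
by have := congr1 (fun x => (cdnormsq X)^-1 *: x) h; rewrite !scalerA mulVf ?scale1r// gt_eqF// cdnormsq_gt0.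
Qed.

Lemma cd_mulr_inj X Y Z : X <> 0 -> Y ** X = Z ** X -> Y = Z.
Proof.
move=> X0 E; have := cd_altr X Y n4; rewrite E cd_altr// => h.
by have := congr1 (fun x => (cdnormsq X)^-1 *: x) h; rewrite !scalerA mulVf ?scale1r// gt_eqF// cdnormsq_gt0.
Qed.

Lemma stem_holo_cont (F1 F2 P Q : plane R -> cd R n) z : stem_holo F1 F2 P Q z ->
  {for z, continuous F1} /\ {for z, continuous F2}.
Proof.
have H m (G : plane R -> cd R m) : (forall w : cd R m, {for z, continuous (fun x => cddot w (G x) : R)}) -> {for z, continuous G}.
  elim: m G => [|m IH] G H.
    have := H 1; rewrite (_ : (fun x => _) = G)//.
    by apply/funext => x /=; rewrite mul1r.
  have h1 : {for z, continuous (fun x => (G x).1 : cd R m)}.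
    apply: IH => w; have := H (w, 0).
    by rewrite (_ : (fun x => _) = (fun x => cddot w (G x).1))//; apply/funext => x /=; rewrite cddot0l addr0.
  have h2 : {for z, continuous (fun x => (G x).2 : cd R m)}.
    apply: IH => w; have := H (0, w).
    by rewrite (_ : (fun x => _) = (fun x => cddot w (G x).2))//; apply/funext => x /=; rewrite cddot0l add0r.
  have := cvg_pair h1 h2; rewrite (_ : (fun x => _) = G); last by apply/funext => x; case: (G x).
  by move=> hc; rewrite /prop_for /continuous_at [X in _ --> X]surjective_pairing; exact: hc.
by move=> hF; split; apply: H => w; have [] := holo_at_continuous (hF w).
Qed.

Lemma sqr_le_norm (x y : R) : 0 <= y -> x ^+ 2 <= y ^+ 2 -> `|x| <= y.
Proof. by move=> y0 h; rewrite -(@ler_pXn2r _ 2) ?nnegrE// real_normK ?num_real. Qed.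

Lemma im_part_normsqN X : cdnormsq (im_part (- X)) = cdnormsq (im_part X).
Proof. by rewrite !im_part_normsq cdnormsqN !cdre_dot cddotNr sqrrN. Qed.

(** As [B] bounds the smallest value [S - 2 sqrt g] of [|f|^2] on each sphere and
    [|conj_val|^2 <= S + 2 sqrt g], the product is at most [nu] for every slice; equality holds at
    [z0] for a maximizing [I]. The constant obtained is [f(x0)] because the minimizer on the sphere
    is unique when the gap is positive, and [f] is constant there when [F2 z0 = 0]. *)
Lemma local_sphere_min (F1 F2 P Q : plane R -> cd R n) J0 z0 : (1 < n)%N ->
  (\forall z \near z0, stem_holo F1 F2 P Q z) -> unit_im J0 ->
  F1 z0 + J0 ** F2 z0 <> 0 ->
  (0 < gap (F1 z0) (F2 z0) \/ F2 z0 = 0) ->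
  (\forall z \near z0, forall J, unit_im J ->
     cdnormsq (F1 z0 + J0 ** F2 z0) <= cdnormsq (F1 z + J ** F2 z)) ->
  exists2 J, unit_im J & \forall z \near z0, F1 z + J ** F2 z = F1 z0 + J0 ** F2 z0.
Proof.
move=> n1 H h0 f0 hg M.
pose S z := cdnormsq (F1 z) + cdnormsq (F2 z).
pose g z := gap (F1 z) (F2 z).
pose B := cdnormsq (F1 z0 + J0 ** F2 z0).
have B0 : 0 < B := cdnormsq_gt0 f0.
have g0 z : 0 <= g z by rewrite /g -gap_v// cdnormsq_ge0.
have sg z : Num.sqrt (g z) ^+ 2 = g z by rewrite sqr_sqrtr.
have sg0 z : 0 <= Num.sqrt (g z) by exact: sqrtr_ge0.
have S0 z : 0 <= S z by rewrite addr_ge0// cdnormsq_ge0.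
have nuE z : nu (F1 z) (F2 z) = (S z + 2 * Num.sqrt (g z)) * (S z - 2 * Num.sqrt (g z)).
  by rewrite /nu -gapE -/(S z) -/(g z) -{1}sg; ring.
have BS z : (forall J, unit_im J -> B <= cdnormsq (F1 z + J ** F2 z)) -> B <= S z - 2 * Num.sqrt (g z).
  move=> Mz; have [J hJ JE] := unit_extremal (- (F1 z ** cdconj (F2 z))) h0.
  have := Mz J hJ; rewrite fv_normsq// -/(S z).
  by move: JE; rewrite cddotNl im_part_normsqN gap_v// -/(g z); lra.
have aS z K : unit_im K -> cdnormsq (conj_val (F1 z) (F2 z) K) <= S z + 2 * Num.sqrt (g z).
  move=> hK; rewrite conj_val_normsq// -/(S z).
  have := cauchy_unit (cdconj (F1 z) ** F2 z) hK.
  rewrite gap_u// -/(g z) -{1}sg => /(sqr_le_norm (sg0 z)).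
  by rewrite ler_norml => /andP[_]; lra.
have [I hI IE] := unit_extremal (cdconj (F1 z0) ** F2 z0) h0.
have aI : cdnormsq (conj_val (F1 z0) (F2 z0) I) = S z0 + 2 * Num.sqrt (g z0).
  by rewrite conj_val_normsq// IE gap_u.
have BE : B = S z0 - 2 * Num.sqrt (g z0).
  apply/le_anti; rewrite BS; last exact: nbhs_singleton M.
  rewrite /B fv_normsq// -/(S z0) /=.
  have := cauchy_unit (F1 z0 ** cdconj (F2 z0)) h0.
  rewrite gap_v// -/(g z0) -{1}sg => /(sqr_le_norm (sg0 z0)).
  by rewrite ler_norml => /andP[]; lra.
have Sp : 0 < S z0 + 2 * Num.sqrt (g z0) by have := sg0 z0; move: B0; rewrite BE; lra.
have [|||J [d [hJ dB _ dE]]] := local_slice_constant n4 n1 hI B0 H.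
- exists setT; first exact: filterT.
  apply: filterS M => z Mz K _ hK; rewrite nuE.
  apply: le_trans (_ : _ <= (S z + 2 * Num.sqrt (g z)) * B) _.
    by rewrite ler_pM2r//; exact: aS.
  by rewrite ler_wpM2l ?BS// addr_ge0// mulr_ge0.
- by rewrite nuE aI -BE.
- by rewrite nuE -BE mulf_neq0 // gt_eqF.
exists J => //; suff <- : d = F1 z0 + J0 ** F2 z0 by [].
rewrite -(nbhs_singleton dE); case: hg => [gp|->]; last by rewrite !cdmul0r.
congr (_ + _ ** _); apply: (@unit_minimal_uniq R n (F1 z0 ** cdconj (F2 z0))) => //.
- by rewrite gap_v.
- have : 2 * cddot (F1 z0 ** cdconj (F2 z0)) J0 = - (2 * Num.sqrt (g z0)).
    by move: BE; rewrite /B fv_normsq// -/(S z0); lra.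
  move=> h; have -> : cddot (F1 z0 ** cdconj (F2 z0)) J0 = - Num.sqrt (g z0) by lra.
  by rewrite sqrrN sg gap_v.
- move: dB; rewrite -(nbhs_singleton dE) /B !fv_normsq//; lra.
Qed.

(** Multiplied on the left by [conj_val], both [d] and [f(x0)] give the value of [N(f)] at
    [alpha + beta I]; the common factor cancels. *)
Lemma local_from_direction (F1 F2 P Q : plane R -> cd R n) I J0 z0 : (1 < n)%N ->
  (\forall z \near z0, stem_holo F1 F2 P Q z) -> unit_im I ->
  F1 z0 + J0 ** F2 z0 <> 0 -> conj_val (F1 z0) (F2 z0) I <> 0 ->
  conj_val (F1 z0) (F2 z0) I ** (J0 ** F2 z0) = (I ** conj_val (F1 z0) (F2 z0) I) ** F2 z0 ->
  (exists2 V, nbhs I V & \forall z \near z0, forall K, V K -> unit_im K ->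
     cdnormsq (conj_val (F1 z) (F2 z) K) * cdnormsq (F1 z0 + J0 ** F2 z0) <= nu (F1 z) (F2 z)) ->
  exists2 J, unit_im J & \forall z \near z0, F1 z + J ** F2 z = F1 z0 + J0 ** F2 z0.
Proof.
move=> n1 H hI f0 a0 rel HM.
have B0 := cdnormsq_gt0 f0; have A0 := cdnormsq_gt0 a0.
have E0 := conj_val_normsq_mul n4 hI rel.
have [|J [d [hJ dB dE dN]]] := local_slice_constant n4 n1 hI B0 H HM E0.
  by rewrite /nu -E0 mulf_neq0// gt_eqF.
exists J => //; suff <- : d = F1 z0 + J0 ** F2 z0 by [].
by apply: (cd_mull_inj a0); rewrite dE conj_val_mul.
Qed.

Lemma conj_sandwich X I : cdconj X ** (I ** X) = (cdconj X ** I) ** X.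
Proof. by rewrite cdconjE !cdmulBl !cdmulZl !cdmul1l cd_flex. Qed.

(** A zero gap makes [X] a real multiple of [Y], and then [I = Y^-1 J0 Y] is sent to [J0] by [Tdir].
    Since [Tdir] is continuous at [(z0, I)], points near it are sent to where the minimality of
    [|f|] applies. *)
Lemma local_gap0 (F1 F2 P Q : plane R -> cd R n) J0 z0 (V : set (cd R n)) : (1 < n)%N ->
  (\forall z \near z0, stem_holo F1 F2 P Q z) -> unit_im J0 ->
  F2 z0 <> 0 -> gap (F1 z0) (F2 z0) = 0 -> F1 z0 + J0 ** F2 z0 <> 0 -> nbhs J0 V ->
  (\forall z \near z0, forall J, V J -> unit_im J ->
     cdnormsq (F1 z0 + J0 ** F2 z0) <= cdnormsq (F1 z + J ** F2 z)) ->
  exists2 J, unit_im J & \forall z \near z0, F1 z + J ** F2 z = F1 z0 + J0 ** F2 z0.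
Proof.
move=> n1 H h0 Y0 g0 f0 nV M.
set X := F1 z0 in g0 f0; set Y := F2 z0 in Y0 g0 f0.
have Yp := cdnormsq_gt0 Y0.
pose I := (cdnormsq Y)^-1 *: (cdconj Y ** (J0 ** Y)).
have hI : unit_im I by exact: conj_rot_unit.
have IY : I ** cdconj Y = cdconj Y ** J0.
  by rewrite /I cdmulZl conj_sandwich cd_altr// scalerA mulVf ?scale1r// gt_eqF.
pose t := cdre (X ** cdconj Y) / cdnormsq Y.
have XE : X = t *: Y.
  have : im_part (X ** cdconj Y) = 0 by apply: cdnormsq_eq0; rewrite gap_v.
  move=> /eqP; rewrite /im_part subr_eq0 => /eqP h.
  have := cd_altr (cdconj Y) X n4; rewrite h cdconjK cdnormsq_conj cdmulZl cdmul1l => h2.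
  by rewrite /t mulrC -scalerA h2 scalerA mulVf ?scale1r// gt_eqF.
have aE : conj_val X Y I = t *: cdconj Y + cdconj Y ** J0 by rewrite /conj_val IY XE cdconjZ.
have rel : conj_val X Y I ** (J0 ** Y) = (I ** conj_val X Y I) ** Y.
  have e1 : cdconj Y ** (J0 ** Y) = cdnormsq Y *: I by rewrite /I scalerA divff ?scale1r// gt_eqF.
  have e2 : (cdconj Y ** J0) ** (J0 ** Y) = - (cdnormsq Y *: cdone R n).
    have -> : cdconj Y ** J0 = - cdconj (J0 ** Y) by rewrite cdconjM (unit_im_conj h0) cdmulNr opprK.
    by rewrite cdmulNl cdconj_mul cdnormsqM// h0.2 mul1r.
  have e3 : (I ** cdconj Y) ** Y = cdnormsq Y *: I.
    by have := cd_altr (cdconj Y) I n4; rewrite cdconjK cdnormsq_conj.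
  rewrite aE cdmulDl cdmulZl e1 e2 -IY cdmulDr cdmulZr unit_imK// cdmulDl cdmulZl e3.
  by rewrite cdmulNl cdconj_mul.
have a0 : conj_val X Y I <> 0.
  move=> a0; have := conj_val_normsq_mul n4 hI rel; rewrite a0 {1}cdnormsqE cddot0l mul0r.
  rewrite -gapE g0 mulr0 subr0 => /esym/eqP; rewrite sqrf_eq0.
  by rewrite gt_eqF// ltr_wpDl// cdnormsq_ge0.
have TE : Tdir X Y I = J0.
  by apply: (cd_mulr_inj Y0); apply: (cd_mull_inj a0); rewrite Tdir_rel.
have [cX cY] := stem_holo_cont (nbhs_singleton H).
pose A z := conj_val (F1 z) (F2 z).
have c1 : {for (z0, I), continuous (fun p : plane R * cd R n => F1 p.1)}.
  by apply: (@cvg_comp _ _ _ (fun p : plane R * cd R n => p.1) F1 _ (nbhs z0)) => //; exact: cvg_fst.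
have c2 : {for (z0, I), continuous (fun p : plane R * cd R n => F2 p.1)}.
  by apply: (@cvg_comp _ _ _ (fun p : plane R * cd R n => p.1) F2 _ (nbhs z0)) => //; exact: cvg_fst.
have c3 : {for (z0, I), continuous (fun p : plane R * cd R n => p.2)} by exact: cvg_snd.
have cT := @Tdir_cont _ _ _ _ (z0, I) Y0 a0 c1 c2 c3.
have cA := @conj_val_cont _ _ _ _ (z0, I) c1 c2 c3.
have nz (T : topologicalType) (Z : T -> cd R n) s : Z s <> 0 -> {for s, continuous Z} ->
    \forall x \near s, Z x <> 0.
  move=> Zs cZ; have /cvgr_gt/(_ _ (cdnormsq_gt0 Zs)) := cdnormsq_cont cZ.
  by apply: filterS => x; rewrite cdnormsqE => + Zx; rewrite Zx cddot0l ltxx.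
have nT : \forall p \near (z0, I), [/\ V (Tdir (F1 p.1) (F2 p.1) p.2), F2 p.1 <> 0 & conj_val (F1 p.1) (F2 p.1) p.2 <> 0].
  have h1 : \forall p \near (z0, I), V (Tdir (F1 p.1) (F2 p.1) p.2).
    by apply: cT; rewrite /= -/X -/Y TE.
  have h2 := nz _ _ _ (Y0 : (fun p : plane R * cd R n => F2 p.1) (z0, I) <> 0) c2.
  have h3 := nz _ _ _ (a0 : (fun p : plane R * cd R n => conj_val (F1 p.1) (F2 p.1) p.2) (z0, I) <> 0) cA.
  by near=> p; split; near: p.
apply: (local_from_direction n1 H hI) => //.
have [[U W] [/= nU nW] UW] := nT.
exists W => //; near=> z => K WK hK.
have Uz : U z by near: z.
have [VT F2z Az] := UW (z, K) (conj Uz WK).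
have := conj_val_normsq_mul n4 hK (Tdir_rel F2z Az); rewrite /nu => <-.
rewrite ler_wpM2l ?cdnormsq_ge0//.
have Mz : forall J, V J -> unit_im J ->
     cdnormsq (F1 z0 + J0 ** F2 z0) <= cdnormsq (F1 z + J ** F2 z) by near: z.
by apply: Mz => //; exact: Tdir_unit.
Unshelve. all: by end_near.
Qed.

(** Where [F2] vanishes [Tdir] has no meaning, but there [|f|] and [|f^c|] agree and are constant on
    the sphere, so the bound for [J0] suffices. *)
Lemma local_degenerate (F1 F2 P Q : plane R -> cd R n) I J0 z0 (V : set (cd R n)) : (1 < n)%N ->
  (\forall z \near z0, stem_holo F1 F2 P Q z) -> unit_im I ->
  F2 z0 = 0 -> F1 z0 + J0 ** F2 z0 <> 0 -> nbhs I V ->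
  (\forall z \near z0, cdnormsq (F1 z0 + J0 ** F2 z0) <= cdnormsq (F1 z + J0 ** F2 z)) ->
  (\forall z \near z0, forall K, V K -> unit_im K -> F2 z <> 0 -> conj_val (F1 z) (F2 z) K <> 0 ->
     cdnormsq (F1 z0 + J0 ** F2 z0) <= cdnormsq (F1 z + Tdir (F1 z) (F2 z) K ** F2 z)) ->
  exists2 J, unit_im J & \forall z \near z0, F1 z + J ** F2 z = F1 z0 + J0 ** F2 z0.
Proof.
move=> n1 H hI Y0 f0 nV M1 M2.
have aX : conj_val (F1 z0) (F2 z0) I <> 0.
  rewrite /conj_val Y0 cdconj0 cdmul0r addr0.
  by move=> h; apply: f0; rewrite Y0 cdmul0r addr0 -(cdconjK (F1 z0)) h cdconj0.
apply: (local_from_direction n1 H hI f0 aX); first by rewrite Y0 !cdmul0r.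
exists V => //; move: M1 M2; set B := cdnormsq _ => M1 M2.
have B0 : 0 <= B by exact: cdnormsq_ge0.
near=> z => K VK hK.
have [F20|F2z] := pselect (F2 z = 0).
  have : B <= cdnormsq (F1 z + J0 ** F2 z) by near: z.
  rewrite F20 cdmul0r addr0 => h.
  have -> : nu (F1 z) 0 = cdnormsq (F1 z) * cdnormsq (F1 z).
    by rewrite /nu /nrm0 /nrm1 (cdnormsqE 0) !cddot0r; ring.
  by rewrite conj_val_normsq// (cdnormsqE 0) cdmul0r !cddot0l mulr0 !addr0 ler_wpM2l ?cdnormsq_ge0.
have [a0|Az] := pselect (conj_val (F1 z) (F2 z) K = 0).
  by rewrite a0 (cdnormsqE 0) cddot0l mul0r nu_ge0.
have := conj_val_normsq_mul n4 hK (Tdir_rel F2z Az); rewrite /nu => <-.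
rewrite ler_wpM2l ?cdnormsq_ge0//.
have Mz : forall K, V K -> unit_im K -> F2 z <> 0 -> conj_val (F1 z) (F2 z) K <> 0 ->
     B <= cdnormsq (F1 z + Tdir (F1 z) (F2 z) K ** F2 z) by near: z.
exact: Mz.
Unshelve. all: by end_near.
Qed.

(** By the Cauchy-Riemann equations the derivatives of [F1] vanish with [F2]; the mean value theorem
    along radii concludes. *)
Lemma local_spherically_constant (F1 F2 P Q : plane R -> cd R n) z0 :
  (\forall z \near z0, stem_holo F1 F2 P Q z) ->
  (\forall z \near z0, F2 z = 0) -> \forall z \near z0, F1 z = F1 z0.
Proof.
move=> H Z.
have nZ : \forall z \near z0, \forall x \near z, F2 x = 0 by apply: near_join.
have [s s0 Hs] := near_esq (filterI H nZ).
have esq00 : esq z0 z0 < s ^+ 2 by rewrite /esq !subrr expr0n addr0 exprn_gt0.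
apply: filterS (near_esq_lt esq00) => z /ltW zs; apply: cd_dot_ext => w.
have [r [t [r0 rE zE]]] := polarP z0 z.
have hp (x : R) : `|x| <= `|r| -> is_derive x 1 (fun x : R => cddot w (F1 (polar z0 x t))) 0.
  move=> xr; have : esq z0 (polar z0 x t) <= s ^+ 2.
    by rewrite esq_polar -real_normK ?num_real// (le_trans _ zs)// -rE -[leRHS]real_normK ?num_real// lerXn2r ?nnegrE.
  move=> /Hs[Hz Zz]; have Hw := Hz w.
  have := holo_radial Hw.
  have [|p0 q0] := holo_at_zero_deriv (holo_rot Hw).
    by apply: filterS Zz => y ->; rewrite cddot0r.
  by rewrite p0 -[cddot w (P _)]opprK q0 oppr0 !mul0r subr0.
have [c _ E] := MVT_origin hp.
move: E; rewrite mul0r /= -zE => /eqP; rewrite subr_eq0 => /eqP ->.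
by rewrite /polar !mul0r !addr0; case: (z0).
Qed.
End LocalCases.

(** The classical argument: the maximum modulus principle for [1 / f]. *)
Lemma local_complex (R : realType) (F1 F2 P Q : plane R -> cd R 1) J0 z0 :
  (\forall z \near z0, stem_holo F1 F2 P Q z) -> unit_im J0 ->
  F1 z0 + J0 ** F2 z0 <> 0 ->
  (\forall z \near z0, cdnormsq (F1 z0 + J0 ** F2 z0) <= cdnormsq (F1 z + J0 ** F2 z)) ->
  \forall z \near z0, F1 z + J0 ** F2 z = F1 z0 + J0 ** F2 z0.
Proof.
move=> H h0 f0 M.
pose G z := F1 z + J0 ** F2 z.
pose u z := cddot (cdone R 1) (G z); pose v z := cddot (J0 ** cdone R 1) (G z).
have [J1 J2] : J0.1 = 0 :> R /\ (J0.2 : R) ^+ 2 = 1.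
  by have [/= j1 j2] := h0; split => //; move: j2; rewrite j1 expr0n add0r.
have uE z : u z = (G z).1 by rewrite /u /= mul1r mul0r addr0.
have vE z : v z = J0.2 * (G z).2 :> R by rewrite /v /= J1; ring.
have nG z : cdnormsq (G z) = u z * u z + v z * v z.
  rewrite uE vE; set g : R := (G z).2.
  have -> : J0.2 * g * (J0.2 * g) = J0.2 ^+ 2 * g ^+ 2 :> R by ring.
  by rewrite J2 mul1r -expr2.
have Gz0 : 0 < cdnormsq (G z0) by exact: cdnormsq_gt0.
have [s s0 Hs] := near_esq (filterI H M).
have nz w : esq z0 w <= s ^+ 2 -> u w * u w + v w * v w != 0.
  by move=> /Hs[_ Mw]; rewrite -nG gt_eqF// (lt_le_trans Gz0).
have hG w (hw : esq z0 w <= s ^+ 2) := @stem_holo_slice R 1 isT F1 F2 P Q J0 (cdone R 1) w (Hs w hw).1 h0.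
have := @max_modulus_disc R _ _ _ _ z0 s (ltW s0) (fun w hw => holo_inv (hG w hw) (nz w hw)).
have mE w : esq z0 w <= s ^+ 2 -> sqmod (fun w => u w * (u w * u w + v w * v w)^-1)
    (fun w => -1 * (v w * (u w * u w + v w * v w)^-1)) w = (cdnormsq (G w))^-1.
  by move=> hw; rewrite /sqmod nG; field; exact: nz.
move=> K.
have z0s : esq z0 z0 < s ^+ 2 by rewrite /esq !subrr expr0n addr0 exprn_gt0.
have {}K w : esq z0 w <= s ^+ 2 -> u w / cdnormsq (G w) = u z0 / cdnormsq (G z0) /\
    v w / cdnormsq (G w) = v z0 / cdnormsq (G z0).
  move=> hw; have [|k1 k2] := K _ w hw.
    move=> x hx; rewrite (mE _ hx) (mE _ (ltW z0s)) lef_pV2 ?posrE//; last first.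
      exact: lt_le_trans Gz0 (Hs _ hx).2.
    exact: (Hs _ hx).2.
  rewrite !nG; split; first exact: k1.
  by move: k2; rewrite !mulN1r => /oppr_inj.
apply: filterS (near_esq_lt z0s) => w /ltW hw.
have [k1 k2] := K w hw.
have Gw : 0 < cdnormsq (G w) by exact: lt_le_trans Gz0 (Hs _ hw).2.
have inv (x : plane R) : 0 < cdnormsq (G x) ->
    (u x / cdnormsq (G x)) ^+ 2 + (v x / cdnormsq (G x)) ^+ 2 = (cdnormsq (G x))^-1.
  by move=> Gx; rewrite !expr_div_n -mulrDl !expr2 -nG; field; rewrite gt_eqF.
have nE : cdnormsq (G w) = cdnormsq (G z0).
  have h1 := inv w Gw; apply: invr_inj; rewrite -h1 k1 k2; exact: inv.
have inj (a b : R) : a / cdnormsq (G w) = b / cdnormsq (G z0) -> a = b.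
  by rewrite nE; apply: mulIf; rewrite invr_eq0 gt_eqF.
have J20 : J0.2 != 0 :> R by apply/eqP => j; move: J2; rewrite j expr0n => /eqP; rewrite eq_sym oner_eq0.
apply: injective_projections; first by rewrite -!uE; exact: inj.
by apply: (mulfI J20); rewrite -!vE; exact: inj.
Qed.

(** * Slices and spheres of a circular set *)

Section SliceGeometry.
Variables (R : realType) (n : nat).
Implicit Types (z w : plane R) (I J K : cd R n) (D : set (plane R)) (Omega : set (cd R n)).

Lemma cdre_on_slice J z : unit_im J -> cdre (on_slice J z) = z.1.
Proof. by move=> [r0 _]; rewrite /on_slice cdreD !cdreZ cdre1 r0 mulr1 mulr0 addr0. Qed.

Lemma unit_imN J : unit_im J -> unit_im (- J).
Proof. by move=> [r0 n1]; split; rewrite ?cdnormsqN// cdre_dot cddotNr -cdre_dot r0 oppr0. Qed.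

Lemma on_slice_conj J z : on_slice J (plane_conj z) = on_slice (- J) z.
Proof. by rewrite /on_slice /= scalerN scaleNr. Qed.

Lemma plane_conjK z : plane_conj (plane_conj z) = z.
Proof. by case: z => a b; rewrite /plane_conj /= opprK. Qed.

Lemma cdim_on_slice J z : unit_im J -> cdim (on_slice J z) = (z.2 : R) *: J.
Proof.
move=> hJ; rewrite /cdim /on_slice cdconjD !cdconjZ cdconj1 (unit_im_conj hJ).
by vec; field.
Qed.

Lemma cdnorm_cdim_on_slice J z : unit_im J -> cdnorm (cdim (on_slice J z)) = `|z.2 : R|.
Proof. by move=> hJ; rewrite cdim_on_slice// /cdnorm cdnormsqZ hJ.2 mulr1 sqrtr_sqr. Qed.

Lemma on_slice_inj I J z w : unit_im I -> unit_im J -> on_slice I z = on_slice J w ->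
  w = z \/ w = plane_conj z.
Proof.
move=> hI hJ E.
have E1 : z.1 = w.1 by rewrite -(cdre_on_slice z hI) E cdre_on_slice.
have /eqP : `|z.2 : R| = `|w.2 : R| by rewrite -(cdnorm_cdim_on_slice z hI) E cdnorm_cdim_on_slice.
rewrite eqr_norm2 => /orP[/eqP E2|/eqP E2]; [left|right].
  by case: z w E1 E2 {E} => ? ? [? ?] /= -> ->.
by case: z w E1 E2 {E} => ? ? [? ?]; rewrite /plane_conj /= => -> ->; rewrite opprK.
Qed.

Lemma circularizes_mem D Omega J z : circularizes D Omega -> unit_im J ->
  Omega (on_slice J z) <-> D z.
Proof.
move=> [_ sD ->] hJ; split; last by move=> Dz; exists z, J; split => //; exact/imag_unitsP.
move=> [w [I [Dw /imag_unitsP hI E]]].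
by have [->|->] := on_slice_inj hI hJ (esym E); [|exact: sD].
Qed.

Lemma circularizes_inj D D' Omega J : unit_im J ->
  circularizes D Omega -> circularizes D' Omega -> D = D'.
Proof.
move=> hJ c c'; apply/seteqP; split => z.
  by move/(circularizes_mem z c hJ)/(circularizes_mem z c' hJ).
by move/(circularizes_mem z c' hJ)/(circularizes_mem z c hJ).
Qed.

Lemma on_slice_cont (p : plane R * cd R n) :
  {for p, continuous (fun p : plane R * cd R n => on_slice p.2 p.1)}.
Proof.
have c1 : p.1 @[p --> p] --> p.1 by exact: cvg_fst.
have c2 : p.2 @[p --> p] --> p.2 by exact: cvg_snd.
have c11 : p.1.1 @[p --> p] --> p.1.1 by apply: (cvg_comp _ _ c1); exact: cvg_fst.
have c12 : p.1.2 @[p --> p] --> p.1.2 by apply: (cvg_comp _ _ c1); exact: cvg_snd.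
apply: cvgD; first by apply: cvgZr_tmp.
exact: cvgZ.
Qed.

Lemma near_on_slice J z (V : set (cd R n)) : nbhs (on_slice J z) V ->
  exists2 W, nbhs J W & \forall w \near z, forall K, W K -> V (on_slice K w).
Proof.
move=> nV; have [[U W] /= [nU nW] UW] := @on_slice_cont (z, J) _ nV.
by exists W => //; apply: filterS nU => w Uw K WK; exact: (UW (w, K)).
Qed.

(** [slice_fun] evaluates the stem at [|beta|]: parity handles negative [beta], and forces [F2 = 0]
    on the real axis. *)
Lemma slice_fun_on_slice (F : stem R n) J z : unit_im J ->
  F.1 (plane_conj z) = F.1 z -> F.2 (plane_conj z) = - F.2 z ->
  slice_fun F (on_slice J z) = F.1 z + J ** F.2 z.
Proof.
move=> hJ E1 E2; rewrite /slice_fun /= cdnorm_cdim_on_slice// cdre_on_slice// cdim_on_slice//.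
have [p|m|e] := ltgtP 0 (z.2 : R).
- rewrite (gtr0_norm p) scalerA mulVf ?gt_eqF// scale1r.
  by case: z p {E1 E2}.
- have -> : (z.1, `|z.2 : R|) = plane_conj z by rewrite ltr0_norm.
  rewrite E1 E2 (ltr0_norm m) scalerA invrN mulNr mulVf ?lt_eqF// scaleN1r.
  by rewrite cdmulNl cdmulNr opprK.
- have zc : plane_conj z = z by case: z e {E1 E2} => a b /= e; rewrite /plane_conj /= -e oppr0.
  have F20 : F.2 z = 0.
    have FN : F.2 z = - F.2 z by rewrite -{2}zc E2 opprK.
    have h : (2 : R) *: F.2 z = 0 by rewrite scaler_nat mulr2n {1}FN addNr.
    by rewrite -[LHS]scale1r -(@mulVf R 2) ?pnatr_eq0// -scalerA h scaler0.
  have -> : (z.1, `|z.2 : R|) = z by rewrite -e normr0; case: z e {E1 E2 zc F20} => a b /= ->.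
  by rewrite F20 !cdmul0r.
Qed.
End SliceGeometry.

(** * [f^c], [N(f)], [f'_s] and [T_f] in terms of the stem *)

Section StemFunctions.
Variables (R : realType) (n : nat).
Hypothesis n4 : (n < 4)%N.
Implicit Types (z w : plane R) (I J K : cd R n) (D : set (plane R)) (Omega : set (cd R n)).

Lemma is_derive_conj (F : plane R -> cd R n) z v dF :
  is_derive z v F dF -> is_derive z v (fun x => cdconj (F x)) (cdconj dF).
Proof.
move=> [hF eF].
have cv : (fun h : R => h^-1 *: ((F \o shift z) (h *: v) - F z)) @ 0^' --> dF.
  by rewrite -eF; exact: hF.
have cw : (fun h : R => cdconj (h^-1 *: ((F \o shift z) (h *: v) - F z))) @ 0^' --> cdconj dF.
  apply: (@cvg_comp _ _ _ _ (@cdconj R n) _ _ _ cv).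
  by apply: cdconj_cont; exact: cvg_id.
have E : (fun h : R => cdconj (h^-1 *: ((F \o shift z) (h *: v) - F z))) =
    (fun h : R => h^-1 *: (((fun x => cdconj (F x)) \o shift z) (h *: v) - cdconj (F z))).
  by apply/funext => h; rewrite cdconjZ cdconjB.
rewrite E in cw; split; first by apply/cvg_ex; exists (cdconj dF).
by apply: cvg_lim cw => //; exact: norm_hausdorff.
Qed.

Lemma C1_on_conj D (F : plane R -> cd R n) : open D -> C1_on D F -> C1_on D (fun x => cdconj (F x)).
Proof.
move=> oD C z Dz; have [h1 h2 h3 h4] := C z Dz.
have H v : derivable F z v -> is_derive z v (fun x => cdconj (F x)) (cdconj ('D_v F z)).
  by move=> h; exact: is_derive_conj (derivableP h).
have K v : (forall w, D w -> derivable F w v) -> {for z, continuous ('D_v F)} ->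
    {for z, continuous ('D_v (fun x => cdconj (F x)))}.
  move=> hv cF.
  have E w : D w -> 'D_v (fun x => cdconj (F x)) w = cdconj ('D_v F w).
    by move=> Dw; have [_] := is_derive_conj (derivableP (hv w Dw)).
  rewrite /prop_for /continuous_at (E z Dz).
  apply: cvg_trans (cdconj_cont cF); apply: near_eq_cvg.
  have : \forall w \near z, D w by exact: open_nbhs_nbhs.
  by apply: filterS => w /E ->.
split.
- by have [] := H _ h1.
- by have [] := H _ h2.
- by apply: K h3 => w /C[].
- by apply: K h4 => w /C[].
Qed.

Lemma regular_stem_conj D (F : stem R n) : open D -> regular_stem D F ->
  regular_stem D ((fun z => cdconj (F.1 z)), (fun z => cdconj (F.2 z))).
Proof.
move=> oD [C1 C2 par CR]; split => /=; try exact: C1_on_conj.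
  by move=> z /par[-> ->]; rewrite cdconjN.
have E (G : plane R -> cd R n) z v : derivable G z v -> 'D_v (fun x => cdconj (G x)) z = cdconj ('D_v G z).
  by move=> h; have [_] := is_derive_conj (derivableP h).
move=> z Dz; have [e1 e2] := CR z Dz; have [h1 h2 _ _] := C1 z Dz; have [h3 h4 _ _] := C2 z Dz.
by rewrite /d_alpha /d_beta !E// -cdconjN; split; congr cdconj.
Qed.

Variables (D : set (plane R)) (Omega : set (cd R n)) (f : cd R n -> cd R n).
Local Notation F := (stem_of Omega f).
Hypotheses (hC : circularizes D Omega) (oD : open D) (reg : regular_stem D F) (ind : induces D F f).

Let par z : D z -> F.1 (plane_conj z) = F.1 z /\ F.2 (plane_conj z) = - F.2 z.
Proof. by have [_ _ h _] := reg; exact: h. Qed.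

Lemma slice_conj_on_slice I z : D z -> unit_im I ->
  slice_conj Omega f (on_slice I z) = conj_val (F.1 z) (F.2 z) I.
Proof.
move=> Dz hI; have [p1 p2] := par Dz.
by rewrite /slice_conj slice_fun_on_slice //= ?p1 ?p2 ?cdconjN.
Qed.

(** [slice_prod] sees [f^c] only through a chosen stem; its values at [I] and [- I] identify that
    stem on [D] with the conjugate of [F]. *)
Lemma normal_fun_on_slice I z : D z -> unit_im I ->
  Defs.normal_fun Omega f (on_slice I z) = nrm0 (F.1 z) (F.2 z) *: cdone R n + nrm1 (F.1 z) (F.2 z) *: I.
Proof.
move=> Dz hI.
pose fc := slice_conj Omega f.
pose Fc : stem R n := ((fun z => cdconj (F.1 z)), (fun z => cdconj (F.2 z))).
have hFc : is_stem_of Omega fc Fc.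
  exists D; split => //; first exact: regular_stem_conj.
  by move=> w J Dw /imag_unitsP hJ; rewrite /fc slice_conj_on_slice.
have [D' [hC' oD' _ ind']] : is_stem_of Omega fc (stem_of Omega fc).
  exact: (xgetPex _ (ex_intro _ Fc hFc)).
have DD : D' = D by exact: circularizes_inj hI hC' hC.
rewrite {}DD in hC' oD' ind'.
set G := stem_of Omega fc in ind'.
have GE w : D w -> G.1 w = cdconj (F.1 w) /\ G.2 w = cdconj (F.2 w).
  move=> Dw.
  have := ind' w (- I) Dw ((imag_unitsP (- I)).2 (unit_imN hI)).
  have := ind' w I Dw ((imag_unitsP I).2 hI).
  rewrite /fc !slice_conj_on_slice//; last exact: unit_imN.
  rewrite /conj_val !cdmulNl => e1 e2.
  have H (a b c d : cd R n) : a + b = c + d -> a - b = c - d -> c = a.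
    move=> h1 h2; have : (2 : R) *: c = (2 : R) *: a.
      have -> : (2 : R) *: c = (c + d) + (c - d) by vec; ring.
      by rewrite -h1 -h2; vec; ring.
    move=> h; have := congr1 (fun x => (2 : R)^-1 *: x) h.
    by rewrite !scalerA mulVf ?pnatr_eq0// !scale1r.
  have G1 := H _ _ _ _ e1 e2.
  split => //; move: e1; rewrite G1 => /addrI h.
  have I0 : I <> 0 by move=> I0; have := hI.2; rewrite I0 cdnormsqE cddot0l => /esym/eqP; rewrite oner_eq0.
  exact: (cd_mull_inj n4 I0 (esym h)).
have [p1 p2] := par Dz; have Dz' : D (plane_conj z) by have [_ sD _] := hC; exact: sD.
have [g1 g2] := GE _ Dz; have [g1' g2'] := GE _ Dz'.
rewrite /Defs.normal_fun /slice_prod slice_fun_on_slice //= -/fc -/G ?g1 ?g2 ?g1' ?g2' ?p1 ?p2.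
- have := cd_polarr (F.1 z) (F.2 z) (cdone R n) n4; rewrite !cdmul1l => ->.
  by rewrite !cdmul_conj /nrm0 /nrm1 cdmulZr cdmul1r -scalerBl.
- by rewrite cdconjN cdmulNl cdmulNr opprK.
- by rewrite cdconjN cdmulNl cdmulNr opprD.
Qed.

Lemma spherical_derivative_on_slice I z : D z -> unit_im I -> z.2 != 0 :> R ->
  spherical_derivative f (on_slice I z) = (z.2 : R)^-1 *: F.2 z.
Proof.
move=> Dz hI z20; have [p1 p2] := par Dz.
have Dz' : D (plane_conj z) by have [_ sD _] := hC; exact: sD.
have cj : cdconj (on_slice I z) = on_slice I (plane_conj z).
  by rewrite on_slice_conj /on_slice cdconjD !cdconjZ cdconj1 (unit_im_conj hI).
rewrite /spherical_derivative cj !ind//; try exact/imag_unitsP.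
rewrite p1 p2 cdim_on_slice// /cdinv cdnormsqZ hI.2 mulr1 cdconjZ (unit_im_conj hI).
rewrite cdmulNr opprD addrACA subrr add0r opprK cdmulZl cdmulZl cdmulNl cdmulDr unit_imK//.
by vec; field.
Qed.

Lemma sd_zeros_on_slice I z : D z -> unit_im I -> z.2 != 0 :> R ->
  sd_zeros Omega f (on_slice I z) <-> F.2 z = 0.
Proof.
move=> Dz hI z20; split.
  move=> [_ /=]; rewrite spherical_derivative_on_slice// => h.
  have := congr1 (fun x => (z.2 : R) *: x) h.
  by rewrite scalerA divff// scale1r scaler0.
move=> F20; split; last by rewrite /= spherical_derivative_on_slice// F20 scaler0.
split; first exact/(circularizes_mem _ hC hI).
move=> [a E]; have := cdnorm_cdim_on_slice z hI.
rewrite E /cdim cdconjZ cdconj1 subrr scaler0 /cdnorm cdnormsqE cddot0l sqrtr0 => /esym/eqP.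
by rewrite normr_eq0 (negPf z20).
Qed.

Lemma Omega''_on_slice I z : D z -> unit_im I -> z.2 != 0 :> R -> F.2 z <> 0 ->
  nu (F.1 z) (F.2 z) != 0 -> Omega'' Omega f (on_slice I z).
Proof.
move=> Dz hI z20 F20 nz; have Oz : Omega (on_slice I z) by exact/(circularizes_mem _ hC hI).
split; first split => //.
  move=> [_ /=]; rewrite normal_fun_on_slice// => h.
  by move: nz; rewrite /nu -(normsq_slice _ _ hI) h cdnormsqE cddot0l eqxx.
move=> [|/(sd_zeros_on_slice Dz hI z20)//].
move=> [a E]; have := cdnorm_cdim_on_slice z hI.
rewrite E /cdim cdconjZ cdconj1 subrr scaler0 /cdnorm cdnormsqE cddot0l sqrtr0 => /esym/eqP.
by rewrite normr_eq0 (negPf z20).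
Qed.

(** The real factor of [f'_s] cancels, and by the alternative laws the real part of the point comes
    out unchanged. *)
Lemma T_map_on_slice I z : D z -> unit_im I -> z.2 != 0 :> R -> F.2 z <> 0 ->
  conj_val (F.1 z) (F.2 z) I <> 0 ->
  T_map Omega f (on_slice I z) = on_slice (Tdir (F.1 z) (F.2 z) I) z.
Proof.
move=> Dz hI z20 F20 a0.
have Fp := cdnormsq_gt0 F20; have ap := cdnormsq_gt0 a0.
rewrite /T_map slice_conj_on_slice// spherical_derivative_on_slice//.
rewrite /on_slice /Tdir; set a := conj_val _ _ _ in a0 ap *; set Y := F.2 z in F20 Fp *.
rewrite /cdinv cdnormsqZ cdconjZ cdmulDl !cdmulZl cdmul1l cdmulDl !cdmulZl !cdmulZr.
rewrite cdmulDr !cdmulZr cd_altl// cdmulDl !cdmulZl cdmul_conj.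
vec; field.
by rewrite z20 !gt_eqF.
Qed.
End StemFunctions.

(** * The local form of the theorem *)

Section LocalTheorem.
Variables (R : realType).
Implicit Types (z w : plane R).

(** [affine_local_min] identifies [J0] with the unit opposite to the imaginary part of [F1 conj F2],
    which minimizes on the whole sphere. As the gap is positive, this unit [T z] depends
    continuously on [z] and remains in [W]. *)
Lemma near_sphere_min n (F1 F2 P Q : plane R -> cd R n) J0 z0 (W : set (cd R n)) (B : R) :
  (n < 4)%N -> (1 < n)%N ->
  (\forall z \near z0, stem_holo F1 F2 P Q z) -> unit_im J0 ->
  0 < gap (F1 z0) (F2 z0) -> nbhs J0 W ->
  cdnormsq (F1 z0 + J0 ** F2 z0) = B ->
  (\forall z \near z0, forall J, W J -> unit_im J -> B <= cdnormsq (F1 z + J ** F2 z)) ->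
  \forall z \near z0, forall J, unit_im J -> B <= cdnormsq (F1 z + J ** F2 z).
Proof.
move=> n4 n1 H h0 g0 nW BE M.
pose v z := F1 z ** cdconj (F2 z).
have Mz0 := nbhs_singleton M.
have [||vE s0] := @affine_local_min R n (v z0) J0 h0.
- exact: unit_orth.
- move=> K hK IK; have [d d0 Hd] := rot_near K nW; exists d => // t td.
  have hr := unit_rot_unit t h0 hK IK.
  by have := Mz0 _ (Hd t td) hr; rewrite -BE !fv_normsq// -/(v z0); lra.
set s := cddot (v z0) J0 in vE s0.
have gE z : cdnormsq (im_part (v z)) = gap (F1 z) (F2 z) by exact: gap_v.
have sE : Num.sqrt (gap (F1 z0) (F2 z0)) = - s.
  by rewrite -gE vE cdnormsqZ h0.2 mulr1 sqrtr_sqr ler0_norm.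
pose T z := - (Num.sqrt (gap (F1 z) (F2 z)))^-1 *: im_part (v z).
have s1 : s != 0 by rewrite -oppr_eq0 -sE gt_eqF// sqrtr_gt0.
have TE : T z0 = J0 by rewrite /T vE sE invrN opprK scalerA mulVf// scale1r.
have [c1 c2] := stem_holo_cont (nbhs_singleton H).
have cv : {for z0, continuous v} by exact: (cdmul_cont c1 (cdconj_cont c2)).
have ci : {for z0, continuous (fun z => im_part (v z))}.
  have cr : {for z0, continuous (fun z => cdre (v z) : R)}.
    by apply: (cvg_comp _ _ cv); exact: cdre_cont.
  by apply: cvgB => //; exact: cvgZr_tmp.
have cg : {for z0, continuous (fun z => gap (F1 z) (F2 z) : R)}.
  have -> : (fun z => gap (F1 z) (F2 z)) = (fun z => cdnormsq (im_part (v z))) by apply/funext => z; rewrite gE.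
  exact: cdnormsq_cont.
have cs : {for z0, continuous (fun z => Num.sqrt (gap (F1 z) (F2 z)) : R)}.
  exact: (continuous_comp cg (@sqrt_continuous R _)).
have cT : {for z0, continuous T}.
  apply: cvgZ => //; apply: cvgN; apply: cvgV => //.
  by rewrite sE oppr_eq0.
have nT : \forall z \near z0, W (T z) by apply: cT; rewrite TE.
have ng : \forall z \near z0, 0 < gap (F1 z) (F2 z).
  by have /cvgr_gt := cg; apply.
near=> z => J hJ.
have gz : 0 < gap (F1 z) (F2 z) by near: z.
have WT : W (T z) by near: z.
have Mz : forall J, W J -> unit_im J -> B <= cdnormsq (F1 z + J ** F2 z) by near: z.
set m := Num.sqrt (gap (F1 z) (F2 z)).
have m0 : 0 < m by rewrite sqrtr_gt0.
have m2 : m ^+ 2 = gap (F1 z) (F2 z) by rewrite sqr_sqrtr// ltW.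
have hT : unit_im (T z).
  split; first by rewrite /T cdreZ im_part_re mulr0.
  by rewrite /T -/m cdnormsqZ gE -m2 sqrrN exprVn mulVf// expf_neq0// gt_eqF.
apply: le_trans (Mz _ WT hT) _; rewrite !fv_normsq// -/(v z) lerD2l ler_pM2l//.
have -> : cddot (v z) (T z) = - m.
  rewrite -(dot_im_part (v z) hT.1) /T -/m cddotZr -cdnormsqE gE -m2.
  by field; rewrite gt_eqF.
have := cauchy_unit (v z) hJ; rewrite gE -m2 => /(sqr_le_norm (ltW m0)).
by rewrite ler_norml => /andP[].
Unshelve. all: by end_near.
Qed.

Lemma cd_norm_le1 n (x : cd R n) : cdnormsq x <= 1 -> `|x| <= 1.
Proof.
elim: n x => [|n IH] x /=.
  by move=> h; apply: sqr_le_norm; rewrite ?expr1n.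
move: x => [x1 x2] /= h; have a1 := cdnormsq_ge0 x1; have a2 := cdnormsq_ge0 x2.
by rewrite prod_normE ge_max !IH//=; lra.
Qed.

Lemma near_real_sphere n (J0 : cd R n) z0 (V : set (cd R n)) : z0.2 = 0 :> R ->
  nbhs (on_slice J0 z0) V -> \forall z \near z0, forall J, unit_im J -> V (on_slice J z).
Proof.
move=> z00 /nbhs_ballP[e e0 He].
apply/near_plane; exists (e / 2); first by rewrite divr_gt0.
move=> z z1 z2 J hJ; apply: He; rewrite -ball_normE /=.
have -> : on_slice J0 z0 - on_slice J z = (z0.1 - z.1 : R) *: cdone R n - (z.2 : R) *: J.
  by rewrite /on_slice z00; vec; ring.
apply: le_lt_trans (ler_normB _ _) _; rewrite !normrZ (splitr e).
have h1 : `|cdone R n| <= 1 by rewrite cd_norm_le1// cdnormsq1.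
have h2 : `|J| <= 1 by rewrite cd_norm_le1// hJ.2.
apply: ltrD.
  by apply: (@le_lt_trans _ _ `|z0.1 - z.1 : R|); rewrite ?ler_piMr// distrC.
by apply: (@le_lt_trans _ _ `|z.2 : R|); [rewrite ler_piMr|move: z2; rewrite z00 subr0].
Qed.

Lemma ler_cdnorm n (x y : cd R n) : (cdnorm x <= cdnorm y) = (cdnormsq x <= cdnormsq y).
Proof. by rewrite /cdnorm ler_sqrt// cdnormsq_ge0. Qed.

Lemma local_minimum n (D : set (plane R)) (Omega : set (cd R n)) (f : cd R n -> cd R n) J0 z0 :
  (0 < n < 4)%N -> circularizes D Omega -> open D ->
  regular_stem D (stem_of Omega f) -> induces D (stem_of Omega f) f ->
  D z0 -> unit_im J0 ->
  local_min_norm Omega f (on_slice J0 z0) -> f (on_slice J0 z0) <> 0 ->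
  (frontier (sd_zeros Omega f) (on_slice J0 z0) ->
     min_on_circular_nbhs Omega f (on_slice J0 z0) \/ T_extends_to Omega f (on_slice J0 z0)) ->
  exists2 J, unit_im J & \forall z \near z0,
    (stem_of Omega f).1 z + J ** (stem_of Omega f).2 z = f (on_slice J0 z0).
Proof.
move=> /andP[npos n4] hC oD reg ind Dz0 h0.
set F := stem_of Omega f in reg ind *.
have indJ J z : D z -> unit_im J -> f (on_slice J z) = F.1 z + J ** F.2 z.
  by move=> Dz hJ; apply: ind => //; exact/imag_unitsP.
set x0 := on_slice J0 z0 => hmin hnz hadd.
have fx0 : f x0 = F.1 z0 + J0 ** F.2 z0 by exact: indJ.
have nD : \forall z \near z0, D z by exact: open_nbhs_nbhs.
have H : \forall z \near z0, stem_holo F.1 F.2 (d_alpha F.1) (d_alpha F.2) z.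
  by apply: filterS nD => z Dz; exact: (regular_stem_holo oD reg Dz).
pose B := cdnormsq (F.1 z0 + J0 ** F.2 z0).
pose V : set (cd R n) := [set x | Omega x -> B <= cdnormsq (f x)].
have nV : nbhs x0 V.
  by have [_] := hmin; apply: filterS => x hx Ox; rewrite /B -fx0 -ler_cdnorm; exact: hx.
have VJ z J : D z -> unit_im J -> V (on_slice J z) -> B <= cdnormsq (F.1 z + J ** F.2 z).
  by move=> Dz hJ; rewrite -indJ//; apply; exact/(circularizes_mem _ hC hJ).
have [W nW HW] := near_on_slice nV.
have M : \forall z \near z0, forall J, W J -> unit_im J -> B <= cdnormsq (F.1 z + J ** F.2 z).
  near=> z => J WJ hJ; have Dz : D z by near: z.
  have Wz : forall K, W K -> V (on_slice K z) by near: z.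
  by apply: VJ => //; exact: Wz.
have M0 : \forall z \near z0, B <= cdnormsq (F.1 z + J0 ** F.2 z).
  by apply: filterS M => z; apply => //; exact: nbhs_singleton.
have f0 : F.1 z0 + J0 ** F.2 z0 <> 0 by rewrite -fx0.
rewrite fx0.
have [n1|n1] : n = 1%N \/ (1 < n)%N by case: (n) npos => [//|[|m]] _; [left|right].
  subst n; exists J0 => //; exact: local_complex H h0 f0 M0.
have Dconj z : D z -> D (plane_conj z) by have [_ + _] := hC; apply.
have par z : D z -> F.1 (plane_conj z) = F.1 z /\ F.2 (plane_conj z) = - F.2 z.
  by have [_ _ + _] := reg; apply.
(* At a real point [F2] vanishes by parity and nearby spheres lie entirely in [V]. *)
have [z00|z0n] := eqVneq (z0.2 : R) 0.
  have zc : plane_conj z0 = z0 by case: (z0) z00 => a b /= ->; rewrite /plane_conj /= oppr0.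
  have F20 : F.2 z0 = 0.
    have [_] := par _ Dz0; rewrite zc => h.
    have h2 : (2 : R) *: F.2 z0 = 0 by rewrite scaler_nat mulr2n {1}h addNr.
    by rewrite -[LHS]scale1r -(@mulVf R 2) ?pnatr_eq0// -scalerA h2 scaler0.
  apply: (local_sphere_min n4 n1 H h0 f0); first by right.
  near=> z => J hJ; have Dz : D z by near: z.
  have Vz : forall J, unit_im J -> V (on_slice J z).
    by near: z; exact: near_real_sphere nV.
  by apply: VJ => //; exact: Vz.
have nz2 : \forall z \near z0, z.2 != 0 :> R.
  apply/near_plane; exists `|z0.2 : R|; first by rewrite normr_gt0.
  by move=> z _ h; apply: contraTneq h => ->; rewrite sub0r normrN ltxx.
(* Off [V(f'_s)], the gap tells whether [|f|] is constant on the sphere of [x0]. *)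
have [F20|F2n] := pselect (F.2 z0 = 0); last first.
  have [g0|gn] := eqVneq (gap (F.1 z0) (F.2 z0)) 0.
    exact: (local_gap0 n4 n1 H h0 F2n g0 f0 nW M).
  have g0 : 0 < gap (F.1 z0) (F.2 z0).
    by rewrite lt_neqAle eq_sym gn -gap_v// cdnormsq_ge0.
  apply: (local_sphere_min n4 n1 H h0 f0); first by left.
  exact: (near_sphere_min n4 n1 H h0 g0 nW erefl M).
have sdz : sd_zeros Omega f x0 by apply/(sd_zeros_on_slice n4 hC reg ind Dz0 h0 z0n).
have [intr|nint] := pselect (interior (sd_zeros Omega f) x0).
  have [W' nW' HW'] := near_on_slice intr.
  have F2z : \forall z \near z0, F.2 z = 0.
    near=> z; have Dz : D z by near: z.
    have z2 : z.2 != 0 :> R by near: z.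
    have Wz : forall K, W' K -> sd_zeros Omega f (on_slice K z) by near: z.
    by apply/(sd_zeros_on_slice n4 hC reg ind Dz h0 z2); apply: Wz; exact: nbhs_singleton.
  exists J0 => //; have F1z := local_spherically_constant H F2z.
  by near=> z; have -> : F.2 z = 0 by [near: z]; have -> : F.1 z = F.1 z0 by [near: z]; rewrite F20.
case: hadd.
- by split => //; exact: subset_closure.
- move=> [C [[Dc hDc] nC CO CM]].
  have [W' nW' HW'] := near_on_slice nC.
  apply: (local_sphere_min n4 n1 H h0 f0); first by right.
  near=> z => J hJ; have Dz : D z by near: z.
  have Wz : forall K, W' K -> C (on_slice K z) by near: z.
  have Dcz : Dc z by apply/(circularizes_mem _ hDc h0); apply: Wz; exact: nbhs_singleton.
  have Cz : C (on_slice J z) by exact/(circularizes_mem _ hDc hJ).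
  by have := CM _ Cz; rewrite ler_cdnorm fx0 indJ.
- move=> [w0 [U [G [[z [J [I [/imag_unitsP hJ /imag_unitsP hI ex0 ew0]]]] [oU Uw0 UO] cG GT Gw0]]]].
  have {I hI ew0} [I hI ew0] : exists2 I, unit_im I & w0 = on_slice I z0.
    (* [x0] may be written with the conjugate of [z0], which changes the sign of [I]. *)
    have [->|->] := on_slice_inj hJ h0 (esym ex0).
      by exists I.
    by exists (- I); [exact: unit_imN|rewrite -on_slice_conj plane_conjK].
  set A := Omega'' Omega f `|` U in cG.
  have Aw0 : A w0 by right.
  (* As the extension is continuous at [w0] with value [x0], near [w0] it takes values where [|f|]
     is at least [|f(x0)|]. *)
  have cw : \forall x \near w0, A x -> V (G x).
    have h : G @ within A (nbhs w0) --> G w0 by have /subspace_continuousP/(_ w0 Aw0) := cG.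
    by rewrite Gw0 in h; exact: (h _ nV).
  rewrite ew0 in cw; have [W' nW' HW'] := near_on_slice cw.
  have nu0 : nu (F.1 z0) (F.2 z0) != 0.
    rewrite /nu /nrm0 /nrm1 F20 cddot0r mulr0 expr0n addr0 (cdnormsqE 0) cddot0r subr0 expf_neq0//.
    by rewrite gt_eqF// cdnormsq_gt0//; move: f0; rewrite F20 cdmul0r addr0.
  have nnu : \forall z \near z0, nu (F.1 z) (F.2 z) != 0.
    have : 0 < nu (F.1 z0) (F.2 z0) by rewrite lt_neqAle eq_sym nu0 nu_ge0.
    move=> Np; have /cvgr_gt/(_ _ Np) := stem_holo_nu_cont (nbhs_singleton H).
    by apply: filterS => x; apply: lt0r_neq0.
  apply: (local_degenerate n4 n1 H hI F20 f0 nW' M0).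
  near=> x => K WK hK F2x ax.
  have Dx : D x by near: x.
  have x2 : x.2 != 0 :> R by near: x.
  have nx : nu (F.1 x) (F.2 x) != 0 by near: x.
  have Wx : forall K, W' K -> A (on_slice K x) -> V (G (on_slice K x)) by near: x.
  have Ox := Omega''_on_slice n4 hC oD reg ind Dx hK x2 F2x nx.
  have := Wx _ WK (or_introl Ox); rewrite GT// (T_map_on_slice n4 hC reg ind Dx hK x2 F2x ax).
  by apply: VJ => //; exact: Tdir_unit.
Unshelve. all: by end_near.
Qed.
End LocalTheorem.

(** * From local to global *)

Section Global.
Variables (R : realType).
Implicit Types (z w : plane R) (D E : set (plane R)).

Lemma slice_constant_connected n D E (F : stem R n) (J d : cd R n) z0 :
  (n < 4)%N -> open D -> regular_stem D F -> unit_im J -> connected E -> E `<=` D -> E z0 ->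
  (\forall z \near z0, F.1 z + J ** F.2 z = d) ->
  forall z, E z -> F.1 z + J ** F.2 z = d.
Proof.
move=> n4 oD reg hJ cE ED Ez0 Hd z Ez; apply: cd_dot_ext => e.
have H w (Dw : D w) := stem_holo_slice n4 e (regular_stem_holo oD reg Dw) hJ.
have := @identity_theorem R D E _ _ _ _ z0 oD cE ED (fun w Dw =>
  holo_lin 1 (-1) (H w Dw) (holo_at_cst (cddot e d) (cddot (J ** e) d) w)) Ez0.
move=> IT; have [|+ _] := IT _ z Ez.
  by apply: filterS Hd => w ->; split; ring.
by rewrite mul1r mulN1r => /eqP; rewrite subr_eq0 => /eqP.
Qed.

Lemma connected_half_plane E z0 : connected E -> (forall z, E z -> z.2 != 0 :> R) -> E z0 ->
  0 < z0.2 :> R -> forall z, E z -> 0 < z.2 :> R.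
Proof.
move=> cE nz Ez0 p0.
have c2 : continuous (fun z : plane R => z.2 : R) by move=> z; exact: cvg_snd.
have EE : E `&` [set z | 0 < z.2 :> R] = E.
  apply: cE.
  - by exists z0.
  - exists [set z | 0 < z.2 :> R] => //.
    by apply: (@open_comp _ _ (fun z : plane R => z.2 : R) [set x | 0 < x]) => //; exact: open_gt.
  - exists [set z | 0 <= z.2 :> R].
      by apply: (@closed_comp _ _ (fun z : plane R => z.2 : R) [set x | 0 <= x]) => //; exact: closed_ge.
    apply/seteqP; split => z [Ez /= z2]; split => //=; first exact: ltW.
    by rewrite lt_neqAle eq_sym nz.
by move=> z; rewrite -EE => -[].
Qed.

Lemma connected_half_planeN E z0 : connected E -> (forall z, E z -> z.2 != 0 :> R) -> E z0 ->
  z0.2 < 0 :> R -> forall z, E z -> z.2 < 0 :> R.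
Proof.
move=> cE nz Ez0 p0.
have c2 : continuous (fun z : plane R => z.2 : R) by move=> z; exact: cvg_snd.
have EE : E `&` [set z | z.2 < 0 :> R] = E.
  apply: cE.
  - by exists z0.
  - exists [set z | z.2 < 0 :> R] => //.
    by apply: (@open_comp _ _ (fun z : plane R => z.2 : R) [set x | x < 0]) => //; exact: open_lt.
  - exists [set z | z.2 <= 0 :> R].
      by apply: (@closed_comp _ _ (fun z : plane R => z.2 : R) [set x | x <= 0]) => //; exact: closed_le.
    apply/seteqP; split => z [Ez /= z2]; split => //=; first exact: ltW.
    by rewrite lt_neqAle nz.
by move=> z; rewrite -EE => -[].
Qed.
End Global.

Theorem theorem5p4 (R : realType) (n : nat) (hn : n \in [:: 1; 2; 3]%N)
    (Omega : set (cd R n)) (f : cd R n -> cd R n) (x0 : cd R n)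
    (hcirc : circular Omega) (hopen : open Omega)
    (hf : slice_regular Omega f)
    (hmin : local_min_norm Omega f x0) (hnz : f x0 <> 0)
    (hadd : frontier (sd_zeros Omega f) x0 ->
       min_on_circular_nbhs Omega f x0 \/ T_extends_to Omega f x0) :
  (slice_domain Omega -> exists c, forall x, Omega x -> f x = c) /\
  (product_domain Omega ->
     exists2 J, imag_units J & forall x, half_slice Omega J x -> f x = f x0).
Proof.
have n04 : (0 < n < 4)%N by move: hn; rewrite !inE => /or3P[] /eqP ->.
have n4 : (n < 4)%N by case/andP: n04.
have [D [hC oD reg ind]] : is_stem_of Omega f (stem_of Omega f) by exact: (xgetPex _ hf).
set F := stem_of Omega f in reg ind.
have [z0 [J0 [Dz0 /imag_unitsP h0 ex0]]] : exists z J, [/\ D z, imag_units J & x0 = on_slice J z].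
  by have [_ _ OE] := hC; have [Ox0 _] := hmin; rewrite OE in Ox0.
subst x0.
have [J hJ HJ] := local_minimum n04 hC oD reg ind Dz0 h0 hmin hnz hadd.
rewrite -/F in HJ; set d := f (on_slice J0 z0) in HJ *.
have par z : D z -> F.1 (plane_conj z) = F.1 z /\ F.2 (plane_conj z) = - F.2 z.
  by have [_ _ + _] := reg; apply.
have Dconj z : D z -> D (plane_conj z) by have [_ + _] := hC; apply.
have indJ I z : D z -> unit_im I -> f (on_slice I z) = F.1 z + I ** F.2 z.
  by move=> Dz hI; apply: ind => //; exact/imag_unitsP.
split.
- move=> [D' [hC' _ cD' _]].
  have DD : D' = D by exact: circularizes_inj h0 hC' hC.
  rewrite DD in cD'.
  have K := slice_constant_connected n4 oD reg hJ cD' (@subset_refl _ D) Dz0 HJ.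
  exists d => x Ox; have [_ _ OE] := hC; move: Ox; rewrite OE => -[z [I [Dz /imag_unitsP hI ->]]].
  (* The value [d] is taken at [z] and at its conjugate, so [F1 + J F2 = F1 - J F2 = d] and [F2]
     vanishes. *)
  rewrite indJ//; have := K _ Dz; have := K _ (Dconj _ Dz); have [-> ->] := par _ Dz.
  rewrite cdmulNr => k1 k2.
  have JF : J ** F.2 z = 0.
    have : (2 : R) *: (J ** F.2 z) = 0.
      by rewrite -(subrr d) -{1}k2 -k1; vec; ring.
    by move=> h; rewrite -[LHS]scale1r -(@mulVf R 2) ?pnatr_eq0// -scalerA h scaler0.
  have F20 : F.2 z = 0 by rewrite -[LHS]opprK -(unit_imK (F.2 z) n4 hJ) JF cdmul0r oppr0.
  by move: k2; rewrite F20 !cdmul0r.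
- move=> [D' [hC' _ nzD [D1 [D2 [D12 comp c12 c21]]]]].
  have DD : D' = D by exact: circularizes_inj h0 hC' hC.
  rewrite {}DD in nzD comp.
  pose E := connected_component D z0.
  have Ez0 : E z0 by exact: connected_component_refl.
  have ED : E `<=` D by exact: connected_component_sub.
  have cE : connected E by exact: component_connected.
  have K := slice_constant_connected n4 oD reg hJ cE ED Ez0 HJ.
  have nzE z : E z -> z.2 != 0 :> R by move=> /ED/nzD.
  (* Conjugation exchanges the two components, one of which is [E]. *)
  have cover z : D z -> E z \/ E (plane_conj z).
    move=> Dz.
    have DE w : D w -> connected_component D w = D1 \/ connected_component D w = D2.
      move=> Dw; have : [set D1; D2] (connected_component D w) by rewrite -comp; exists w.
      by move=> [->|->]; [left|right].
    have zz : connected_component D z z by exact: connected_component_refl.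
    have := DE z Dz; have := DE z0 Dz0; rewrite -/E => e1 e2.
    have [e|ne] := pselect (connected_component D z = E); first by left; rewrite -e.
    right; have : @plane_conj R @` connected_component D z = E.
      by case: e1 e2 ne => -> [->|->].
    by move=> <-; exists z.
  have fin I : unit_im I -> (forall z, D z -> 0 < z.2 :> R -> F.1 z + I ** F.2 z = d) ->
      exists2 J, imag_units J & forall x, half_slice Omega J x -> f x = d.
    move=> hI H; exists I; first exact/imag_unitsP.
    move=> x [Ox [z zp ex]]; rewrite ex in Ox *.
    have Dz : D z by exact/(circularizes_mem _ hC hI).
    by rewrite indJ// H.
  have [p|m|e] := ltgtP 0 (z0.2 : R); last by move: (nzE _ Ez0); rewrite -e eqxx.
  + apply: (fin J hJ) => z Dz zp; apply: K.
    have [//|Ez] := cover z Dz.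
    by have := connected_half_plane cE nzE Ez0 p Ez; rewrite /= oppr_gt0 ltNge (ltW zp).
  (* Here [E] lies in the lower half plane, which the slice of [J] maps to the upper half slice of
     [- J]. *)
  + apply: (fin (- J) (unit_imN hJ)) => z Dz zp.
    have [Ez|Ez] := cover z Dz.
      by have := connected_half_planeN cE nzE Ez0 m Ez; rewrite ltNge (ltW zp).
    have := K _ Ez; have [-> ->] := par _ Dz.
    by rewrite cdmulNr cdmulNl.
Qed.
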